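(* Let $d \geq 2$ and let $P \subset \mathbb{R}^{d}$ be a closed convex cone which is pointed ($P \cap -P=\{0\}$) and spanning ($P-P=\mathbb{R}^{d}$). Let $A$ be a $P$-module, $k \in \{1,2,\dots\}\cup\{\infty\}$, $\mathcal{K}$ a separable Hilbert space of dimension $k$, and let $V$ be the isometric representation of $P$ on $L^{2}(A)\otimes\mathcal{K}$ associated to $A$ of multiplicity $k$. For $x\in P$ let $E_x=V_xV_x^{*}$ and $E_x^{\perp}=1-E_x$. Let $M$ be the commutant of the von Neumann algebra generated by $\{V_x:x\in P\}$ and let $\mathcal{U}(M)$ be its unitary group with the strong operator topology. Let $\alpha^{(A,k)}$ be the CCR flow associated to $V$ and $G(\alpha^{(A,k)})$ its gauge group. Then the map \[ \mathbb{R}^{d}\times\mathcal{U}(M)\ni(\lambda,U)\mapsto\{e^{i\langle\lambda|x\rangle}\,\Gamma(UE_x^{\perp}+E_x)\}_{x\in P}\in G(\alpha^{(A,k)}) \] is a homeomorphism, where $\mathbb{R}^{d}\times\mathcal{U}(M)$ carries the product topology.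
   Context: $P$-module: a proper closed subset $A \subset \mathbb{R}^{d}$ with $A+x \subset A$ for all $x \in P$ and, by convention, $0 \in A$. The isometric representation associated to $A$ of multiplicity $k$ acts on $L^2(A,\mathcal{K})\cong L^2(A)\otimes\mathcal{K}$ (Lebesgue measure) by $(V_xf)(y)=f(y-x)$ if $y-x\in A$ and $(V_xf)(y)=0$ if $y-x\notin A$, for $x \in P$. $E_0$-semigroup over $P$ on $B(\mathcal{H})$: a family $\alpha=\{\alpha_x\}_{x\in P}$ of normal unital $*$-endomorphisms with $\alpha_x\circ\alpha_y=\alpha_{x+y}$ and $x\mapsto\langle\alpha_x(T)\xi|\eta\rangle$ continuous for all $T\in B(\mathcal{H})$, $\xi,\eta \in \mathcal{H}$. Fock space: $\Gamma(\mathcal{H})$ is the symmetric Fock space of $\mathcal{H}$, $e(u)=\sum_{n\ge 0} u^{\otimes n}/\sqrt{n!}$ are the exponential vectors. $W(u)$ is the unique unitary with $W(u)e(v)=e^{-\|u\|^2/2-\langle u|v\rangle}e(u+v)$ (inner products linear in the second variable). For a unitary $U$ on $\mathcal{H}$, $\Gamma(U)$ is the unique unitary on $\Gamma(\mathcal{H})$ with $\Gamma(U)e(v)=e(Uv)$. CCR flow of a strongly continuous isometric representation $V$ of $P$ on $\mathcal{H}$: the unique $E_0$-semigroup $\alpha^{V}$ on $B(\Gamma(\mathcal{H}))$ with $\alpha^{V}_x(W(u))=W(V_xu)$. Gauge group of an $E_0$-semigroup $\alpha$ on $B(\mathcal{H})$: $G(\alpha)$ is the set of strongly continuous families of unitaries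 $\{U_x\}_{x\in P}$ on $\mathcal{H}$ with $U_x\alpha_x(U_y)=U_{x+y}$ and $U_x\alpha_x(T)U_x^{*}=\alpha_x(T)$ for all $x,y\in P$, $T\in B(\mathcal{H})$, with pointwise multiplication, inverse $\{U_x^*\}_{x\in P}$, and the topology of uniform convergence on compact subsets of $P$, the unitary group $\mathcal{U}(\mathcal{H})$ having the strong operator topology. *)

(* Defs.v *)
From HB Require Import structures.
From mathcomp Require Import all_boot all_order all_algebra all_fingroup.
From mathcomp Require Import complex.
From mathcomp Require Import all_classical all_reals all_analysis.

Set Implicit Arguments.
Unset Strict Implicit.
Unset Printing Implicit Defensive.
Import Order.TTheory GRing.Theory Num.Theory.
Import numFieldNormedType.Exports.
Local Open Scope classical_set_scope.
Local Open Scope ring_scope.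
Local Open Scope complex_scope.

(* Inner products are conjugate-linear in the first variable and linear in
   the second. The norm of a normed module over R[i] is R[i]-valued. *)
HB.mixin Record isHilbert (R : realType) H of CompleteNormedModule R[i] H := {
  inner : H -> H -> R[i] ;
  inner_linear : forall u a v w, inner u (a *: v + w) = a * inner u v + inner u w ;
  inner_conj : forall u v, inner v u = (inner u v)^* ;
  inner_norm : forall u, inner u u = `|u| ^+ 2
}.

#[short(type="hilbertType")]
HB.structure Definition Hilbert (R : realType) :=
  {H of CompleteNormedModule R[i] H & isHilbert R H}.

Definition cexp (R : realType) (z : R[i]) : R[i] :=
  (expR (complex.Re z))%:C * (cos (complex.Im z) +i* sin (complex.Im z)).

Section hilbert_space.
Context {R : realType} (H : hilbertType R).

Definition lin_span (S : set H) : set H :=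
  [set v | exists (n : nat) (c : 'I_n -> R[i]) (s : 'I_n -> H),
     (forall i, S (s i)) /\ v = \sum_i c i *: s i].

Definition total_set (S : set H) := closure (lin_span S) = setT.

Definition orthonormal_basis (I : eqType) (b : I -> H) :=
  (forall i j, inner (b i) (b j) = (i == j)%:R) /\ total_set (range b).

(* [None] stands for the countably infinite dimension. *)
Definition has_dim (k : option nat) :=
  if k is Some n then exists b : 'I_n -> H, orthonormal_basis b
  else exists b : nat -> H, orthonormal_basis b.

Definition separable_space := exists2 D : set H, countable D & dense D.

End hilbert_space.

Section bounded_operators.
Context {R : realType} (H : hilbertType R).

Record bop := Bop {
  bop_fun :> H -> H ;
  bop_linear : linear bop_fun ;
  bop_continuous : continuous bop_fun }.

HB.instance Definition _ := gen_eqMixin bop.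
HB.instance Definition _ := gen_choiceMixin bop.

Lemma bop_ext (S T : bop) : (forall u, S u = T u) -> S = T.
Proof.
case: S T => [S lS cS] [T lT cT] /= /funext ST; subst T.
by congr Bop; exact: Prop_irrelevance.
Qed.

Lemma bop_linear0 : linear (fun _ : H => 0 : H).
Proof. by move=> a u v; rewrite scaler0 addr0. Qed.
Definition bop0 := Bop bop_linear0 (fun x => cvg_cst 0).

Lemma bop_linear1 : linear (@idfun H).
Proof. by []. Qed.
Definition bop1 := Bop bop_linear1 (fun x => cvg_id).

Lemma bop_linearN (T : bop) : linear (fun u => - T u).
Proof. by move=> a u v; rewrite bop_linear opprD scalerN. Qed.
Definition bopN (T : bop) :=
  Bop (bop_linearN T) (fun x => cvgN (@bop_continuous T x)).

Lemma bop_linearD (S T : bop) : linear (fun u => S u + T u).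
Proof. by move=> a u v; rewrite !bop_linear scalerDr addrACA. Qed.
Definition bopD (S T : bop) := Bop (bop_linearD S T)
  (fun x => cvgD (@bop_continuous S x) (@bop_continuous T x)).

Lemma bop_linearZ (a : R[i]) (T : bop) : linear (fun u => a *: T u).
Proof. by move=> b u v; rewrite bop_linear scalerDr !scalerA mulrC. Qed.
Definition bopZ (a : R[i]) (T : bop) := Bop (bop_linearZ a T)
  (fun x => cvgZl_tmp (@bop_continuous T x)).

Lemma bop_linearM (S T : bop) : linear (S \o T).
Proof. by move=> a u v /=; rewrite !bop_linear. Qed.
Lemma bop_continuousM (S T : bop) : continuous (S \o T).
Proof.
by move=> x; apply: continuous_comp; exact: bop_continuous.
Qed.
Definition bopM (S T : bop) := Bop (bop_linearM S T) (@bop_continuousM S T).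

Lemma bopDA : associative bopD.
Proof. by move=> S T U; apply: bop_ext => u /=; rewrite addrA. Qed.
Lemma bopDC : commutative bopD.
Proof. by move=> S T; apply: bop_ext => u /=; rewrite addrC. Qed.
Lemma bop0D : left_id bop0 bopD.
Proof. by move=> S; apply: bop_ext => u /=; rewrite add0r. Qed.
Lemma bopND : left_inverse bop0 bopN bopD.
Proof. by move=> S; apply: bop_ext => u /=; rewrite addNr. Qed.
HB.instance Definition _ := GRing.isZmodule.Build bop bopDA bopDC bop0D bopND.

Lemma bopMA : associative bopM.
Proof. by move=> S T U; exact: bop_ext. Qed.
Lemma bop1M : left_id bop1 bopM.
Proof. by move=> S; exact: bop_ext. Qed.
Lemma bopM1 : right_id bop1 bopM.
Proof. by move=> S; exact: bop_ext. Qed.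
Lemma bopMDl : left_distributive bopM +%R.
Proof. by move=> S T U; exact: bop_ext. Qed.
Lemma bopMDr : right_distributive bopM +%R.
Proof.
by move=> S T U; apply: bop_ext => u /=; rewrite -[T u]scale1r bop_linear !scale1r.
Qed.
HB.instance Definition _ := GRing.Zmodule_isPzRing.Build bop
  bopMA bop1M bopM1 bopMDl bopMDr.

Lemma bopZA a b (T : bop) : bopZ a (bopZ b T) = bopZ (a * b) T.
Proof. by apply: bop_ext => u /=; rewrite scalerA. Qed.
Lemma bop1Z : left_id 1 bopZ.
Proof. by move=> T; apply: bop_ext => u /=; rewrite scale1r. Qed.
Lemma bopZDr : right_distributive bopZ +%R.
Proof. by move=> a S T; apply: bop_ext => u /=; rewrite scalerDr. Qed.
Lemma bopZDl (T : bop) : {morph bopZ^~ T : a b / a + b}.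
Proof. by move=> a b; apply: bop_ext => u /=; rewrite scalerDl. Qed.
HB.instance Definition _ := GRing.Zmodule_isLmodule.Build R[i] bop
  bopZA bop1Z bopZDr bopZDl.

(* The topology and uniformity of [bop] are the strong operator ones. *)
HB.instance Definition _ :=
  Uniform.copy bop (initial_topology (bop_fun : bop -> {ptws H -> H})).

Definition adj (T : bop) : bop :=
  xget 0 [set S : bop | forall u v, inner (T u) v = inner u (S v)].

Definition unitary (U : bop) := adj U * U = 1 /\ U * adj U = 1.

Definition bop_le (S T : bop) := forall u, inner u (S u) <= inner u (T u).

Definition is_lub (D : set bop) (L : bop) :=
  (forall T, D T -> bop_le T L) /\
  (forall L', (forall T, D T -> bop_le T L') -> bop_le L L').

Definition directed (D : set bop) := D !=set0 /\
  forall S T, D S -> D T -> exists U, [/\ D U, bop_le S U & bop_le T U].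

Definition commutant (N : set bop) : set bop :=
  [set T | forall S, N S -> S * T = T * S].

Definition von_neumann_algebra (N : set bop) :=
  (forall T, N T -> N (adj T)) /\ commutant (commutant N) = N.

Definition generated_vN (S : set bop) : set bop :=
  [set T | forall N, von_neumann_algebra N -> S `<=` N -> N T].

Definition unitary_group (N : set bop) : set bop :=
  [set U | N U /\ unitary U].

(* normal = preserves suprema of bounded increasing nets of self-adjoint
   operators *)
Definition normal_map (phi : bop -> bop) :=
  forall (D : set bop) (L : bop), directed D -> (forall T, D T -> adj T = T) ->
    is_lub D L -> is_lub (phi @` D) (phi L).

Definition unital_star_endomorphism (phi : bop -> bop) :=
  [/\ linear phi, phi 1 = 1, forall S T, phi (S * T) = phi S * phi T
    & forall T, phi (adj T) = adj (phi T)].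

End bounded_operators.

Section cones.
Context {R : realType} {d : nat}.
Implicit Types P A : set 'rV[R]_d.

Definition convex_cone P := P !=set0 /\
  forall (a b : R) x y, 0 <= a -> 0 <= b -> P x -> P y -> P (a *: x + b *: y).

Definition pointed P := P `&` [set - x | x in P] = [set 0].

Definition spanning P := [set x - y | x in P & y in P] = setT.

Definition is_module P A :=
  [/\ closed A, A != setT, A 0 & forall x a, P x -> A a -> A (a + x)].

Definition dotv (x y : 'rV[R]_d) : R := \sum_i x 0 i * y 0 i.

End cones.

Notation borel T := (g_sigma_algebraType (@open T)).

Definition is_lebesgue (R : realType) (d : nat)
    (mu : {measure set (borel 'rV[R]_d) -> \bar R}) :=
  forall a b : 'rV[R]_d, (forall i, a 0 i <= b 0 i) ->
    mu [set x : 'rV[R]_d | forall i, a 0 i < x 0 i <= b 0 i] =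
    (\prod_i (b 0 i - a 0 i))%:E.

Section L2.
Context {R : realType} {d : nat}
  (mu : {measure set (borel 'rV[R]_d) -> \bar R})
  (A : set 'rV[R]_d) (K : hilbertType R).
Implicit Types f g : 'rV[R]_d -> K.

Definition L2_integral f : \bar R :=
  (\int[mu]_(y in (A : set (borel 'rV[R]_d))) ((complex.Re `|f y|) ^+ 2)%:E)%E.

Definition square_integrable f :=
  measurable_fun (A : set (borel 'rV[R]_d)) (f : borel 'rV[R]_d -> borel K) /\
  (L2_integral f < +oo)%E.

(* A realization of L^2(A, K): a Hilbert space together with the class map
   f |-> [f] on square-integrable functions (only the values of f on A matter).
   Functions equal a.e. on A have the same class because the norm is the L^2
   norm, which also determines the inner product by polarization. *)
Record L2_space := L2Space {
  L2_sort :> hilbertType R ;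
  L2_class : ('rV[R]_d -> K) -> L2_sort ;
  L2_class_linear : forall (c : R[i]) f g,
    square_integrable f -> square_integrable g ->
    L2_class (fun y => c *: f y + g y) = c *: L2_class f + L2_class g ;
  L2_class_norm : forall f, square_integrable f ->
    ((complex.Re `|L2_class f|) ^+ 2)%:E = L2_integral f ;
  L2_class_onto : forall u, exists2 f, square_integrable f & L2_class f = u }.

Definition translate (x : 'rV[R]_d) f (y : 'rV[R]_d) : K :=
  if (y - x) \in A then f (y - x) else 0.

Definition associated_representation (P : set 'rV[R]_d) (L : L2_space)
    (V : P -> bop L) :=
  forall (x : P) f, square_integrable f ->
    V x (L2_class L f) = L2_class L (translate (val x) f).

End L2.

(* A realization of the symmetric Fock space of H. The vector [fock_tensor u]
   is the symmetrization (n!)^-1 \sum_s u_(s 0) (x) ... (x) u_(s (n-1)) of the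
   elementary tensor of u, with the inner product that it has in the n-th
   Hilbert tensor power of H; tensors of different degrees are orthogonal. *)
Record fock_space (R : realType) (H : hilbertType R) := FockSpace {
  fock_sort :> hilbertType R ;
  fock_tensor : forall n, ('I_n -> H) -> fock_sort ;
  fock_inner : forall n (u v : 'I_n -> H),
    inner (fock_tensor u) (fock_tensor v) =
    (n`!%:R)^-1 * \sum_(s : 'S_n) \prod_i inner (u i) (v (s i)) ;
  fock_orthogonal : forall m n (u : 'I_m -> H) (v : 'I_n -> H), m != n ->
    inner (fock_tensor u) (fock_tensor v) = 0 ;
  fock_total :
    total_set [set w | exists n (u : 'I_n -> H), w = fock_tensor u] }.

Section fock.
Context {R : realType} {H : hilbertType R} (F : fock_space H).

Definition expvec (u : H) : F :=
  lim (series (fun n => (sqrtC (n`!%:R : R[i]))^-1 *: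
                        fock_tensor F (fun _ : 'I_n => u)) @ \oo).

Definition weyl (u : H) : bop F :=
  xget 1 [set W : bop F | unitary W /\ forall v,
    W (expvec v) = cexp (- (`|u| ^+ 2 / 2) - inner u v) *: expvec (u + v)].

Definition second_quantization (U : bop H) : bop F :=
  xget 1 [set T : bop F | unitary T /\ forall v, T (expvec v) = expvec (U v)].

End fock.

(* Families indexed by P are functions on the type of elements of P, which
   carries the subspace topology. *)
Section E0_semigroups.
Context {R : realType} {d : nat} {H : hilbertType R} {P : set 'rV[R]_d}.

Definition E0_semigroup (alpha : P -> bop H -> bop H) :=
  [/\ forall x, normal_map (alpha x) /\ unital_star_endomorphism (alpha x),
      forall x y z : P, val z = val x + val y ->
        forall T, alpha x (alpha y T) = alpha z T
    & forall T xi eta, continuous (fun x : P => inner (alpha x T xi) eta : R[i]^o)].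

Definition gauge_group (alpha : P -> bop H -> bop H) :
    set {family compact, P -> bop H} :=
  [set U : P -> bop H | [/\ forall x, unitary (U x),
      continuous U,
      forall x y z : P, val z = val x + val y -> U x * alpha x (U y) = U z
    & forall x T, U x * alpha x T * adj (U x) = alpha x T]].

End E0_semigroups.

Definition CCR_flow (R : realType) (d : nat) (H : hilbertType R)
    (F : fock_space H) (P : set 'rV[R]_d) (V : P -> bop H)
    (alpha : P -> bop F -> bop F) :=
  E0_semigroup alpha /\ forall x u, alpha x (weyl F u) = weyl F (V x u).

Definition homeomorphism (X Y : topologicalType) (f : X -> Y) :=
  continuous f /\ exists g : Y -> X, [/\ cancel f g, cancel g f & continuous g].

(* Main.v *)
(* Write E_x = V_x V_x^* and E'_x = 1 - E_x. For w in ker V_x^* there is an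
   operator J_w with J_w e(u) = e(w + V_x u) and alpha_x(T) J_w = J_w T, so that
   an operator commutes with the range of alpha_x as soon as it carries each
   J_w to some J_w'; this makes (l, U) |-> e^{i<l|x>} Gamma(U E'_x + E_x) a
   gauge cocycle. Conversely let G be a gauge cocycle and put
   chi x = <Om, G_x Om>, which is multiplicative. The kernel
   <e(u), G_x e(v)>, cut down to ker V_x^*, is a multiplicative cocycle in x.
   Splitting x into n equal pieces and letting n grow shows that it is
   determined by the terms of first and second order in (u, v). The first order
   term is an additive cocycle with xi_x in ker V_x^*; in L^2(A) it vanishes, as
   a ball in A has infinitely many disjoint translates inside A \ (A + 3a) (here
   d >= 2), all of them carrying at least the mass that xi_x has on the ball. The
   second order term yields a unitary S_x with G_x e(u) = chi_x e(S_x u), and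
   S_{na} converges to a unitary U commuting with every V_x because
   V_{na}^* -> 0 strongly, for a interior to P. Finally |chi| = 1, so that chi is
   x |-> e^{i<l|x>}. *)
From HB Require Import structures.
Require Import Defs.
From mathcomp Require Import all_boot all_order all_algebra all_fingroup.
From mathcomp Require Import complex.
From mathcomp Require Import all_classical all_reals all_analysis.
From mathcomp Require Import measurable_realfun.
From mathcomp Require Import ring lra.
Set Implicit Arguments.
Unset Strict Implicit.
Unset Printing Implicit Defensive.
Import Order.TTheory GRing.Theory Num.Theory.
Import numFieldNormedType.Exports.
Local Open Scope classical_set_scope.
Local Open Scope ring_scope.
Local Open Scope complex_scope.

(** * Real norms and complex exponentials *)

(** The flow is prescribed on Weyl operators only, so the intertwining relation of [J_w] must be
    extended to all operators; this is where normality enters. If [S] satisfies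
    [alpha_x(T) S = S T], then [J_w^* S] commutes with the Weyl operators, hence is a scalar, and
    the ranges of such [S] are total because a normal unital endomorphism is nondegenerate on
    rank-one operators. The ranges of the [J_w] are total as well, since [e(v) = J_w e(V_x^* v)] for
    [w = E'_x v]. Cutting [x] into pieces splits [u] into layers whose squared norms have a bounded
    sum while the largest tends to 0. Third order errors therefore disappear in the limit, but first
    order terms would not be summable, so they have to be shown to vanish beforehand. An exponential
    determines its exponent only modulo [2 i pi]. Exponents are always recovered from a whole
    segment [t z], [0 < t <= 1]; for the continuity of the inverse map this is a uniform bound on a
    compact segment of [P]. The unitary [U] is recovered at a single point [n a] at which
    [V_(na)^* u] is small. *)

Section real_norm.
Context {R : realType}.
Implicit Types z w : R[i].

Lemma ge0_ReC z : 0 <= z -> z = (complex.Re z)%:C.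
Proof. by case: z => a b; rewrite lecE /= => /andP[/eqP -> _]. Qed.

Lemma complex_eqP z w : complex.Re z = complex.Re w -> complex.Im z = complex.Im w -> z = w.
Proof. by case: z w => [a b] [c d] /= -> ->. Qed.

Lemma ler_ReC (x y : R) : (x%:C <= y%:C) = (x <= y).
Proof. by rewrite lecE /= eqxx. Qed.

Lemma ltr_ReC (x y : R) : (x%:C < y%:C) = (x < y).
Proof. by rewrite ltcE /= eqxx. Qed.

Lemma cReD z w : complex.Re (z + w) = complex.Re z + complex.Re w.
Proof. by case: z w => [a b] [c d]. Qed.
Lemma cReN z : complex.Re (- z) = - complex.Re z.
Proof. by case: z => [a b]. Qed.
Lemma cReB z w : complex.Re (z - w) = complex.Re z - complex.Re w.
Proof. by rewrite cReD cReN. Qed.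
Lemma cReM z w : complex.Re (z * w) =
  complex.Re z * complex.Re w - complex.Im z * complex.Im w.
Proof. by case: z w => [a b] [c d]. Qed.
Lemma cImD z w : complex.Im (z + w) = complex.Im z + complex.Im w.
Proof. by case: z w => [a b] [c d]. Qed.
Lemma cImN z : complex.Im (- z) = - complex.Im z.
Proof. by case: z => [a b]. Qed.
Lemma cImM z w : complex.Im (z * w) =
  complex.Re z * complex.Im w + complex.Im z * complex.Re w.
Proof. by case: z w => [a b] [c d]. Qed.

Section rn.
Context {V : normedZmodType R[i]}.
Implicit Types u v : V.

(** Norms of modules over [R[i]] are [R[i]]-valued; taking the real part loses nothing by [normE]
    and moves order reasoning to [R]. *)
Definition rn u : R := complex.Re `|u|.

Lemma normE u : `|u| = (rn u)%:C.
Proof. exact/ge0_ReC/normr_ge0. Qed.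

Lemma rn_ge0 u : 0 <= rn u.
Proof. by rewrite -ler_ReC -normE normr_ge0. Qed.

Lemma rn0 : rn 0 = 0.
Proof. by rewrite /rn normr0. Qed.

Lemma rn0_eq0 u : rn u = 0 -> u = 0.
Proof. by move=> u0; apply/eqP; rewrite -normr_eq0 normE u0. Qed.

Lemma rn_gt0 u : u != 0 -> 0 < rn u.
Proof.
move=> u0; rewrite lt_neqAle rn_ge0 andbT eq_sym.
by apply: contra_neq u0; exact: rn0_eq0.
Qed.

Lemma rn_triangle u v : rn (u + v) <= rn u + rn v.
Proof. by rewrite -ler_ReC rmorphD /= -!normE ler_normD. Qed.

Lemma rnN u : rn (- u) = rn u.
Proof. by rewrite /rn normrN. Qed.

Lemma rnB u v : rn (u - v) = rn (v - u).
Proof. by rewrite -rnN opprB. Qed.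

Lemma rn_triangleB u v : rn (u - v) <= rn u + rn v.
Proof. by rewrite (le_trans (rn_triangle _ _)) // rnN. Qed.

Lemma rn_dist_triangle u v (w : V) : rn (u - w) <= rn (u - v) + rn (v - w).
Proof. by rewrite (le_trans _ (rn_triangle _ _)) // subrKA. Qed.

Lemma rn_sub_le u v : rn u <= rn v + rn (u - v).
Proof. by rewrite (le_trans _ (rn_triangle _ _)) // addrC subrK. Qed.

Lemma rn_sum (I : Type) (r : seq I) (Q : pred I) (f : I -> V) :
  rn (\sum_(i <- r | Q i) f i) <= \sum_(i <- r | Q i) rn (f i).
Proof.
elim/big_rec2 : _ => [|i x y _ xy]; first by rewrite rn0.
by rewrite (le_trans (rn_triangle _ _)) // lerD2l.
Qed.

Lemma rn_le_eps u : (forall e : R, 0 < e -> rn u <= e) -> u = 0.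
Proof.
move=> ue; apply: rn0_eq0; apply/eqP; rewrite eq_le rn_ge0 andbT.
by apply/ler_addgt0Pl => e e0; rewrite addr0 ue.
Qed.

(** The form in which Taylor coefficients are killed: divide a bound of order [t^(n+1)] by [t^n] and
    let [t] tend to 0. *)
Lemma rn_le_Ct (C : R) u : (forall t : R, 0 < t -> t <= 1 -> rn u <= C * t) -> u = 0.
Proof.
move=> ue; apply: rn_le_eps => e e0.
have C0 : 0 <= C by have := ue 1 ltr01 (lexx _); rewrite mulr1; apply: le_trans (rn_ge0 _).
have h : 0 < Num.min 1 (e / (C + 1)) by rewrite lt_min ltr01 divr_gt0 //; lra.
have := ue _ h; rewrite ge_min lexx => /(_ isT) /le_trans; apply.
apply: (@le_trans _ _ (C * (e / (C + 1)))).
  by rewrite ler_wpM2l // ge_min lexx orbT.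
rewrite mulrA ler_pdivrMr; last lra.
by nra.
Qed.

End rn.

Lemma rnC (x : R) : rn x%:C = `|x|.
Proof. by rewrite /rn normc_def /= expr0n /= addr0 sqrtr_sqr. Qed.

Lemma rnM z w : rn (z * w) = rn z * rn w.
Proof. by rewrite /rn normrM !normE cReM /= mulr0 subr0. Qed.

Lemma rn1 : rn (1 : R[i]) = 1.
Proof. by rewrite /rn normr1. Qed.

Lemma rnX z n : rn (z ^+ n) = rn z ^+ n.
Proof. by elim: n => [|n IH]; rewrite ?expr0 ?rn1 // !exprS rnM IH. Qed.

Lemma rnV z : rn z^-1 = (rn z)^-1.
Proof.
have [->|z0] := eqVneq z 0; first by rewrite !(invr0, rn0).
have h : rn z * rn z^-1 = 1 by rewrite -rnM divff // rn1.
have r0 : rn z != 0 by apply: contra_neq z0 => /rn0_eq0.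
by apply: (mulfI r0); rewrite h divff.
Qed.

Lemma cjC (x : R) : (x%:C)^*%C = x%:C.
Proof. exact: conjc_real. Qed.

Lemma rnJ z : rn z^*%C = rn z.
Proof. by case: z => a b; rewrite /rn !normc_def /= sqrrN. Qed.

Lemma rn_sqr z : rn z ^+ 2 = complex.Re z ^+ 2 + complex.Im z ^+ 2.
Proof.
rewrite /rn normc_def /= sqr_sqrtr // addr_ge0 ?sqr_ge0 //.
Qed.

Lemma Re_le_rn z : `|complex.Re z| <= rn z.
Proof. by rewrite -ler_ReC -normE normc_ge_Re. Qed.

Lemma rnZ (V : normedModType R[i]) z (u : V) : rn (z *: u) = rn z * rn u.
Proof. by rewrite /rn normrZ !normE cReM /= mulr0 subr0. Qed.

Lemma mulJ_rn z : z^*%C * z = (rn z ^+ 2)%:C.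
Proof.
by case: z => a b; rewrite rn_sqr /=; apply: complex_eqP => /=; ring.
Qed.

Lemma mul_rnJ z : z * z^*%C = (rn z ^+ 2)%:C.
Proof. by rewrite mulrC mulJ_rn. Qed.

End real_norm.

Section cexp.
Context {R : realType}.
Implicit Types z w : R[i].

Lemma cexpD z w : cexp (z + w) = cexp z * cexp w.
Proof.
case: z w => [a b] [c d]; rewrite /cexp /= expRD sinD cosD.
by apply: complex_eqP => /=; ring.
Qed.

Lemma cexp0 : cexp (0 : R[i]) = 1.
Proof. by rewrite /cexp /= expR0 cos0 sin0; apply: complex_eqP => /=; ring. Qed.

Lemma cexpN z : cexp (- z) * cexp z = 1.
Proof. by rewrite -cexpD addNr cexp0. Qed.

Lemma cexp_neq0 z : cexp z != 0.
Proof.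
apply/eqP => z0; have := cexpN z; rewrite z0 mulr0 => /eqP.
by rewrite eq_sym oner_eq0.
Qed.

Lemma cexpC (x : R) : cexp x%:C = (expR x)%:C.
Proof. by rewrite /cexp /= cos0 sin0; apply: complex_eqP => /=; ring. Qed.

Lemma rn_cexp z : rn (cexp z) = expR (complex.Re z).
Proof.
rewrite /cexp rnM rnC ger0_norm ?expR_ge0 //.
suff -> : rn (cos (complex.Im z) +i* sin (complex.Im z)) = 1 by rewrite mulr1.
apply/eqP; rewrite -(@eqrXn2 _ 2) ?rn_ge0 // rn_sqr /= cos2Dsin2 expr1n //.
Qed.

Lemma cexpJ z : cexp z^*%C = (cexp z)^*%C.
Proof.
case: z => a b; rewrite /cexp /= cosN sinN.
by apply: complex_eqP => /=; ring.
Qed.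

Lemma cexp_sum (I : Type) (r : seq I) (f : I -> R[i]) :
  cexp (\sum_(i <- r) f i) = \prod_(i <- r) cexp (f i).
Proof.
by elim: r => [|i r IH]; rewrite ?big_nil ?cexp0 // !big_cons cexpD IH.
Qed.

End cexp.

Section tends.
Context {R : realType}.

(** An epsilon-N limit with real epsilon; [tends_cvg] identifies it with filter convergence in
    normed modules. *)
Definition tends (V : normedZmodType R[i]) (s : nat -> V) (l : V) :=
  forall e : R, 0 < e -> exists N, forall n, (N <= n)%N -> rn (s n - l) <= e.

Section theory.
Context {V : normedZmodType R[i]}.
Implicit Types (s t : nat -> V) (l m : V).

Lemma tends_unique s l m : tends s l -> tends s m -> l = m.
Proof.
move=> sl sm; apply/eqP; rewrite -subr_eq0; apply/eqP/rn_le_eps => e e0.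
have e2 : 0 < e / 2 by lra.
have [N1 h1] := sl _ e2; have [N2 h2] := sm _ e2.
have {}h1 := h1 _ (leq_maxl N1 N2); have {}h2 := h2 _ (leq_maxr N1 N2).
have := rn_dist_triangle l (s (maxn N1 N2)) m; rewrite (rnB l (s _)); lra.
Qed.

Lemma tends_cst l : tends (fun=> l) l.
Proof. by move=> e e0; exists 0%N => n _; rewrite subrr rn0 ltW. Qed.

Lemma tendsD s t l m : tends s l -> tends t m -> tends (fun n => s n + t n) (l + m).
Proof.
move=> sl sm e e0; have e2 : 0 < e / 2 by lra.
have [N1 h1] := sl _ e2; have [N2 h2] := sm _ e2.
exists (maxn N1 N2) => n; rewrite geq_max => /andP[/h1 {}h1 /h2 {}h2].
rewrite opprD addrACA (le_trans (rn_triangle _ _)) //; lra.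
Qed.

Lemma tends_squeeze (W : normedZmodType R[i]) s l (t : nat -> W) (C : R) :
  (forall n, rn (s n - l) <= C * rn (t n)) -> tends t 0 -> tends s l.
Proof.
move=> st t0 e e0; have C1 : 0 < `|C| + 1 by rewrite ltr_wpDl.
have [N h] := t0 (e / (`|C| + 1)) (divr_gt0 e0 C1).
exists N => n /h; rewrite subr0 => {}h; apply: le_trans (st _) _.
apply: (@le_trans _ _ ((`|C| + 1) * rn (t n))).
  by rewrite ler_wpM2r ?rn_ge0 // (le_trans (ler_norm _)) // lerDl.
by rewrite mulrC -ler_pdivlMr.
Qed.

Lemma tends_rn_le s l (C : R) : tends s l -> (forall n, rn (s n) <= C) -> rn l <= C.
Proof.
move=> sl sC; apply/ler_addgt0Pl => e /sl[N /(_ N (leqnn _)) h].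
rewrite (le_trans (rn_sub_le l (s N))) // addrC lerD // rnB; exact: h.
Qed.

Lemma tends_shift s l k : tends s l -> tends (fun n => s (n + k)%N) l.
Proof.
move=> sl e /sl[N h]; exists N => n Nn; apply: h.
by rewrite (leq_trans Nn) ?leq_addr.
Qed.

End theory.

Lemma tends_real (s : nat -> R) (l : R) : s @ \oo --> l -> tends (fun n => (s n)%:C) l%:C.
Proof.
move=> sl e e0; move/cvgrPdist_le : sl => /(_ _ e0)[N _ h].
by exists N => n /h; rewrite -rmorphB /= rnC distrC.
Qed.

Lemma tendsM (s t : nat -> R[i]) l m : tends s l -> tends t m ->
  tends (fun n => s n * t n) (l * m).
Proof.
move=> sl tm e e0.
have C0 : 0 < rn l + rn m + 1 by have := rn_ge0 l; have := rn_ge0 m; lra.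
pose d := Num.min 1 (e / (rn l + rn m + 1)).
have d0 : 0 < d by rewrite lt_min ltr01 divr_gt0.
have d1 : d <= 1 by rewrite ge_min lexx.
have de : d * (rn l + rn m + 1) <= e by rewrite -ler_pdivlMr // ge_min lexx orbT.
have [N1 h1] := sl _ d0; have [N2 h2] := tm _ d0.
exists (maxn N1 N2) => n; rewrite geq_max => /andP[/h1 {}h1 /h2 {}h2].
have -> : s n * t n - l * m = (s n - l) * (t n - m) + (s n - l) * m + l * (t n - m) by ring.
rewrite (le_trans (rn_triangle _ _)) // (le_trans (lerD (rn_triangle _ _) (lexx _))) //.
rewrite !rnM.
have := rn_ge0 (s n - l); have := rn_ge0 (t n - m); have := rn_ge0 l; have := rn_ge0 m.
nra.
Qed.

End tends.

(** * The power series of the complex exponential *)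

Section exp_series.
Context {R : realType}.
Implicit Types z w : R[i].

(** [cexp] is defined by [expR], [cos] and [sin], whereas inner products of truncated exponential
    vectors are these partial sums; [tends_pexp] joins the two. *)
Definition pexp n z : R[i] := \sum_(0 <= k < n) z ^+ k / k`!%:R.

Lemma pexpC n (x : R) : pexp n x%:C = (series (exp_coeff x) n)%:C.
Proof.
rewrite /pexp /series /= rmorph_sum; apply: eq_bigr => k _.
by rewrite /exp_coeff /= rmorphM /= rmorphXn /= fmorphV rmorph_nat.
Qed.

Lemma tends_pexpC (x : R) : tends (fun n => pexp n x%:C) (expR x)%:C.
Proof.
under [X in tends X]eq_fun do rewrite pexpC.
by apply: tends_real; exact: is_cvg_series_exp_coeff.
Qed.

Lemma natrC n : (n%:R : R[i]) = (n%:R : R)%:C.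
Proof. by rewrite rmorph_nat. Qed.

Lemma sqr_I : (0 +i* 1 : R[i]) ^+ 2 = -1.
Proof. by apply: complex_eqP => /=; ring. Qed.

(** The powers of [i] in the shape of [cos_coeff] and [sin_coeff]; at [k = 0] the truncated [k.-1]
    is harmless, as its factor [odd k] vanishes. *)
Lemma expIE k : (0 +i* 1 : R[i]) ^+ k =
  ((~~ odd k)%:R * (-1) ^+ k./2) +i* ((odd k)%:R * (-1) ^+ k.-1./2).
Proof.
elim/ltn_ind: k => -[|[|k]] IH; rewrite ?expr0 ?expr1 /=.
- by apply: complex_eqP => /=; ring.
- by apply: complex_eqP => /=; ring.
rewrite exprS exprS mulrA IH // -expr2 sqr_I /= negbK.
case: k {IH} => [|k] /=; first by apply: complex_eqP => /=; ring.
rewrite !exprS.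
by apply: complex_eqP => /=; rewrite ?negbK; ring.
Qed.

Lemma pexp_imag n (y : R) :
  pexp n (0 +i* y) = series (cos_coeff y) n +i* series (sin_coeff y) n.
Proof.
have yE : 0 +i* y = y%:C * (0 +i* 1) by apply: complex_eqP => /=; ring.
rewrite /pexp /series /=.
elim: n => [|n IH]; first by rewrite !big_geq.
rewrite !big_nat_recr //= IH yE exprMn -rmorphXn /= expIE natrC -fmorphV.
have -> : cos_coeff y n = (~~ odd n)%:R * (-1) ^+ n./2 * y ^+ n / n`!%:R by [].
have -> : sin_coeff y n = (odd n)%:R * (-1) ^+ n.-1./2 * y ^+ n / n`!%:R by [].
have -> : complex_real_complex_def__canonical__GRing_RMorphism R n`!%:R^-1 = (n`!%:R^-1)%:C by [].
by apply: complex_eqP; rewrite ?cReD ?cImD ?cReM ?cImM /=; ring.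
Qed.

Lemma tends_pexp_imag (y : R) : tends (fun n => pexp n (0 +i* y)) (cos y +i* sin y).
Proof.
have c := tends_real (@is_cvg_series_cos_coeff R y).
have s := tends_real (@is_cvg_series_sin_coeff R y).
have -> : cos y +i* sin y = (limn (series (cos_coeff y)))%:C + (0 +i* 1) * (limn (series (sin_coeff y)))%:C.
  by rewrite cos.unlock sin.unlock; apply: complex_eqP => /=; ring.
have := tendsD c (tendsM (tends_cst (0 +i* 1 : R[i])) s).
congr tends; apply/funext => n; rewrite pexp_imag; apply: complex_eqP => /=; ring.
Qed.

Lemma sum_triangle (V : nmodType) (F : nat -> nat -> V) n :
  \sum_(0 <= k < n) \sum_(0 <= j < k.+1) F j (k - j)%N =
  \sum_(0 <= i < n) \sum_(0 <= j < n - i) F i j.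
Proof.
elim: n => [|n IH]; first by rewrite !big_geq.
rewrite big_nat_recr //= IH [RHS]big_nat_recr //= subSnn big_nat1.
rewrite [X in _ + X]big_nat_recr //= subnn addrA; congr (_ + _).
rewrite -big_split /= !big_nat; apply: eq_bigr => i /andP[_ ni].
by rewrite subSn ?(ltnW ni) // big_nat_recr.
Qed.

(** The product of the partial sums is a square of terms, the partial sum at [z + w] its lower
    triangle; what remains is the corner [i + j >= n]. *)
Lemma pexpD n z w : pexp n z * pexp n w - pexp n (z + w) =
  \sum_(0 <= i < n) \sum_(n - i <= j < n) z ^+ i / i`!%:R * (w ^+ j / j`!%:R).
Proof.
have -> : pexp n (z + w) = \sum_(0 <= i < n) \sum_(0 <= j < n - i)
    z ^+ i / i`!%:R * (w ^+ j / j`!%:R).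
  rewrite -sum_triangle; apply: eq_bigr => k _.
  rewrite addrC exprDn mulr_suml big_mkord; apply: eq_bigr => j _.
  have jk : (j <= k)%N by rewrite -ltnS.
  have := bin_fact jk; move/(congr1 (fun n => n%:R : R[i])); rewrite natrM => <-.
  rewrite natrM -mulr_natr.
  have h1 : (j`!%:R : R[i]) != 0 by rewrite pnatr_eq0 -lt0n fact_gt0.
  have h2 : ((k - j)`!%:R : R[i]) != 0 by rewrite pnatr_eq0 -lt0n fact_gt0.
  have h3 : ('C(k, j)%:R : R[i]) != 0 by rewrite pnatr_eq0 -lt0n bin_gt0.
  by field; rewrite h1 h2 h3.
rewrite /pexp big_distrlr /= -sumrB; apply: eq_bigr => i _.
by rewrite (@big_cat_nat _ _ _ (n - i)) ?leq_subr //= addrC addrK.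
Qed.

Lemma rn_coef z k : rn (z ^+ k / k`!%:R) = rn z ^+ k / k`!%:R.
Proof. by rewrite rnM rnX rnV natrC rnC ger0_norm // ler0n. Qed.

(** In the corner left by [pexpD] each term is dominated by its value at the moduli, where
    multiplicativity of [expR] makes the corner tend to 0. *)
Lemma pexpD_rn n z w : rn (pexp n z * pexp n w - pexp n (z + w)) <=
  rn (pexp n (rn z)%:C * pexp n (rn w)%:C - pexp n (rn z + rn w)%:C).
Proof.
rewrite rmorphD /= !pexpD.
pose f i j := rn z ^+ i / i`!%:R * (rn w ^+ j / j`!%:R).
have f0 i j : 0 <= f i j by rewrite !mulr_ge0 ?exprn_ge0 ?rn_ge0 ?invr_ge0 ?ler0n.
rewrite [in leRHS](_ : \sum_(0 <= i < n) _ =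
    (\sum_(0 <= i < n) \sum_(n - i <= j < n) f i j)%:C); last first.
  rewrite rmorph_sum; apply: eq_bigr => i _; rewrite rmorph_sum; apply: eq_bigr => j _.
  by rewrite /f !rmorphM /= !rmorphXn /= !fmorphV /= !rmorph_nat.
rewrite rnC ger0_norm; last by apply: sumr_ge0 => i _; apply: sumr_ge0 => j _.
rewrite (le_trans (rn_sum _ _ _)) //; apply: ler_sum => i _.
rewrite (le_trans (rn_sum _ _ _)) //; apply: ler_sum => j _.
by rewrite rnM !rn_coef.
Qed.

(** On the real and on the imaginary part of [z] the series is known to converge; the defect of
    multiplicativity tends to 0 by [pexpD_rn]. *)
Lemma tends_pexp z : tends (fun n => pexp n z) (cexp z).
Proof.
case: z => a b.
have -> : a +i* b = a%:C + 0 +i* b by apply: complex_eqP => /=; ring.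
set z := a%:C; set w := 0 +i* b.
have -> : cexp (z + w) = (expR a)%:C * (cos b +i* sin b).
  by rewrite cexpD cexpC; congr (_ * _); rewrite /cexp /= expR0 mul1r.
have p1 := tendsM (tends_pexpC a) (tends_pexp_imag b).
have p2 : tends (fun n => pexp n z * pexp n w - pexp n (z + w)) 0.
  have p3 := tendsD (tendsM (tends_pexpC (rn z)) (tends_pexpC (rn w)))
                   (tendsM (tends_cst (-1)) (tends_pexpC (rn z + rn w))).
  rewrite expRD rmorphM /= mulN1r subrr in p3.
  apply: (@tends_squeeze _ _ _ _ _ _ 1 _ p3) => n.
  by rewrite subr0 mul1r mulN1r pexpD_rn.
have := tendsD p1 (tendsM (tends_cst (-1)) p2).
rewrite mulr0 addr0; congr tends; apply/funext => n; rewrite mulN1r.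
by rewrite opprB addrC subrK.
Qed.

Lemma rn_cexp_sub z : rn (cexp z - 1 - z) <= expR (rn z) - 1 - rn z.
Proof.
have h n : rn (pexp n.+2 z - 1 - z) <= complex.Re (pexp n.+2 (rn z)%:C) - 1 - rn z.
  rewrite pexpC /= /series /pexp /= !big_nat_recl //= !expr0 !expr1 !divr1.
  rewrite /exp_coeff /= expr0 expr1 !divr1.
  rewrite [X in rn (X - 1 - z)](_ : _ = 1 + z + \sum_(0 <= i < n) z ^+ i.+2 / i.+2`!%:R);
    last by rewrite !addrA.
  rewrite [X in rn X](_ : _ = \sum_(0 <= i < n) z ^+ i.+2 / i.+2`!%:R); last by ring.
  rewrite [leRHS](_ : _ = \sum_(0 <= i < n) rn z ^+ i.+2 / i.+2`!%:R); last by ring.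
  rewrite (le_trans (rn_sum _ _ _)) //; apply: ler_sum => i _.
  by rewrite rn_coef.
apply/ler_addgt0Pl => e e0.
have e2 : 0 < e / 2 by lra.
have [N1 h1] := tends_pexp z e2; have [N2 h2] := tends_pexpC (rn z) e2.
have k1 : (N1 <= (maxn N1 N2).+2)%N by rewrite ltnW // ltnS leqW // leq_maxl.
have k2 : (N2 <= (maxn N1 N2).+2)%N by rewrite ltnW // ltnS leqW // leq_maxr.
have {}h1 := h1 _ k1; have {}h2 := h2 _ k2.
have {}h2 := le_trans (Re_le_rn _) h2; rewrite cReB /= in h2.
have := h (maxn N1 N2); move: h1 h2; set p := pexp _ z; set q := complex.Re _.
move=> h1; rewrite ler_norml => /andP[_ h2] h3.
have := rn_triangle (cexp z - p) (p - 1 - z); rewrite rnB.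
have -> : cexp z - p + (p - 1 - z) = cexp z - 1 - z by ring.
lra.
Qed.

Lemma expR_sub_le (x : R) : 0 <= x -> expR x - 1 - x <= x ^+ 2 * expR x.
Proof.
move=> x0; have h := expR_ge1Dx (- x).
have e0 := expR_gt0 x.
have : (1 - x) * expR x <= 1.
  have := ler_wpM2r (ltW e0) h; rewrite -expRD addNr expR0; lra.
have := expR_ge1Dx x; nra.
Qed.

(** [cexp] determines its argument only modulo [2 i pi]; agreement along the whole segment allows
    the first order terms in [t] to be compared. *)
Lemma cexp_scaled_inj z w :
  (forall t : R, 0 < t -> t <= 1 -> cexp (t%:C * z) = cexp (t%:C * w)) -> z = w.
Proof.
move=> zw; apply/eqP; rewrite -subr_eq0; apply/eqP.
pose C := rn z ^+ 2 * expR (rn z) + rn w ^+ 2 * expR (rn w).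
have est (u : R[i]) (t : R) : 0 < t -> t <= 1 ->
    rn (cexp (t%:C * u) - 1 - t%:C * u) <= t ^+ 2 * (rn u ^+ 2 * expR (rn u)).
  move=> t0 t1; apply: le_trans (rn_cexp_sub _) _.
  rewrite rnM rnC gtr0_norm //.
  apply: le_trans (expR_sub_le _) _; first by rewrite mulr_ge0 ?rn_ge0 // ltW.
  rewrite exprMn -mulrA ler_wpM2l ?sqr_ge0 // ler_wpM2l ?sqr_ge0 //.
  by rewrite ler_expR ler_piMl ?rn_ge0.
apply: (@rn_le_Ct _ _ C) => t t0 t1.
have h1 := est z t t0 t1; have h2 := est w t t0 t1.
rewrite (zw t t0 t1) in h1.
have := rn_triangleB (cexp (t%:C * w) - 1 - t%:C * w) (cexp (t%:C * w) - 1 - t%:C * z).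
have -> : cexp (t%:C * w) - 1 - t%:C * w - (cexp (t%:C * w) - 1 - t%:C * z) =
  t%:C * (z - w) by ring.
rewrite rnM rnC gtr0_norm // => h3.
have {h3}: t * rn (z - w) <= t * (C * t) by rewrite /C; lra.
by rewrite ler_pM2l.
Qed.

End exp_series.

(** * Hilbert spaces and bounded operators *)

Section hilbert_theory.
Context {R : realType}.

Lemma tends_cvg (V : normedModType R[i]) (s : nat -> V) (l : V) :
  tends s l <-> s @ \oo --> l.
Proof.
split=> [sl|/cvgrPdist_le sl e e0].
  apply/cvgrPdist_le => e e0; have e1 := ge0_ReC (ltW e0).
  have : 0 < complex.Re e by rewrite -ltr_ReC -e1.
  by move=> /sl[N h]; exists N => // n /h; rewrite e1 normE ler_ReC rnB.
have : 0 < e%:C by rewrite ltr_ReC.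
by move=> /sl[N _ h]; exists N => n /h; rewrite normE ler_ReC rnB.
Qed.

Lemma cauchy_tends (V : completeNormedModType R[i]) (s : nat -> V) :
  (forall e : R, 0 < e -> exists N, forall m n, (N <= m)%N -> (N <= n)%N ->
     rn (s m - s n) <= e) -> exists l, tends s l.
Proof.
move=> sc; suff : cvg (s @ \oo) by move=> h; exists (lim (s @ \oo)); apply/tends_cvg.
apply/cauchy_cvgP/cauchy_exP => e e0; have e1 := ge0_ReC (ltW e0).
have er : 0 < complex.Re e / 2.
  by rewrite divr_gt0 // -ltr_ReC -e1.
have [N h] := sc _ er; exists (s N); exists N => // n /= Nn.
rewrite -ball_normE /ball_ /= normE e1 ltr_ReC.
by apply: le_lt_trans (h _ _ (leqnn _) Nn) _; lra.
Qed.

Context {H : hilbertType R}.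
Implicit Types u v w : H.

Lemma innerJ u v : inner v u = (inner u v)^*%C.
Proof. exact: inner_conj. Qed.
Lemma innerDr u v w : inner u (v + w) = inner u v + inner u w.
Proof. by rewrite -[v]scale1r inner_linear mul1r scale1r. Qed.
Lemma inner0r u : inner u 0 = 0.
Proof. by apply: (addrI (inner u 0)); rewrite -innerDr !addr0. Qed.
Lemma innerZr (a : R[i]) u v : inner u (a *: v) = a * inner u v.
Proof. by rewrite -[a *: v]addr0 inner_linear inner0r addr0. Qed.
Lemma innerNr u v : inner u (- v) = - inner u v.
Proof. by rewrite -scaleN1r innerZr mulN1r. Qed.
Lemma innerBr u v w : inner u (v - w) = inner u v - inner u w.
Proof. by rewrite innerDr innerNr. Qed.
Lemma innerDl u v w : inner (v + w) u = inner v u + inner w u.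
Proof. by rewrite innerJ innerDr rmorphD /= -!innerJ. Qed.
Lemma innerZl (a : R[i]) u v : inner (a *: v) u = a^*%C * inner v u.
Proof. by rewrite innerJ innerZr rmorphM /= -innerJ. Qed.
Lemma inner0l u : inner 0 u = 0.
Proof. by rewrite innerJ inner0r rmorph0. Qed.
Lemma innerNl u v : inner (- v) u = - inner v u.
Proof. by rewrite innerJ innerNr rmorphN /= -innerJ. Qed.
Lemma innerBl u v w : inner (v - w) u = inner v u - inner w u.
Proof. by rewrite innerDl innerNl. Qed.

Lemma inner_sumr (I : Type) (r : seq I) (f : I -> H) u :
  inner u (\sum_(i <- r) f i) = \sum_(i <- r) inner u (f i).
Proof.
by elim: r => [|i r IH]; rewrite ?big_nil ?inner0r // !big_cons innerDr IH.
Qed.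
Lemma inner_suml (I : Type) (r : seq I) (f : I -> H) u :
  inner (\sum_(i <- r) f i) u = \sum_(i <- r) inner (f i) u.
Proof.
by elim: r => [|i r IH]; rewrite ?big_nil ?inner0l // !big_cons innerDl IH.
Qed.

Lemma innerE u : inner u u = (rn u ^+ 2)%:C.
Proof. by rewrite inner_norm normE rmorphXn. Qed.

Lemma rn_inner u : rn u ^+ 2 = complex.Re (inner u u).
Proof. by rewrite innerE. Qed.

Lemma inner_eq0 u : inner u u = 0 -> u = 0.
Proof.
rewrite innerE => /(congr1 (@complex.Re R)) /= /eqP.
by rewrite sqrf_eq0 => /eqP/rn0_eq0.
Qed.

Lemma inner_ext u v : (forall w, inner w u = inner w v) -> u = v.
Proof.
move=> uv; apply/eqP; rewrite -subr_eq0; apply/eqP/inner_eq0.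
by rewrite innerBr uv subrr.
Qed.

Lemma rn_sqrD u v :
  rn (u + v) ^+ 2 = rn u ^+ 2 + rn v ^+ 2 + 2 * complex.Re (inner u v).
Proof.
rewrite !rn_inner innerDl !innerDr (innerJ u v).
by rewrite !cReD; case: (inner u v) => a b /=; ring.
Qed.

Lemma rn_sqrB u v :
  rn (u - v) ^+ 2 = rn u ^+ 2 + rn v ^+ 2 - 2 * complex.Re (inner u v).
Proof. by rewrite rn_sqrD rnN innerNr cReN mulrN. Qed.

Lemma rn_pythagoras u v : inner u v = 0 -> rn (u + v) ^+ 2 = rn u ^+ 2 + rn v ^+ 2.
Proof. by rewrite rn_sqrD => ->; rewrite mulr0 addr0. Qed.

Lemma parallelogram u v :
  rn (u + v) ^+ 2 + rn (u - v) ^+ 2 = 2 * rn u ^+ 2 + 2 * rn v ^+ 2.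
Proof. by rewrite rn_sqrD rn_sqrB; ring. Qed.

Lemma cauchy_schwarz u v : rn (inner u v) <= rn u * rn v.
Proof.
have [->|v0] := eqVneq v 0; first by rewrite inner0r !rn0 mulr0.
have rv := rn_gt0 v0.
pose c := inner v u / inner v v.
have := sqr_ge0 (rn (u - c *: v)).
rewrite rn_sqrB innerZr rnZ.
have vv : inner v v = (rn v ^+ 2)%:C by exact: innerE.
rewrite /c vv.
set z := inner v u; have -> : inner u v = z^*%C by rewrite innerJ.
rewrite rnJ mulrAC mul_rnJ -fmorphV -rmorphM /=.
rewrite rnM rnC ger0_norm ?invr_ge0 ?sqr_ge0 // => h.
have {}h : rn z ^+ 2 / rn v ^+ 2 <= rn u ^+ 2.
  suff -> : rn z ^+ 2 / rn v ^+ 2 = 2 * (rn z ^+ 2 / rn v ^+ 2) - (rn z / rn v ^+ 2 * rn v) ^+ 2 by lra.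
  by field; rewrite gt_eqF.
rewrite ler_pdivrMr ?exprn_gt0 // -exprMn in h.
by rewrite -(@ler_pXn2r _ 2) ?nnegrE ?mulr_ge0 ?rn_ge0.
Qed.

Lemma tends_innerr (s : nat -> H) l u : tends s l -> tends (fun n => inner u (s n)) (inner u l).
Proof.
move=> sl; apply: (@tends_squeeze _ _ _ _ _ (fun n => s n - l) (rn u)) => [n|].
  by rewrite -innerBr cauchy_schwarz.
have := tendsD sl (tends_cst (- l)); by rewrite subrr.
Qed.

Lemma tends_innerl (s : nat -> H) l u : tends s l -> tends (fun n => inner (s n) u) (inner l u).
Proof.
move=> sl; apply: (@tends_squeeze _ _ _ _ _ (fun n => s n - l) (rn u)) => [n|].
  by rewrite -innerBl mulrC cauchy_schwarz.
have := tendsD sl (tends_cst (- l)); by rewrite subrr.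
Qed.

Lemma natSinv_small (e : R) : 0 < e -> exists N, forall n, (N <= n)%N -> n.+1%:R^-1 <= e.
Proof.
move=> e0; have [N _ hN] := near_infty_natSinv_lt (PosNum e0).
by exists N => n Nn; apply/ltW/(hN n).
Qed.

Lemma tends_inner (s t : nat -> H) l m : tends s l -> tends t m ->
  tends (fun n => inner (s n) (t n)) (inner l m).
Proof.
move=> sl tm.
have h1 : tends (fun n => inner (s n - l) (t n - m)) 0.
  have [N1 hN1] : exists N, forall n, (N <= n)%N -> rn (s n - l) <= 1 by exact: sl.
  move=> e /tm[N2 hN2]; exists (maxn N1 N2) => n.
  rewrite geq_max => /andP[/hN1 h /hN2 h']; rewrite subr0.
  apply: le_trans (cauchy_schwarz _ _) _.
  have := rn_ge0 (t n - m); have := rn_ge0 (s n - l); nra.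
have := tendsD h1 (tendsD (tends_innerl m sl) (tendsD (tends_innerr l tm) (tends_cst (- inner l m)))).
rewrite add0r addrN addr0; congr tends; apply/funext => n.
by rewrite innerBl !innerBr; ring.
Qed.

Lemma least_norm (S : set H) : S !=set0 ->
  (forall u v, S u -> S v -> S ((2^-1 : R)%:C *: (u + v))) ->
  (forall s l, (forall n, S (s n)) -> tends s l -> S l) ->
  exists2 z, S z & forall u, S u -> rn z ^+ 2 <= rn u ^+ 2.
Proof.
move=> S0 Smid Scl.
pose D := [set rn u ^+ 2 | u in S].
have D0 : D !=set0 by case: S0 => u Su; exists (rn u ^+ 2); exists u.
have lbD : lbound D 0 by move=> _ [u _ <-]; exact: sqr_ge0.
have hD : has_inf D by split => //; exists 0.
pose d := inf D.
have dle u : S u -> d <= rn u ^+ 2.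
  by move=> fu; apply: ge_inf; [exists 0|exists u].
have /choice[s hs] : forall n : nat, exists u, S u /\ rn u ^+ 2 <= d + n.+1%:R^-1.
  move=> n; have := @inf_adherent _ D n.+1%:R^-1 _ hD.
  by rewrite invr_gt0 ltr0n => /(_ isT)[_ [u fu <-] /ltW h]; exists u.
have par m n : rn (s m - s n) ^+ 2 <= 2 * m.+1%:R^-1 + 2 * n.+1%:R^-1.
  have := parallelogram (s m) (s n).
  have := dle _ (Smid _ _ (hs m).1 (hs n).1).
  rewrite rnZ rnC exprMn ger0_norm ?invr_ge0 ?ler0n //.
  have := (hs m).2; have := (hs n).2.
  have -> : (2^-1 : R) ^+ 2 = 4^-1 by field.
  move: (m.+1%:R^-1 : R) (n.+1%:R^-1 : R) => x y; lra.
have [z sz] : exists l, tends s l.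
  apply: cauchy_tends => e e0.
  have e2 : 0 < e ^+ 2 / 4 by rewrite divr_gt0 ?exprn_gt0.
  have [N hN] := natSinv_small e2.
  exists N => m n /hN Nm /hN Nn; rewrite -(@ler_pXn2r _ 2) ?nnegrE ?rn_ge0 ?(ltW e0) //.
  apply: le_trans (par m n) _.
  move: Nm Nn; move: (m.+1%:R^-1 : R) (n.+1%:R^-1 : R) => x y; lra.
exists z; first by apply: (Scl s) => // n; exact: (hs n).1.
move=> u /dle; apply: le_trans.
apply/ler_addgt0Pl => e e0.
have e2 : 0 < e / 2 by lra.
have [N1 h1] := tends_inner sz sz e2.
have [N2 h2] := natSinv_small e2.
have {}h1 := h1 _ (leq_maxl N1 N2); have /= {}h2 := h2 _ (leq_maxr N1 N2).
have := (hs (maxn N1 N2)).2; have := le_trans (Re_le_rn _) h1.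
rewrite cReB -!rn_inner ler_norml => /andP[].
move: h2; move: ((maxn N1 N2).+1%:R^-1 : R) => x; lra.
Qed.

(** The choice [c = - <h, z> / |h|^2] would lower the squared norm by [|<h, z>|^2 / |h|^2]. *)
Lemma least_norm_perp (z h : H) : (forall c, rn z ^+ 2 <= rn (z + c *: h) ^+ 2) -> inner z h = 0.
Proof.
move=> zmin; apply/eqP/contraT => zh; exfalso.
have h0 : h != 0 by apply: contra_neq zh => ->; rewrite inner0r.
have rh : 0 < rn h ^+ 2 by rewrite exprn_gt0 // rn_gt0.
pose c := - (inner h z / (rn h ^+ 2)%:C).
have := zmin c.
rewrite rn_sqrD rnZ innerZr /c rnN.
have -> : inner z h = (inner h z)^*%C by rewrite innerJ.
rewrite mulNr mulrAC mul_rnJ -fmorphV -rmorphM cReN /=.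
rewrite rnM rnC ger0_norm ?invr_ge0 ?sqr_ge0 //.
have : 0 < rn (inner h z) ^+ 2 / rn h ^+ 2.
  rewrite divr_gt0 // exprn_even_gt0 //=; apply: contra_neq zh => /rn0_eq0 hz.
  by rewrite innerJ hz rmorph0.
have -> : (rn (inner h z) / rn h ^+ 2 * rn h) ^+ 2 = rn (inner h z) ^+ 2 / rn h ^+ 2.
  by field; rewrite gt_eqF // rn_gt0.
lra.
Qed.

(* The representing vector is the rescaled element of least norm on the affine
   hyperplane [f = 1]. *)
Lemma riesz (f : H -> R[i]) (C : R) :
  (forall a u v, f (a *: u + v) = a * f u + f v) ->
  (forall u, rn (f u) <= C * rn u) ->
  exists y, forall u, f u = inner y u.
Proof.
move=> fl fC.
have fD u v : f (u + v) = f u + f v by rewrite -[u]scale1r fl mul1r scale1r.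
have f0 : f 0 = 0 by apply: (addrI (f 0)); rewrite -fD !addr0.
have fZ a u : f (a *: u) = a * f u by rewrite -[a *: u]addr0 fl f0 addr0.
have fB u v : f (u - v) = f u - f v by rewrite fD -scaleN1r fZ mulN1r.
have [[u1 fu1]|nf] := pselect (exists u, f u <> 0); last first.
  by exists 0 => u; rewrite inner0l; apply: contrapT => fu; apply: nf; exists u.
have [||s l hs sl|z /= fz zmin] := @least_norm [set u | f u = 1].
- by exists ((f u1)^-1 *: u1) => /=; rewrite fZ mulVf //; apply/eqP.
- move=> u v /= fu fv.
  by rewrite fZ fD fu fv; apply: complex_eqP => /=; field.
- have : tends (fun n => f (s n)) (f l).
    apply: (@tends_squeeze _ _ _ _ _ (fun n => s n - l) C) => [n|]; first by rewrite -fB.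
    by have := tendsD sl (tends_cst (- l)); rewrite subrr.
  move=> h; apply: tends_unique h _.
  by under [X in tends X]eq_fun do rewrite hs; exact: tends_cst.
have zperp h : f h = 0 -> inner z h = 0.
  move=> fh; apply: least_norm_perp => c; apply: zmin => /=.
  by rewrite fD fz fZ fh mulr0 addr0.
have z0 : inner z z != 0.
  apply/eqP => /inner_eq0 z0; move: fz; rewrite z0 f0 => /eqP.
  by rewrite eq_sym oner_eq0.
exists ((inner z z)^-1 *: z) => u.
have := zperp (u - f u *: z); rewrite fB fZ fz mulr1 subrr => /(_ erefl).
rewrite innerBr innerZr => /subr0_eq zu.
have izz : ((inner z z)^-1)^*%C = (inner z z)^-1.
  by rewrite innerE -fmorphV; exact: cjC.
have -> : inner ((inner z z)^-1 *: z) u = (inner z z)^-1 * inner z u.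
  by rewrite innerZl; congr (_ * _); exact: izz.
by rewrite zu mulrCA mulVf ?mulr1.
Qed.

Lemma bop_bounded (T : bop H) : exists2 C : R, 0 <= C & forall u, rn (T u) <= C * rn u.
Proof.
pose lT := GRing.isLinear.Build _ _ _ _ (bop_fun T) (bop_linear T).
pose T' : {linear H -> H} := HB.pack (bop_fun T) lT.
have /linear_bounded_continuous/linear_boundedP[M [Mr hM]] : continuous T' by exact: (@bop_continuous _ _ T).
pose r : R[i] := (complex.Re `|M| + 1)%:C.
have Mr' : M < r.
  apply: le_lt_trans (real_ler_norm Mr) _; rewrite normE ltr_ReC; rewrite /rn; lra.
have r0 : 0 <= complex.Re `|M| + 1 by rewrite addr_ge0 // -/(rn M) rn_ge0.
exists (complex.Re `|M| + 1) => // u.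
by have := hM _ Mr' u; rewrite !normE -rmorphM /= ler_ReC.
Qed.

Lemma bounded_continuous (f : H -> H) (C : R) : linear f ->
  (forall u, rn (f u) <= C * rn u) -> continuous f.
Proof.
move=> fl fC x; apply/cvgrPdist_le => e e0; have e1 := ge0_ReC (ltW e0).
have er : 0 < complex.Re e by rewrite -ltr_ReC -e1.
have C1 : 0 < `|C| + 1 by rewrite ltr_wpDl.
have d0 : 0 < (complex.Re e / (`|C| + 1))%:C by rewrite ltr_ReC divr_gt0.
near=> y.
have fB u v : f (u - v) = f u - f v.
  by rewrite addrC -scaleN1r fl scaleN1r addrC.
rewrite normE e1 ler_ReC -fB; apply: le_trans (fC _) _.
apply: (@le_trans _ _ ((`|C| + 1) * rn (x - y))).
  by rewrite ler_wpM2r ?rn_ge0 // (le_trans (ler_norm _)) // lerDl.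
rewrite mulrC -ler_pdivlMr // -ler_ReC -normE.
by near: y; apply: cvgr_dist_le d0; exact: cvg_id.
Unshelve. all: by end_near. Qed.

Definition mkbop (f : H -> H) (C : R) (fl : linear f)
  (fC : forall u, rn (f u) <= C * rn u) : bop H := Bop fl (bounded_continuous fl fC).

Lemma bop_D (T : bop H) u v : T (u + v) = T u + T v.
Proof. by rewrite -[u]scale1r bop_linear !scale1r. Qed.
Lemma bop_0 (T : bop H) : T 0 = 0.
Proof. by apply: (addrI (T 0)); rewrite -bop_D !addr0. Qed.
Lemma bop_Z (T : bop H) (a : R[i]) u : T (a *: u) = a *: T u.
Proof. by rewrite -[a *: u]addr0 bop_linear bop_0 addr0. Qed.
Lemma bop_N (T : bop H) u : T (- u) = - T u.
Proof. by rewrite -scaleN1r bop_Z scaleN1r. Qed.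
Lemma bop_B (T : bop H) u v : T (u - v) = T u - T v.
Proof. by rewrite bop_D bop_N. Qed.
Lemma sesquilinear_bop (b : H -> H -> R[i]) (C : R) :
  (forall w (a : R[i]) u v, b w (a *: u + v) = a * b w u + b w v) ->
  (forall w (a : R[i]) u v, b (a *: u + v) w = a^*%C * b u w + b v w) ->
  (forall u v, rn (b u v) <= C * rn u * rn v) ->
  exists T : bop H, forall u v, b u v = inner (T u) v.
Proof.
move=> br bl bC.
have /choice[f hf] : forall u, exists y, forall v, b u v = inner y v.
  by move=> u; apply: (@riesz _ (C * rn u)) => [a x y|v]; [exact: br|exact: bC].
have fl : linear f.
  move=> a u v; apply: inner_ext => w.
  rewrite innerJ -hf bl !innerDr innerZr [inner w (f u)]innerJ.
  by rewrite [inner w (f v)]innerJ -!hf rmorphD rmorphM /= conjcK.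
have fC u : rn (f u) <= C * rn u.
  have [->|f0] := eqVneq (f u) 0.
    rewrite rn0; have [->|u0] := eqVneq u 0; first by rewrite rn0 mulr0.
    have ru := rn_gt0 u0.
    have := le_trans (rn_ge0 _) (bC u u); nra.
  have rf := rn_gt0 f0.
  have := bC u (f u); rewrite hf innerE rnC ger0_norm ?sqr_ge0 // expr2.
  by rewrite ler_pM2r.
by exists (mkbop fl fC) => u v; rewrite hf.
Qed.

(** [adj] is chosen by [xget] with default 0, so the content is that an adjoint exists: it
    represents the bounded sesquilinear form [<x, T y>]. *)
Lemma adjP (T : bop H) u v : inner (T u) v = inner u (adj T v).
Proof.
have [C C0 hC] := bop_bounded T.
have [S hS] : exists S : bop H, forall v u, inner v (T u) = inner (S v) u.
  apply: (@sesquilinear_bop _ C) => [w a x y|w a x y|x y].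
  - by rewrite bop_linear innerDr innerZr.
  - by rewrite innerDl innerZl.
  - apply: le_trans (cauchy_schwarz _ _) _.
    by have := ler_wpM2l (rn_ge0 x) (hC y); rewrite mulrA [rn x * C]mulrC.
rewrite /adj; case: xgetP => [S' _ /= -> //|/(_ S) []].
by move=> x y; rewrite innerJ hS -innerJ.
Qed.

Lemma adjPr (T : bop H) u v : inner u (T v) = inner (adj T u) v.
Proof. by rewrite innerJ adjP -innerJ. Qed.

Lemma adj_unique (T S : bop H) : (forall u v, inner (T u) v = inner u (S v)) -> adj T = S.
Proof.
by move=> h; apply: bop_ext => v; apply: inner_ext => u; rewrite -adjP h.
Qed.

Lemma adjK (T : bop H) : adj (adj T) = T.
Proof. by apply: adj_unique => u v; rewrite adjPr. Qed.

Lemma bop_adjM (S T : bop H) : adj (S * T) = adj T * adj S.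
Proof. by apply: adj_unique => u v; rewrite /= !adjP. Qed.

Lemma bop1E u : (1 : bop H) u = u. Proof. by []. Qed.
Lemma bopME (S T : bop H) u : (S * T) u = S (T u). Proof. by []. Qed.
Lemma bopDE (S T : bop H) u : (S + T) u = S u + T u. Proof. by []. Qed.
Lemma bopNE (S : bop H) u : (- S) u = - S u. Proof. by []. Qed.
Lemma bopBE (S T : bop H) u : (S - T) u = S u - T u. Proof. by []. Qed.
Lemma bopZE (a : R[i]) (S : bop H) u : (a *: S) u = a *: S u. Proof. by []. Qed.
Lemma bop0E u : (0 : bop H) u = 0. Proof. by []. Qed.

Lemma bop_adj1 : adj (1 : bop H) = 1.
Proof. exact: adj_unique. Qed.
Lemma bop_adjD (S T : bop H) : adj (S + T) = adj S + adj T.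
Proof. by apply: adj_unique => u v; rewrite !bopDE innerDl innerDr !adjP. Qed.
Lemma bop_adjN (S : bop H) : adj (- S) = - adj S.
Proof. by apply: adj_unique => u v; rewrite !bopNE innerNl innerNr !adjP. Qed.
Lemma bop_adjZ (a : R[i]) (S : bop H) : adj (a *: S) = a^*%C *: adj S.
Proof. by apply: adj_unique => u v; rewrite !bopZE innerZl innerZr !adjP. Qed.

End hilbert_theory.

(** * Total families, and isometries prescribed by Gram matrices *)

Section totality.
Context {R : realType} {H : hilbertType R} {I : Type}.
Implicit Types (a b : I -> H) (s : seq (R[i] * I)).

Definition comb a s : H := \sum_(p <- s) p.1 *: a p.2.

Definition ortho_total a := forall xi, (forall i, inner (a i) xi = 0) -> xi = 0.

Lemma comb_cat a s t : comb a (s ++ t) = comb a s + comb a t.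
Proof. by rewrite /comb big_cat. Qed.

Lemma comb_scale a c s : comb a [seq (c * p.1, p.2) | p <- s] = c *: comb a s.
Proof.
by rewrite /comb big_map scaler_sumr; apply: eq_bigr => p _; rewrite scalerA.
Qed.

(** The vectors approximable by combinations form a closed subspace [M]; the shortest vector of
    [v - M] is orthogonal to [M], hence 0. *)
Lemma ortho_total_dense a : ortho_total a ->
  forall v (e : R), 0 < e -> exists s, rn (v - comb a s) <= e.
Proof.
move=> ta v.
pose M := [set x : H | forall e : R, 0 < e -> exists s, rn (x - comb a s) <= e].
have MZ c x : M x -> M (c *: x).
  move=> Mx e e0; have c0 : 0 < rn c + 1 by have := rn_ge0 c; lra.
  have [s hs] := Mx (e / (rn c + 1)) (divr_gt0 e0 c0).
  exists [seq (c * p.1, p.2) | p <- s]; rewrite comb_scale -scalerBr rnZ.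
  move: hs; rewrite ler_pdivlMr // mulrC mulrDl mul1r.
  have := rn_ge0 (x - comb a s); lra.
have MD x y : M x -> M y -> M (x + y).
  move=> Mx My e e0; have e2 : 0 < e / 2 by lra.
  have [s hs] := Mx _ e2; have [t ht] := My _ e2; exists (s ++ t).
  rewrite comb_cat opprD addrACA; apply: le_trans (rn_triangle _ _) _; lra.
have Ma i : M (a i).
  move=> e e0; exists [:: (1, i)].
  by rewrite /comb big_seq1 scale1r subrr rn0 ltW.
have M0 : M 0 by move=> e e0; exists [::]; rewrite /comb big_nil subrr rn0 ltW.
have [||s l hs sl|z Mz zmin] := @least_norm _ H [set v - x | x in M].
- by exists (v - 0); exists 0.
- move=> _ _ [x Mx <-] [y My <-]; exists ((2^-1)%:C *: (x + y)); first exact/MZ/MD.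
  rewrite -{1}[v]scale1r.
  have -> : (1 : R[i]) = (2^-1)%:C * 2 by apply: complex_eqP => /=; field.
  by rewrite -scalerA -scalerBr scaler_nat mulr2n opprD addrACA.
- exists (v - l); last by rewrite opprB addrC subrK.
  move=> e e0; have e2 : 0 < e / 2 by lra.
  have [N hN] := sl _ e2; have [x Mx xN] := hs N; have [t ht] := Mx _ e2.
  exists t; apply: le_trans (rn_dist_triangle _ x _) _.
  have := hN _ (leqnn N); rewrite -xN.
  have -> : v - x - l = - (x - (v - l)) by rewrite !opprB addrAC -addrA addrC -addrA.
  rewrite rnN rnB; lra.
have perp x : M x -> inner z x = 0.
  move=> Mx; apply: least_norm_perp => c; apply: zmin.
  case: Mz => y My <-; exists (y - c *: x); last by rewrite opprB addrCA addrC.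
  by rewrite -scaleNr; apply: MD => //; exact: MZ.
have z0 : z = 0.
  by apply: ta => i; rewrite innerJ perp ?rmorph0.
by case: Mz => x Mx /eqP; rewrite z0 subr_eq0 => /eqP ->.
Qed.

Lemma ortho_total_ext a (S T : bop H) : ortho_total a -> (forall i, S (a i) = T (a i)) -> S = T.
Proof.
move=> ta ST; apply: bop_ext => u; apply: inner_ext => w.
apply/eqP; rewrite -subr_eq0 -innerBr; apply/eqP.
rewrite -bopBE adjPr (_ : adj (S - T) w = 0) ?inner0l //; apply: ta => i.
by rewrite -adjP bopBE ST subrr inner0l.
Qed.

Lemma comb_gram a b : (forall i j, inner (b i) (b j) = inner (a i) (a j)) ->
  forall s t, inner (comb b s) (comb b t) = inner (comb a s) (comb a t).
Proof.
move=> ab s t; rewrite /comb !inner_suml; apply: eq_bigr => p _.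
by rewrite !inner_sumr; apply: eq_bigr => q _; rewrite !innerZl !innerZr ab.
Qed.

(** The relation [G] pairs limits of combinations of [a] and of [b] with the same coefficients.
    Totality of [a] makes it everywhere defined; equal Gram matrices make it preserve inner
    products, hence single valued. *)
Lemma gram_isometry a b : ortho_total a ->
  (forall i j, inner (b i) (b j) = inner (a i) (a j)) ->
  exists J : bop H, (forall i, J (a i) = b i) /\ forall u v, inner (J u) (J v) = inner u v.
Proof.
move=> ta ab; have cab := comb_gram ab.
pose G u y := exists s : nat -> seq (R[i] * I),
  tends (fun n => comb a (s n)) u /\ tends (fun n => comb b (s n)) y.
have Gex u : exists y, G u y.
  have /choice[s hs] : forall n : nat, exists s, rn (u - comb a s) <= n.+1%:R^-1.
    by move=> n; apply: ortho_total_dense; rewrite // invr_gt0 ltr0n.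
  have su : tends (fun n => comb a (s n)) u.
    move=> e /natSinv_small[N hN]; exists N => n /hN h.
    by rewrite rnB (le_trans (hs n)).
  have [y sy] : exists l, tends (fun n => comb b (s n)) l.
    apply: cauchy_tends => e e0; have e2 : 0 < e / 2 by lra.
    have [N hN] := su _ e2; exists N => m n /hN hm /hN hn.
    have -> : rn (comb b (s m) - comb b (s n)) = rn (comb a (s m) - comb a (s n)).
      apply/eqP; rewrite -(@eqrXn2 _ 2) ?rn_ge0 // !rn_inner.
      by rewrite !(innerBl, innerBr) !cab.
    apply: le_trans (rn_dist_triangle _ u _) _; rewrite (rnB u); lra.
  by exists y, s.
have Ginner u v x y : G u x -> G v y -> inner x y = inner u v.
  move=> [s [su sx]] [t [tv ty]]; apply: (tends_unique (tends_inner sx ty)).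
  by under [X in tends X]eq_fun do rewrite cab; exact: tends_inner.
have Glin c u v x y : G u x -> G v y -> G (c *: u + v) (c *: x + y).
  move=> [s [su sx]] [t [tv ty]].
  exists (fun n => [seq (c * p.1, p.2) | p <- s n] ++ t n).
  have tZ (r : nat -> H) l : tends r l -> tends (fun n => c *: r n) (c *: l).
    move=> rl; apply: (@tends_squeeze _ _ _ _ _ (fun n => r n - l) (rn c)) => [n|].
      by rewrite -scalerBr rnZ.
    by have := tendsD rl (tends_cst (- l)); rewrite subrr.
  split; (under [X in tends X]eq_fun do rewrite comb_cat comb_scale);
    by apply: tendsD => //; exact: tZ.
(* The difference of two partners of [u] is a partner of 0, so its norm is 0. *)
have Gfun u x y : G u x -> G u y -> x = y.
  move=> Gx Gy; apply/eqP; rewrite -subr_eq0; apply/eqP/inner_eq0.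
  have : G ((-1) *: u + u) ((-1) *: y + x) by exact: Glin.
  rewrite !scaleN1r addNr addrC => h.
  by rewrite (Ginner _ _ _ _ h h) inner0r.
have /choice[f hf] := Gex.
have fl : linear f by move=> c u v; apply: Gfun (hf _) _; exact: Glin.
have fi u v : inner (f u) (f v) = inner u v by exact: Ginner.
have fC u : rn (f u) <= 1 * rn u.
  by rewrite mul1r -(@ler_pXn2r _ 2) ?nnegrE ?rn_ge0 // !rn_inner fi.
exists (mkbop fl fC); split => // i /=; apply: Gfun (hf _) _.
exists (fun=> [:: (1, i)]); rewrite /comb.
by split; (under [X in tends X]eq_fun do rewrite big_seq1 scale1r); exact: tends_cst.
Qed.

End totality.

Section total_set.
Context {R : realType} {H : hilbertType R}.

Lemma total_set_ortho (S : set H) : total_set S ->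
  forall xi, (forall s, S s -> inner s xi = 0) -> xi = 0.
Proof.
move=> tS xi h; apply: rn_le_eps => e e0.
have : closure (lin_span S) xi by rewrite tS.
have e1 : 0 < e%:C by rewrite ltr_ReC.
move=> /(_ (ball xi e%:C)) []; first exact: nbhsx_ballx.
move=> v [[n [c [s [Ss ->]]]]]; rewrite -ball_normE /ball_ /= normE ltr_ReC => hv.
have ixi : inner (\sum_i c i *: s i) xi = 0.
  by rewrite inner_suml big1 // => i _; rewrite innerZl h // mulr0.
have [->|x0] := eqVneq xi 0; first by rewrite rn0 ltW.
have rx := rn_gt0 x0.
rewrite -(ler_pM2r rx) -expr2 rn_inner.
have -> : inner xi xi = inner (xi - \sum_i c i *: s i) xi by rewrite innerBl ixi subr0.
apply: le_trans (ler_norm _) _; apply: le_trans (Re_le_rn _) _.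
apply: le_trans (cauchy_schwarz _ _) _; rewrite ler_wpM2r ?rn_ge0 //; exact: ltW.
Qed.

End total_set.

Section operators.
Context {R : realType} {H : hilbertType R}.
Implicit Types (u v x y : H) (S T U V : bop H).

Lemma ketbra_linear x y : linear (fun u => inner y u *: x).
Proof. by move=> a u v; rewrite inner_linear scalerDl scalerA. Qed.

Lemma ketbra_bounded x y u : rn (inner y u *: x) <= rn x * rn y * rn u.
Proof. by rewrite rnZ mulrC -mulrA ler_wpM2l ?rn_ge0 // cauchy_schwarz. Qed.

Definition ketbra x y : bop H := mkbop (ketbra_linear x y) (ketbra_bounded x y).

Lemma ketbraE x y u : ketbra x y u = inner y u *: x.
Proof. by []. Qed.

Lemma adj_ketbra x y : adj (ketbra x y) = ketbra y x.
Proof.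
apply: adj_unique => u v; rewrite !ketbraE innerZl innerZr -innerJ.
by rewrite mulrC.
Qed.

Lemma ketbra_mull T x y : T * ketbra x y = ketbra (T x) y.
Proof. by apply: bop_ext => u; rewrite bopME !ketbraE bop_Z. Qed.

Lemma ketbra_mulr T x y : ketbra x y * T = ketbra x (adj T y).
Proof. by apply: bop_ext => u; rewrite bopME !ketbraE adjPr. Qed.

Lemma ketbraZl (a : R[i]) x y : ketbra (a *: x) y = a *: ketbra x y.
Proof. by apply: bop_ext => u; rewrite bopZE !ketbraE !scalerA mulrC. Qed.

Lemma ketbraDl x x' y : ketbra (x + x') y = ketbra x y + ketbra x' y.
Proof. by apply: bop_ext => u; rewrite bopDE !ketbraE scalerDr. Qed.

Lemma ketbra_comp x y x' y' : ketbra x y * ketbra x' y' = inner y x' *: ketbra x y'.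
Proof. by rewrite ketbra_mull ketbraE ketbraZl. Qed.

Definition isometric V := forall u v, inner (V u) (V v) = inner u v.

Lemma isometric_rn V u : isometric V -> rn (V u) = rn u.
Proof.
by move=> iV; apply/eqP; rewrite -(@eqrXn2 _ 2) ?rn_ge0 // !rn_inner iV.
Qed.

Lemma isometric_adjK V u : isometric V -> adj V (V u) = u.
Proof. by move=> iV; apply: inner_ext => w; rewrite -adjP iV. Qed.

Lemma isometric_adjM V : isometric V -> adj V * V = 1.
Proof. by move=> iV; apply: bop_ext => u; exact: isometric_adjK. Qed.

Lemma isometric_inj V u v : isometric V -> V u = V v -> u = v.
Proof. by move=> iV uv; rewrite -(isometric_adjK u iV) uv isometric_adjK. Qed.

Lemma adj_isometric_rn V u : isometric V -> rn (adj V u) <= rn u.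
Proof.
move=> iV; have [->|a0] := eqVneq (adj V u) 0; first by rewrite rn0 rn_ge0.
have ra := rn_gt0 a0.
rewrite -(ler_pM2r ra) -expr2 rn_inner -adjP.
apply: le_trans (ler_norm _) _; apply: le_trans (Re_le_rn _) _.
by apply: le_trans (cauchy_schwarz _ _) _; rewrite (isometric_rn _ iV) mulrC.
Qed.

Lemma unitary_isometric U : unitary U -> isometric U.
Proof. by case=> aU _ u v; rewrite adjP -bopME aU. Qed.

Lemma unitary_adjK U u : unitary U -> adj U (U u) = u.
Proof. by case=> aU _; rewrite -bopME aU. Qed.

Lemma unitary_adjKr U u : unitary U -> U (adj U u) = u.
Proof. by case=> _ aU; rewrite -bopME aU. Qed.

Lemma unitary_adj U : unitary U -> unitary (adj U).
Proof. by case=> a b; split; rewrite adjK. Qed.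

Lemma unitary_right_inverse U T : isometric U -> U * T = 1 -> unitary U.
Proof.
move=> iU UT; have aU := isometric_adjM iU; split => //.
by have <- : T = adj U by rewrite -[T]mul1r -aU -mulrA UT mulr1.
Qed.

Lemma unitaryZ (a : R[i]) U : rn a = 1 -> unitary U -> unitary (a *: U).
Proof.
move=> a1 [s1 s2]; rewrite /unitary bop_adjZ.
have aa : a^*%C * a = 1 by rewrite mulJ_rn a1 expr1n.
have e1 (S T : bop H) b c : (b *: S) * (c *: T) = (b * c) *: (S * T).
  by apply: bop_ext => u; rewrite bopME !bopZE bop_Z scalerA.
by split; rewrite e1 ?s1 ?s2 ?[a * _]mulrC aa scale1r.
Qed.

(** Polarization in two stages: the norm of [u + v] gives the real part, and [i v] in place of [v]
    the imaginary part. *)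
Lemma isometric1_rn V : (forall u, rn (V u) = rn u) -> isometric V.
Proof.
move=> hV.
have re u v : complex.Re (inner (V u) (V v)) = complex.Re (inner u v).
  have := rn_sqrD u v; rewrite -(hV (u + v)) bop_D rn_sqrD !hV; lra.
move=> u v; apply: complex_eqP => //.
have := re u ((0 +i* 1) *: v); rewrite bop_Z !innerZr.
by rewrite !cReM /= !mul0r !mul1r !sub0r => /oppr_inj.
Qed.

End operators.

(** * Exponential vectors *)

Section ryser.
Context {R : comPzRingType}.

(** Inclusion-exclusion over the sets that contain the image of [f]: the sum factors over the points
    [j] into [1 - [j not in the image]], hence vanishes unless [f] is onto, that is, injective. *)
Lemma sum_signed_supersets n (f : {ffun 'I_n -> 'I_n}) :
  \sum_(S in {set 'I_n}) (-1) ^+ #|~: S| * \prod_i (f i \in S)%:R =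
  (injectiveb f)%:R :> R.
Proof.
transitivity (\sum_(S in {set 'I_n}) \prod_j (if j \in S then 1 else - (j \notin codom f)%:R) : R).
  apply: eq_bigr => S _.
  have [/existsP[i fi]|/existsPn h] := boolP [exists i, f i \notin S].
    rewrite (bigD1 i) //= (negbTE fi) mul0r mulr0.
    by rewrite (bigD1 (f i)) //= (negbTE fi) codom_f /= oppr0 mul0r.
  rewrite big1 ?mulr1 => [|i _]; last by have := h i; rewrite negbK => ->.
  rewrite (bigID (mem S)) /= big1 => [|j ->//]; rewrite mul1r.
  rewrite (eq_bigr (fun=> -1)) => [|j jS].
    by rewrite prodr_const; congr (_ ^+ _); apply: eq_card => j; rewrite !inE.
  rewrite (negbTE jS) (_ : j \notin codom f = true) //.
  by apply: contraNN jS => /codomP[i ->]; have := h i; rewrite negbK.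
rewrite -bigA_distr /=.
have [/injectiveP fi|fni] := boolP (injectiveb f).
  rewrite big1 // => j _; suff -> : j \in codom f by rewrite oppr0 addr0.
  by have := inj_card_onto fi; apply.
have [j jf] : exists j, j \notin codom f.
  apply/existsP; rewrite -negb_forall; apply: contraNN fni => /forallP h.
  have [g gK] : exists g : 'I_n -> 'I_n, cancel g f.
    by exists (fun j => iinv (h j)) => j; rewrite f_iinv.
  apply/injectiveP; apply: (@can_inj _ _ _ g); apply: (bij_can_sym _ _).2 => //.
  exact: injF_bij (can_inj gK).
by rewrite (bigD1 j) //= jf subrr mul0r.
Qed.

(* Polarizes n-th powers, so exponential vectors are total. *)
Lemma ryser n (a : 'I_n -> 'I_n -> R) :
  \sum_(S in {set 'I_n}) (-1) ^+ #|~: S| * \prod_i \sum_(j in S) a i j =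
  \sum_(s : 'S_n) \prod_i a i (s i).
Proof.
transitivity (\sum_(S in {set 'I_n}) \sum_(f : {ffun 'I_n -> 'I_n})
    (-1) ^+ #|~: S| * (\prod_i a i (f i) * \prod_i (f i \in S)%:R)).
  apply: eq_bigr => S _; rewrite -mulr_sumr; congr (_ * _).
  under eq_bigr => i _.
    rewrite (_ : \sum_(j in S) _ = \sum_j a i j * (j \in S)%:R); last first.
      by rewrite big_mkcond /=; apply: eq_bigr => j _; case: ifP; rewrite ?mulr1 ?mulr0.
  over.
  by rewrite bigA_distr_bigA; apply: eq_bigr => f _; rewrite big_split.
rewrite exchange_big /=.
transitivity (\sum_(f : {ffun 'I_n -> 'I_n}) \prod_i a i (f i) * (injectiveb f)%:R).
  apply: eq_bigr => f _; rewrite -sum_signed_supersets mulr_sumr.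
  by apply: eq_bigr => S _; rewrite mulrCA.
rewrite (bigID (fun f : {ffun 'I_n -> 'I_n} => injectiveb f)) /= addrC big1 ?add0r => [|f /negbTE ->]; last by rewrite mulr0.
rewrite (reindex (@pval _)) /=; last first.
  pose in_Sn := insubd (1%g : 'S_n).
  by exists in_Sn => /= f Uf; first apply: val_inj; apply: insubdK.
apply: eq_big => /= [s|s _]; rewrite ?(valP s) // mulr1.
by apply: eq_bigr => i _; rewrite pvalE.
Qed.

End ryser.

Section exp_tail.
Context {R : realType}.

(** For [k >= m] and [s <= 1] one has [s^k <= s^m]. Used with [s = t^2], this gives remainders of
    order [t^n] for exponential vectors. *)
Lemma pexp_tail_le m n (s y : R) : 0 <= s -> s <= 1 -> 0 <= y -> (m <= n)%N ->
  series (exp_coeff (s * y)) n - series (exp_coeff (s * y)) m <= s ^+ m * expR y.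
Proof.
move=> s0 s1 y0 mn; rewrite sub_series_geq // /exp_coeff /=.
apply: (@le_trans _ _ (s ^+ m * series (exp_coeff y) n)); last first.
  rewrite ler_wpM2l ?exprn_ge0 //.
  have := @is_cvg_series_exp_coeff R y; move=> /(nondecreasing_cvgn_le _) h.
  apply: h => a b ab; rewrite -subr_ge0 sub_series_geq //.
  by apply: sumr_ge0 => i _; exact: exp_coeff_ge0.
rewrite /series /= mulr_sumr (@big_cat_nat _ _ _ m 0) //=.
apply: (@le_trans _ _ (\sum_(m <= k < n) s ^+ m * (y ^+ k / k`!%:R))); last first.
  rewrite lerDr; apply: sumr_ge0 => i _.
  by rewrite !mulr_ge0 ?exprn_ge0 ?invr_ge0 ?ler0n.
rewrite !big_nat; apply: ler_sum => k /andP[mk _].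
rewrite exprMn mulrA ler_wpM2r ?invr_ge0 ?ler0n // ler_wpM2r ?exprn_ge0 //.
by rewrite ler_wiXn2l.
Qed.

End exp_tail.

Section fock_theory.
Context {R : realType} {H : hilbertType R} (F : fock_space H).
Implicit Types u v w : H.

Definition npart n u : F := fock_tensor F (fun _ : 'I_n => u).

Lemma inner_fock_npart n (v : 'I_n -> H) u :
  inner (fock_tensor F v) (npart n u) = \prod_i inner (v i) u.
Proof.
rewrite /npart fock_inner sumr_const card_Sn -[X in _ * X]mulr_natr mulrCA mulVf ?mulr1 //.
Qed.

Lemma inner_npart n u v : inner (npart n u) (npart n v) = inner u v ^+ n.
Proof. by rewrite inner_fock_npart prodr_const card_ord. Qed.

Lemma inner_npart_neq m n u v : m != n -> inner (npart m u) (npart n v) = 0.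
Proof. exact: fock_orthogonal. Qed.

(** Linearity properties of [fock_tensor] are read off its inner products: the difference of both
    sides has norm 0. *)
Lemma npartZ n (a : R[i]) u : npart n (a *: u) = a ^+ n *: npart n u.
Proof.
apply/eqP; rewrite -subr_eq0; apply/eqP/inner_eq0.
rewrite !(innerBl, innerBr, innerZl, innerZr) !inner_npart !(innerZl, innerZr).
by rewrite !exprMn rmorphXn /=; ring.
Qed.

Definition ecoef n : R := (Num.sqrt (n`!%:R))^-1.

Lemma ecoef_gt0 n : 0 < ecoef n.
Proof. by rewrite invr_gt0 sqrtr_gt0 ltr0n fact_gt0. Qed.

Lemma ecoef_sqr n : ecoef n * ecoef n = n`!%:R^-1.
Proof. by rewrite -invfM -expr2 sqr_sqrtr // ler0n. Qed.

Lemma ecoefE n : (sqrtC (n`!%:R : R[i]))^-1 = (ecoef n)%:C.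
Proof.
rewrite fmorphV; congr _^-1.
rewrite -[LHS](_ : sqrtC ((Num.sqrt (n`!%:R : R))%:C ^+ 2) = _).
  by rewrite sqrCK // -[0]/(0%:C) ler_ReC sqrtr_ge0.
by rewrite -rmorphXn /= sqr_sqrtr ?ler0n // natrC.
Qed.

Definition epart n u : F := \sum_(0 <= k < n) (ecoef k)%:C *: npart k u.

Lemma inner_npart_epart k n u v : inner (npart k u) (epart n v) =
  if (k < n)%N then (ecoef k)%:C * inner u v ^+ k else 0.
Proof.
rewrite /epart inner_sumr; case: ifPn => [kn|nk].
  rewrite (bigD1_seq k) ?iota_uniq ?mem_index_iota //= innerZr inner_npart.
  by rewrite big1 ?addr0 // => j jk; rewrite innerZr inner_npart_neq ?mulr0 // eq_sym.
rewrite big_nat big1 // => j /andP[_ jn]; rewrite innerZr inner_npart_neq ?mulr0 //.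
by apply: contraNN nk => /eqP ->.
Qed.

Lemma inner_epart m n u v : (m <= n)%N -> inner (epart m u) (epart n v) = pexp m (inner u v).
Proof.
move=> mn; rewrite {1}/epart inner_suml /pexp !big_nat; apply: eq_bigr => k /andP[_ km].
rewrite innerZl inner_npart_epart (leq_trans km mn) mulrA cjC.
by rewrite -rmorphM /= ecoef_sqr mulrC fmorphV /= -natrC.
Qed.

Lemma inner_epartr m n u v : (m <= n)%N -> inner (epart n u) (epart m v) = pexp m (inner u v).
Proof.
move=> mn; rewrite innerJ inner_epart // [inner v u]innerJ /pexp rmorph_sum.
apply: eq_bigr => k _; rewrite rmorphM rmorphXn fmorphV /= conjcK.
by rewrite natrC cjC.
Qed.

Lemma rn_epart m n u : (m <= n)%N -> rn (epart n u - epart m u) ^+ 2 =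
  series (exp_coeff (rn u ^+ 2)) n - series (exp_coeff (rn u ^+ 2)) m.
Proof.
move=> mn; rewrite rn_sqrB !rn_inner (inner_epartr _ _ mn) !inner_epart //.
by rewrite innerE !pexpC /=; ring.
Qed.

(** [expvec] is a [lim], meaningful only with convergence: by [rn_epart] the squared increments of
    the partial sums are increments of the real exponential series at [|u|^2]. *)
Lemma tends_expvec u : tends (epart^~ u) (expvec F u).
Proof.
have [l hl] : exists l, tends (epart^~ u) l.
  apply: cauchy_tends => e e0.
  have e2 : 0 < e ^+ 2 / 2 by rewrite divr_gt0 ?exprn_gt0.
  have [N hN] := tends_real (@is_cvg_series_exp_coeff R (rn u ^+ 2)) e2.
  have key m n : (N <= m)%N -> (m <= n)%N -> rn (epart n u - epart m u) <= e.
    move=> Nm mn; rewrite -(@ler_pXn2r _ 2) ?nnegrE ?rn_ge0 ?(ltW e0) // rn_epart //.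
    have := hN m Nm; have := hN n (leq_trans Nm mn).
    rewrite -!rmorphB /= !rnC !ler_norml => /andP[_ h1] /andP[h2 _]; lra.
  exists N => m n Nm Nn; have [mn|/ltnW nm] := leqP m n; last exact: key.
  by rewrite rnB; exact: key.
suff -> : expvec F u = l by [].
rewrite /expvec; apply/cvg_lim => //; apply/tends_cvg.
move: hl; congr tends; apply/funext => n; rewrite /epart /series /=.
by apply: eq_bigr => k _; rewrite ecoefE.
Qed.

Lemma inner_exp u v : inner (expvec F u) (expvec F v) = cexp (inner u v).
Proof.
apply: (tends_unique (tends_inner (tends_expvec u) (tends_expvec v))).
by under [X in tends X]eq_fun do rewrite inner_epart //; exact: tends_pexp.
Qed.

Lemma inner_npart_exp k u v :
  inner (npart k u) (expvec F v) = (ecoef k)%:C * inner u v ^+ k.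
Proof.
apply: (tends_unique (tends_innerr (npart k u) (tends_expvec v))) => e e0.
by exists k.+1 => n kn; rewrite inner_npart_epart kn subrr rn0 ltW.
Qed.

Lemma rn_exp u : rn (expvec F u) ^+ 2 = expR (rn u ^+ 2).
Proof. by rewrite rn_inner inner_exp innerE cexpC. Qed.

Definition vac : F := expvec F 0.

Lemma inner_vac u : inner vac (expvec F u) = 1.
Proof. by rewrite inner_exp inner0l cexp0. Qed.

Lemma inner_vacr u : inner (expvec F u) vac = 1.
Proof. by rewrite inner_exp inner0r cexp0. Qed.

Lemma rn_vac : rn vac = 1.
Proof. by apply/eqP; rewrite -(@eqrXn2 _ 2) ?rn_ge0 // rn_inner inner_vac expr1n. Qed.

Lemma rn_exp_tail n u (t : R) : 0 <= t -> t <= 1 ->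
  rn (expvec F (t%:C *: u) - epart n (t%:C *: u)) <= t ^+ n * expR (rn u ^+ 2).
Proof.
move=> t0 t1.
have e1 : 1 <= expR (rn u ^+ 2).
  by apply: le_trans (expR_ge1Dx _); rewrite lerDl sqr_ge0.
have h m : (n <= m)%N -> rn (epart m (t%:C *: u) - epart n (t%:C *: u)) <= t ^+ n * expR (rn u ^+ 2).
  move=> nm; rewrite -(@ler_pXn2r _ 2) ?nnegrE ?rn_ge0 ?mulr_ge0 ?exprn_ge0 ?expR_ge0 //.
  rewrite rn_epart // rnZ rnC ger0_norm // exprMn.
  apply: le_trans (pexp_tail_le _ _ _ nm) _; rewrite ?sqr_ge0 //.
    by rewrite exprn_ile1.
  have -> : (t ^+ 2) ^+ n = (t ^+ n) ^+ 2 by rewrite -!exprM mulnC.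
  rewrite exprMn ler_wpM2l ?sqr_ge0 // expr2 ler_peMr //.
apply: tends_rn_le (tends_shift n (tendsD (tends_expvec _) (tends_cst (- epart n (t%:C *: u))))) _.
by move=> m; apply: h; rewrite leq_addl.
Qed.

(** Induction on [n], testing with [e(t u)]: lower degrees vanish by induction and the remainder is
    of order [t^(n+1)], so division by [t^n] isolates degree [n]. *)
Lemma exp_ortho_npart xi : (forall u, inner (expvec F u) xi = 0) ->
  forall n u, inner (npart n u) xi = 0.
Proof.
move=> xi0; elim/ltn_ind => n IH u.
apply: (@rn_le_Ct _ _ ((ecoef n)^-1 * expR (rn u ^+ 2) * rn xi)) => t t0 t1.
have := xi0 (t%:C *: u).
rewrite -[expvec _ _](subrK (epart n.+1 (t%:C *: u))) innerDl.
have eS : epart n.+1 (t%:C *: u) = epart n (t%:C *: u) + (ecoef n)%:C *: npart n (t%:C *: u).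
  by rewrite /epart big_nat_recr.
have e0 : inner (epart n (t%:C *: u)) xi = 0.
  rewrite /epart inner_suml big_nat big1 // => k /andP[_ kn].
  by rewrite innerZl npartZ innerZl IH // !mulr0.
rewrite {2}eS innerDl e0 add0r npartZ scalerA innerZl => /eqP; rewrite addrC addr_eq0 => /eqP h.
have : rn ((((ecoef n)%:C * t%:C ^+ n)^*)%C * inner (npart n u) xi) <= t ^+ n.+1 * expR (rn u ^+ 2) * rn xi.
  rewrite h rnN; apply: le_trans (cauchy_schwarz _ _) _.
  by rewrite ler_wpM2r ?rn_ge0 // rn_exp_tail // ltW.
rewrite rnM rnJ rnM -rmorphXn /= !rnC (ger0_norm (ltW (ecoef_gt0 _))) ger0_norm ?exprn_ge0 ?(ltW t0) //.
have tn : 0 < t ^+ n by rewrite exprn_gt0.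
rewrite exprS => {}h.
have : ecoef n * rn (inner (npart n u) xi) <= t * expR (rn u ^+ 2) * rn xi.
  by rewrite -(ler_pM2l tn); lra.
rewrite mulrC -ler_pdivlMr ?ecoef_gt0 // => /le_trans; apply.
by rewrite le_eqVlt; apply/orP; left; apply/eqP; ring.
Qed.

(** By [ryser] both sides have the same inner products with all tensors of degree [n]; being
    combinations of such tensors, they coincide. *)
Lemma polarization n (u : 'I_n -> H) :
  \sum_(S in {set 'I_n}) (-1) ^+ #|~: S| *: npart n (\sum_(j in S) u j) =
  n`!%:R *: fock_tensor F u.
Proof.
set X := LHS; set Y := RHS.
have XY (v : 'I_n -> H) : inner (fock_tensor F v) X = inner (fock_tensor F v) Y.
  rewrite /X /Y innerZr fock_inner mulrA mulfV ?pnatr_eq0 -?lt0n ?fact_gt0 // mul1r.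
  rewrite -(ryser (fun i j => inner (v i) (u j))) inner_sumr; apply: eq_bigr => S _.
  rewrite innerZr inner_fock_npart; congr (_ * _); apply: eq_bigr => i _.
  by rewrite -big_filter inner_sumr big_filter.
apply/eqP; rewrite -subr_eq0; apply/eqP/inner_eq0.
rewrite innerBl {1}/X {2}/Y inner_suml innerZl !innerBr XY subrr mulr0 subr0.
by apply: big1 => S _; rewrite innerZl innerBr XY subrr mulr0.
Qed.

Lemma exp_total : ortho_total (expvec F).
Proof.
move=> xi xi0; apply: (total_set_ortho (fock_total F)) => _ [n [u ->]].
have nf : (n`!%:R : R[i]) != 0 by rewrite pnatr_eq0 -lt0n fact_gt0.
suff : inner (n`!%:R *: fock_tensor F u) xi = 0.
  by rewrite innerZl natrC cjC -natrC => /eqP; rewrite mulf_eq0 (negbTE nf) => /eqP.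
rewrite -polarization inner_suml big1 // => S _.
by rewrite innerZl exp_ortho_npart ?mulr0.
Qed.

Lemma exp_ext (S T : bop F) : (forall u, S (expvec F u) = T (expvec F u)) -> S = T.
Proof. exact: ortho_total_ext exp_total. Qed.

Lemma exp_kernel_ext (S T : bop F) :
  (forall u v, inner (expvec F u) (S (expvec F v)) = inner (expvec F u) (T (expvec F v))) -> S = T.
Proof.
move=> ST; apply: exp_ext => v; apply/eqP; rewrite -subr_eq0; apply/eqP.
by apply: exp_total => u; rewrite innerBr ST subrr.
Qed.

Definition ione u : F := npart 1 u.

Lemma inner_ione u v : inner (ione u) (ione v) = inner u v.
Proof. by rewrite inner_npart expr1. Qed.

Lemma ecoef1 : ecoef 1 = 1.
Proof. by rewrite /ecoef (_ : 1`! = 1%N) // sqrtr1 invr1. Qed.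

Lemma inner_ione_exp u v : inner (ione u) (expvec F v) = inner u v.
Proof. by rewrite inner_npart_exp ecoef1 mul1r expr1. Qed.

Lemma inner_exp_ione u v : inner (expvec F u) (ione v) = inner u v.
Proof. by rewrite innerJ inner_ione_exp -innerJ. Qed.

Lemma inner_ione_vac u : inner (ione u) vac = 0.
Proof. by rewrite inner_ione_exp inner0r. Qed.

Lemma rn_ione u : rn (ione u) = rn u.
Proof. by apply/eqP; rewrite -(@eqrXn2 _ 2) ?rn_ge0 // !rn_inner inner_ione. Qed.

Lemma ione_linear : linear ione.
Proof.
move=> a u v; apply/eqP; rewrite -subr_eq0; apply/eqP/inner_eq0.
rewrite !(innerBl, innerBr, innerDl, innerDr, innerZl, innerZr) !inner_ione.
by rewrite !(innerBl, innerBr, innerDl, innerDr, innerZl, innerZr); ring.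
Qed.

(** Pairing with the one-particle vector of [u - v] reads [u - v] off the exponential vectors.
    Besides injectivity this gives the continuity of the inverse of [u |-> e(u)]. *)
Lemma rn_sub_le_exp u v : rn (u - v) <= rn (expvec F u - expvec F v).
Proof.
have [->|w0] := eqVneq (u - v) 0; first by rewrite rn0 rn_ge0.
have rw := rn_gt0 w0.
rewrite -(ler_pM2r rw) -expr2 rn_inner.
have -> : inner (u - v) (u - v) = inner (ione (u - v)) (expvec F u - expvec F v).
  by rewrite [RHS]innerBr !inner_ione_exp -innerBr.
apply: le_trans (ler_norm _) _; apply: le_trans (Re_le_rn _) _.
by apply: le_trans (cauchy_schwarz _ _) _; rewrite rn_ione mulrC.
Qed.

Lemma expvec_inj : injective (expvec F).
Proof.
move=> u v uv; apply/eqP; rewrite -subr_eq0; apply/eqP/rn0_eq0/eqP.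
by rewrite eq_le rn_ge0 andbT (le_trans (rn_sub_le_exp u v)) // uv subrr rn0.
Qed.

Lemma rn_exp_sub1 u : rn (expvec F u - vac) <= rn u * expR (rn u ^+ 2).
Proof.
have e1 : 1 <= expR (rn u ^+ 2).
  by apply: le_trans (expR_ge1Dx _); rewrite lerDl sqr_ge0.
rewrite -(@ler_pXn2r _ 2) ?nnegrE ?rn_ge0 ?mulr_ge0 ?expR_ge0 ?rn_ge0 //.
rewrite rn_sqrB rn_exp rn_vac inner_vacr exprMn /=.
have : (1 - rn u ^+ 2) * expR (rn u ^+ 2) <= 1.
  have := ler_wpM2r (ltW (expR_gt0 (rn u ^+ 2))) (expR_ge1Dx (- rn u ^+ 2)).
  by rewrite -expRD addNr expR0.
have := sqr_ge0 (rn u); move: (rn u ^+ 2) e1 => x; nra.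
Qed.

(** The square of the left side is [exp x - 1 - x] with [x = |u|^2]. *)
Lemma rn_exp_sub2 u : rn (expvec F u - vac - ione u) <= rn u ^+ 2 * expR (rn u ^+ 2).
Proof.
have e1 : 1 <= expR (rn u ^+ 2).
  by apply: le_trans (expR_ge1Dx _); rewrite lerDl sqr_ge0.
rewrite -(@ler_pXn2r _ 2) ?nnegrE ?rn_ge0 ?mulr_ge0 ?expR_ge0 ?sqr_ge0 ?rn_ge0 //.
rewrite rn_sqrB rn_sqrB rn_exp rn_vac inner_vacr rn_ione innerBl.
rewrite inner_exp_ione [inner vac _]innerJ inner_ione_vac rmorph0 subr0 -rn_inner /=.
have := expR_sub_le (sqr_ge0 (rn u)).
by have := sqr_ge0 (rn u); move: (rn u ^+ 2) e1 => x; nra.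
Qed.

Lemma rn_cexp_lip (a b : R[i]) (r : R) : complex.Re b <= r -> rn (a - b) <= r ->
  rn (cexp a - cexp b) <= rn (a - b) * expR (r + r).
Proof.
move=> br abr.
have -> : cexp a - cexp b = cexp b * (cexp (a - b) - 1).
  by rewrite mulrBr -cexpD (_ : b + (a - b) = a) ?mulr1 // addrC subrK.
rewrite rnM rn_cexp expRD mulrCA [X in _ <= X]mulrC -mulrA [X in _ <= X]mulrC.
have h : rn (cexp (a - b) - 1) <= rn (a - b) * expR r.
  have := rn_cexp_sub (a - b); set z := a - b.
  have := rn_sub_le (cexp z - 1) z.
  have : expR (rn z) - 1 <= rn z * expR r.
    have := ler_wpM2r (ltW (expR_gt0 (rn z))) (expR_ge1Dx (- rn z)).
    rewrite -expRD addNr expR0.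
    have := ler_wpM2l (rn_ge0 z) (_ : expR (rn z) <= expR r); rewrite ler_expR => /(_ abr).
    lra.
  lra.
have hb : expR (complex.Re b) <= expR r by rewrite ler_expR.
have := expR_ge0 (complex.Re b); have := rn_ge0 (cexp (a - b) - 1).
have := expR_ge0 r; have := rn_ge0 (a - b); nra.
Qed.

(** The squared distance is a sum of two differences of values of [cexp], each Lipschitz in [u - v]
    on bounded sets; so [e] is Hoelder continuous of exponent 1/2 on balls. *)
Lemma rn_expB u v (r : R) : 1 <= r -> rn u <= r -> rn v <= r ->
  rn (expvec F u - expvec F v) ^+ 2 <= 2 * r * expR (4 * r ^+ 2) * rn (u - v).
Proof.
move=> r1 ur vr; have r0 : 0 <= r by lra.
have uvr : rn (u - v) <= 2 * r by have := rn_triangleB u v; lra.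
have h (x y z : H) : rn x <= r -> rn y <= r -> rn z <= r ->
    rn (y - z) <= 2 * r -> rn (cexp (inner x y) - cexp (inner x z)) <= r * rn (y - z) * expR (4 * r ^+ 2).
  move=> xr yr zr yzr.
  have -> : 4 * r ^+ 2 = 2 * r ^+ 2 + 2 * r ^+ 2 by ring.
  have i1 : rn (inner x y - inner x z) <= r * rn (y - z).
    rewrite -innerBr; apply: le_trans (cauchy_schwarz _ _) _.
    by rewrite ler_wpM2r ?rn_ge0.
  (* [2 r^2] bounds both [|<x, z>| <= r^2] and [|<x, y - z>| <= r * 2 r]; [rn_cexp_lip] doubles it,
     whence [4 r^2]. *)
  apply: le_trans (@rn_cexp_lip _ _ (2 * r ^+ 2) _ _) _.
  - apply: le_trans (ler_norm _) _; apply: le_trans (Re_le_rn _) _.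
    apply: le_trans (cauchy_schwarz _ _) _.
    by have := rn_ge0 x; have := rn_ge0 z; nra.
  - by apply: le_trans i1 _; have := rn_ge0 (y - z); nra.
  by rewrite ler_wpM2r ?expR_ge0.
have h1 := h u u v ur ur vr uvr.
have h2 := h v v u vr vr ur; rewrite rnB in h2; have {}h2 := h2 uvr.
rewrite rn_inner innerBl !innerBr !inner_exp.
rewrite opprB (addrC (cexp (inner v v))) addrA -addrA cReD.
have := le_trans (ler_norm _) (le_trans (Re_le_rn _) h1).
have := le_trans (ler_norm _) (le_trans (Re_le_rn _) h2).
rewrite !cReD !cReN; lra.
Qed.

End fock_theory.

(** * Weyl operators and intertwiners of CCR flows *)

Section weyl_operators.
Context {R : realType}.

Context {H : hilbertType R} (F : fock_space H).
Implicit Types u v w : H.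

Lemma half_norm u : `|u| ^+ 2 / 2 = (rn u ^+ 2 / 2)%:C.
Proof. by rewrite normE -rmorphXn /= natrC -fmorphV -rmorphM. Qed.

(** [weyl] is chosen with default 1. The prescribed images have the Gram matrix of the exponential
    vectors, which gives an isometry, and the isometry for [- u] is a right inverse. *)
Lemma weylP u : unitary (weyl F u) /\ forall v,
  weyl F u (expvec F v) = cexp (- (`|u| ^+ 2 / 2) - inner u v) *: expvec F (u + v).
Proof.
pose b x v := cexp (- (`|x| ^+ 2 / 2) - inner x v) *: expvec F (x + v).
have gram x v w : inner (b x v) (b x w) = inner (expvec F v) (expvec F w).
  rewrite /b innerZl innerZr !inner_exp -cexpJ -!cexpD; congr cexp.
  rewrite !innerDl !innerDr half_norm innerE [inner v x]innerJ rmorphB rmorphN /=.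
  by apply: complex_eqP; rewrite ?(cReD, cReN, cImD, cImN) /=; field.
have ex x : exists J : bop F, (forall v, J (expvec F v) = b x v) /\ isometric J.
  exact: gram_isometry (@exp_total _ _ F) (gram x).
have uex x : exists W : bop F, unitary W /\ forall v, W (expvec F v) = b x v.
  have [J [Jb iJ]] := ex x; have [K [Kb iK]] := ex (- x).
  exists J; split => //; apply: (unitary_right_inverse iJ (T := K)).
  apply: (@exp_ext _ _ F) => v; rewrite bopME Kb bop_Z Jb scalerA -cexpD.
  rewrite (_ : x + (- x + v) = v) ?addrA ?subrr ?add0r // (_ : _ + _ = 0) ?cexp0 ?scale1r //.
  rewrite !half_norm rnN innerDr innerNl innerNr innerE.
  by apply: complex_eqP; rewrite ?(cReD, cReN, cImD, cImN) /=; field.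
rewrite /weyl; case: xgetP => [W _ //|/(_ _)].
by have [W hW] := uex u; move=> /(_ W) [].
Qed.

Lemma weyl_unitary u : unitary (weyl F u).
Proof. by have [] := weylP u. Qed.

Lemma weyl_exp u v : weyl F u (expvec F v) =
  cexp (- (rn u ^+ 2 / 2)%:C - inner u v) *: expvec F (u + v).
Proof. by have [_ ->] := weylP u; rewrite half_norm. Qed.

Lemma weyl_vac u : weyl F u (vac F) = cexp (- (rn u ^+ 2 / 2)%:C) *: expvec F u.
Proof. by rewrite weyl_exp inner0r subr0 addr0. Qed.

Lemma exp_weyl u : expvec F u = cexp ((rn u ^+ 2 / 2)%:C) *: weyl F u (vac F).
Proof. by rewrite weyl_vac scalerA -cexpD subrr cexp0 scale1r. Qed.

Lemma adj_weyl u : adj (weyl F u) = weyl F (- u).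
Proof.
have [aU _] := weyl_unitary u.
suff : weyl F u * weyl F (- u) = 1 by move=> h; rewrite -[RHS]mul1r -aU -mulrA h mulr1.
apply: (@exp_ext _ _ F) => v; rewrite bopME weyl_exp bop_Z weyl_exp scalerA -cexpD.
rewrite (_ : u + (- u + v) = v) ?addrA ?subrr ?add0r // (_ : _ + _ = 0) ?cexp0 ?scale1r //.
rewrite rnN innerDr innerNl innerNr innerE.
by apply: complex_eqP; rewrite ?(cReD, cReN, cImD, cImN) /=; field.
Qed.

Lemma second_quantizationP (U : bop H) : unitary U ->
  unitary (second_quantization F U) /\
  forall v, second_quantization F U (expvec F v) = expvec F (U v).
Proof.
move=> uU.
have ex (S : bop H) : isometric S ->
    exists J : bop F, (forall v, J (expvec F v) = expvec F (S v)) /\ isometric J.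
  by move=> iS; apply: gram_isometry (@exp_total _ _ F) _ => v w; rewrite !inner_exp iS.
have [J [Jb iJ]] := ex _ (unitary_isometric uU).
have [K [Kb iK]] := ex _ (unitary_isometric (unitary_adj uU)).
have uJ : unitary J.
  apply: (unitary_right_inverse iJ (T := K)); apply: (@exp_ext _ _ F) => v.
  by rewrite bopME Kb Jb unitary_adjKr.
by rewrite /second_quantization; case: xgetP => [W _ //|/(_ J) []].
Qed.

Lemma cexpX (z : R[i]) n : cexp z ^+ n = cexp (n%:R * z).
Proof.
elim: n => [|n IH]; first by rewrite expr0 mul0r cexp0.
by rewrite exprS IH -cexpD mulrS mulrDl mul1r.
Qed.

(** At the least degree [n] where two expansions could differ, the bound of order [t^(n+1)] forces
    equality. *)
Lemma poly_coef_unique (a b : nat -> R[i]) :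
  (forall n, exists C : R, forall t : R, 0 < t -> t <= 1 ->
     rn (\sum_(0 <= k < n) (a k - b k) * t%:C ^+ k) <= C * t ^+ n) ->
  forall k, a k = b k.
Proof.
move=> h; elim/ltn_ind => n IH; apply/eqP; rewrite -subr_eq0; apply/eqP.
have [C hC] := h n.+1; apply: (@rn_le_Ct _ _ C) => t t0 t1.
have := hC t t0 t1; rewrite big_nat_recr //= big_nat big1 ?add0r; last first.
  by move=> k /andP[_ /IH ->]; rewrite subrr mul0r.
rewrite rnM rnX rnC gtr0_norm // exprS mulrA [C * t * _]mulrC.
rewrite [X in X <= _]mulrC ler_pM2l //; exact: exprn_gt0.
Qed.

(* Compare the coefficients of [t ^ n] at [t *: u]. *)
Lemma exp_antisym_coef (zeta zeta' : F) :
  (forall u, inner (expvec F u) zeta = inner zeta' (expvec F (- u))) ->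
  forall k u, inner (npart F k u) zeta = (-1) ^+ k * inner zeta' (npart F k u).
Proof.
move=> h k u.
pose a k := (ecoef k : R)%:C * inner (npart F k u) zeta.
pose b k := (ecoef k : R)%:C * ((-1) ^+ k * inner zeta' (npart F k u)).
suff : a k = b k.
  rewrite /a /b => /mulfI; apply.
  by rewrite -(rmorph0 (real_complex R)) (inj_eq (fmorph_inj _)) gt_eqF // ecoef_gt0.
apply: poly_coef_unique => n.
exists (expR (rn u ^+ 2) * rn zeta + rn zeta' * expR (rn u ^+ 2)) => t t0 t1.
have e1 : \sum_(0 <= k < n) (a k - b k) * t%:C ^+ k =
  inner (epart F n (t%:C *: u)) zeta - inner zeta' (epart F n (t%:C *: (- u))).
  rewrite /epart inner_suml inner_sumr -sumrB; apply: eq_bigr => j _.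
  rewrite scalerN -scaleN1r !npartZ !innerZl !innerZr /a /b.
  have tX : ((t%:C ^+ j)^*)%C = t%:C ^+ j by rewrite rmorphXn; congr (_ ^+ _); exact: cjC.
  by rewrite tX cjC; ring.
have := h (t%:C *: u); rewrite -scalerN => {}h.
have t1' := rn_exp_tail F n u (ltW t0) t1.
have t2' := rn_exp_tail F n (- u) (ltW t0) t1.
rewrite e1; set x := epart _ _ _ in t1' *; set y := epart _ _ _ in t2' *.
have -> : inner x zeta - inner zeta' y =
  inner zeta' (expvec F (t%:C *: - u) - y) - inner (expvec F (t%:C *: u) - x) zeta.
  by rewrite innerBr innerBl h; ring.
apply: le_trans (rn_triangleB _ _) _.
have c1 := le_trans (cauchy_schwarz _ _) (ler_wpM2l (rn_ge0 zeta') t2').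
have c2 := le_trans (cauchy_schwarz _ _) (ler_wpM2r (rn_ge0 zeta) t1').
rewrite rnN in c1; apply: le_trans (lerD c1 c2) _.
by rewrite le_eqVlt; apply/orP; left; apply/eqP; ring.
Qed.

Lemma npart0 u : npart F 0 u = vac F.
Proof.
apply/eqP; rewrite -subr_eq0; apply/eqP; apply: (@exp_total _ _ F) => v.
rewrite innerBr inner_vacr innerJ inner_npart_exp /ecoef fact0 sqrtr1 invr1 expr0.
by rewrite mulr1 cjC subrr.
Qed.

(* Both sides of [exp_antisym_coef] are homogeneous in [u], antiholomorphic on
   the left and holomorphic on the right, so only the constant term survives. *)
Lemma exp_antisym_vac (zeta zeta' : F) :
  (forall u, inner (expvec F u) zeta = inner zeta' (expvec F (- u))) ->
  zeta = inner (vac F) zeta *: vac F.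
Proof.
move=> h; have hc := exp_antisym_coef h.
have n0 k u : inner (npart F k.+1 u) zeta = 0.
  (* [w] is a root of [i] of order [k + 1]: scaling [u] by it multiplies the antilinear side by
     [- i] and the linear side by [i]. *)
  pose w : R[i] := cexp (0 +i* (pi / 2 / k.+1%:R)).
  have wk : w ^+ k.+1 = 0 +i* 1.
    rewrite /w cexpX (_ : _ * _ = 0 +i* (pi / 2)); last first.
      by rewrite natrC; apply: complex_eqP => /=; field.
    by rewrite /cexp /= expR0 cos_pihalf sin_pihalf mul1r.
  have := hc k.+1 (w *: u); rewrite !npartZ innerZl innerZr mulrCA -hc.
  rewrite wk => /eqP; rewrite -subr_eq0 -mulrBl mulf_eq0 => /orP[|/eqP //].
  move=> /eqP/(congr1 (@complex.Im R)) /= /eqP.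
  by rewrite -opprD oppr_eq0 -mulr2n mulrn_eq0 oner_eq0.
apply/eqP; rewrite -subr_eq0; apply/eqP; apply: (@exp_total _ _ F) => u.
apply: (tends_unique (tends_innerl _ (tends_expvec F u))).
suff z k : inner (npart F k u) (zeta - inner (vac F) zeta *: vac F) = 0.
  under [X in tends X]eq_fun => n.
    rewrite /epart inner_suml big1; last by move=> k _; rewrite innerZl z mulr0.
  over.
  exact: tends_cst.
rewrite innerBr innerZr; case: k => [|k].
  by rewrite npart0 inner_vac mulr1 subrr.
by rewrite n0 inner_npart_exp inner0r expr0n /= !mulr0 subrr.
Qed.

(* [zeta = T Om] and [zeta' = adj T Om] satisfy the hypothesis of
   [exp_antisym_vac]. *)
Lemma weyl_irreducible (T : bop F) :
  (forall u, T * weyl F u = weyl F u * T) -> exists c : R[i], T = c *: (1 : bop F).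
Proof.
move=> hT.
have TW u x : T (weyl F u x) = weyl F u (T x) by rewrite -!bopME hT.
have := @exp_antisym_vac (T (vac F)) (adj T (vac F)).
set c := inner (vac F) (T (vac F)) => /(_ _) cV.
exists c; apply: (@exp_ext _ _ F) => v.
rewrite bopZE bop1E {1}exp_weyl bop_Z TW cV; last first.
  move=> u; rewrite exp_weyl [in RHS]exp_weyl rnN innerZl innerZr cexpC cjC.
  congr (_ * _).
  by rewrite adjP adj_weyl -adjPr TW.
by rewrite bop_Z !scalerA mulrC -scalerA -exp_weyl.
Qed.

End weyl_operators.

(** * Normal endomorphisms and rank-one operators *)

Section normal_maps.
Context {R : realType} {H : hilbertType R}.
Implicit Types (q T : bop H) (u v x y : H).

(** Finite rank projections, built by adding unit vectors orthogonal to the range so far. Normality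
    concerns suprema of directed sets, and these projections are directed with supremum 1. *)
Inductive finproj : bop H -> Prop :=
| finproj0 : finproj 0
| finprojS q v : finproj q -> q v = 0 -> rn v = 1 -> finproj (q + ketbra v v).

Definition projection q := adj q = q /\ q * q = q.

Lemma bop_adj0 : adj (0 : bop H) = 0.
Proof. by apply: adj_unique => u v; rewrite !bop0E inner0l inner0r. Qed.

Lemma ketbra0l v : ketbra 0 v = 0 :> bop H.
Proof. by apply: bop_ext => u; rewrite ketbraE scaler0. Qed.

Lemma ketbra0r v : ketbra v 0 = 0 :> bop H.
Proof. by apply: bop_ext => u; rewrite ketbraE inner0l scale0r. Qed.

Lemma finproj_projection q : finproj q -> projection q.
Proof.
elim => [|{}q v _ [aq qq] qv rv]; first by split; rewrite ?bop_adj0 ?mul0r.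
split; first by rewrite bop_adjD adj_ketbra aq.
have vv : inner v v = 1 by rewrite innerE rv expr1n.
rewrite mulrDl !mulrDr qq ketbra_mulr aq qv ketbra_mull qv ketbra_comp vv scale1r.
by rewrite ketbra0l ketbra0r addr0 add0r.
Qed.

Lemma projection_inner q u : projection q -> inner u (q u) = (rn (q u) ^+ 2)%:C.
Proof. by move=> [aq qq]; rewrite -innerE adjP aq -bopME qq. Qed.

Lemma projection_rn q u : projection q -> rn (q u) <= rn u.
Proof.
move=> pq; have [->|q0] := eqVneq (q u) 0; first by rewrite rn0 rn_ge0.
have rq := rn_gt0 q0; rewrite -(ler_pM2r rq) -expr2.
have := cauchy_schwarz u (q u); rewrite projection_inner // rnC ger0_norm //.
exact: sqr_ge0.
Qed.

Lemma projection_le q q' : projection q -> projection q' -> q' * q = q -> bop_le q q'.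
Proof.
move=> pq pq' qq u; rewrite !projection_inner // ler_ReC.
have -> : q u = q (q' u).
  by rewrite -[in RHS]bopME -(pq.1) -(pq'.1) -bop_adjM qq pq.1.
by rewrite ler_pXn2r ?nnegrE ?rn_ge0 // projection_rn.
Qed.

(** A Gram-Schmidt step: the normalized component of [v] orthogonal to the range of [q] is added,
    unless it vanishes. *)
Lemma finproj_extend q v : finproj q -> exists q', [/\ finproj q', q' * q = q & q' v = v].
Proof.
move=> fq; have [aq qq] := finproj_projection fq.
have [w0|w0] := eqVneq (v - q v) 0.
  by exists q; split => //; apply/esym/eqP; rewrite -subr_eq0 w0.
have rw := rn_gt0 w0.
pose n := (rn (v - q v))^-1%:C *: (v - q v).
have rn1' : rn n = 1.
  by rewrite /n rnZ rnC ger0_norm ?invr_ge0 ?rn_ge0 // mulVf // gt_eqF.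
have qn : q n = 0 by rewrite /n bop_Z bop_B -[q (q v)]bopME qq subrr scaler0.
exists (q + ketbra n n); split; first exact: finprojS.
  by rewrite mulrDl qq ketbra_mulr aq qn ketbra0r addr0.
rewrite bopDE ketbraE.
have nv : inner n v = (rn (v - q v))%:C.
  have -> : inner n v = inner n (v - q v).
    by rewrite innerBr adjPr aq qn inner0l subr0.
  rewrite /n innerZl cjC innerE -rmorphM /= expr2 mulrA mulVf ?mul1r //.
  by rewrite gt_eqF.
rewrite nv /n scalerA -rmorphM /= mulfV ?scale1r ?gt_eqF //.
by rewrite addrC subrK.
Qed.

Lemma finproj_upper q1 q2 : finproj q1 -> finproj q2 ->
  exists q, [/\ finproj q, q * q1 = q1 & q * q2 = q2].
Proof.
move=> f1; elim => [|q v _ [q' [fq' q1' q2']] qv rv].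
  by exists q1; split => //; [exact: (finproj_projection f1).2|rewrite mulr0].
have [q'' [fq'' qq qv']] := finproj_extend v fq'.
exists q''; split => //; first by rewrite -q1' mulrA qq.
by rewrite mulrDr ketbra_mull qv' -q2' mulrA qq.
Qed.

Lemma finproj_directed : directed finproj.
Proof.
split; first by exists 0; exact: finproj0.
move=> q1 q2 f1 f2; have [q [fq h1 h2]] := finproj_upper f1 f2.
by exists q; split => //; apply: projection_le => //; exact: finproj_projection.
Qed.

Lemma finproj_lub : is_lub finproj 1.
Proof.
split=> [q fq u|L hL u].
  rewrite projection_inner; last exact: finproj_projection.
  rewrite bop1E innerE ler_ReC ler_pXn2r ?nnegrE ?rn_ge0 //.
  by apply: projection_rn; exact: finproj_projection.
rewrite bop1E; have [q [fq _ qu]] := finproj_extend u finproj0.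
by have := hL q fq u; rewrite qu.
Qed.

Context (phi : bop H -> bop H).
Hypothesis (phin : normal_map phi) (phie : unital_star_endomorphism phi).

Lemma phi_linear a S T : phi (a *: S + T) = a *: phi S + phi T.
Proof. by case: phie => h _ _ _; exact: h. Qed.
Lemma phiD S T : phi (S + T) = phi S + phi T.
Proof. by rewrite -[S]scale1r phi_linear !scale1r. Qed.
Lemma phi0 : phi 0 = 0.
Proof. by apply: (addrI (phi 0)); rewrite -phiD !addr0. Qed.
Lemma phiZ (a : R[i]) T : phi (a *: T) = a *: phi T.
Proof. by rewrite -[a *: T]addr0 phi_linear phi0 addr0. Qed.
Lemma phi1 : phi 1 = 1. Proof. by case: phie. Qed.
Lemma phiM S T : phi (S * T) = phi S * phi T. Proof. by case: phie. Qed.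
Lemma phiA T : phi (adj T) = adj (phi T). Proof. by case: phie. Qed.

(* Otherwise [1 - ketbra zeta zeta / |zeta|^2] would bound [phi] of every finite
   rank projection, against normality. *)
Lemma phi_nondegenerate zeta : (forall x y, phi (ketbra x y) zeta = 0) -> zeta = 0.
Proof.
move=> h.
have fz q : finproj q -> phi q zeta = 0.
  by elim => [|{}q v _ IH _ _]; rewrite ?phi0 ?bop0E // phiD bopDE IH h addr0.
have [//|z0] := eqVneq zeta 0; exfalso.
have rz := rn_gt0 z0.
have [_ hlub] := phin finproj_directed (fun T fT => (finproj_projection fT).1) finproj_lub.
rewrite phi1 in hlub.
pose L := (1 : bop H) - (rn zeta ^- 2)%:C *: ketbra zeta zeta.
have : bop_le 1 L.
  apply: hlub => _ [q fq <-] u.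
  have pq : projection (phi q).
    have [aq qq] := finproj_projection fq.
    by split; [rewrite -phiA aq|rewrite -phiM qq].
  pose c := (rn zeta ^- 2)%:C * inner zeta u.
  have qu : phi q u = phi q (u - c *: zeta).
    by rewrite bop_B bop_Z fz // scaler0 subr0.
  have Lu : inner u (L u) = (rn (u - c *: zeta) ^+ 2)%:C.
    rewrite -innerE /L bopBE bop1E bopZE ketbraE scalerA -/c.
    rewrite [RHS]innerBl [X in _ = _ - X](_ : _ = 0) ?subr0 //.
    rewrite innerZl innerBr innerZr innerE /c mulrAC -rmorphM /=.
    rewrite mulVf ?expf_eq0 ?(gt_eqF rz) // mul1r subrr mulr0 //.
  rewrite projection_inner // qu Lu ler_ReC ler_pXn2r ?nnegrE ?rn_ge0 //.
  exact: projection_rn.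
move=> /(_ zeta); rewrite bop1E /L bopBE bop1E bopZE ketbraE scalerA.
rewrite innerE -rmorphM /= mulVf ?expf_eq0 ?(gt_eqF rz) // scale1r subrr inner0r.
rewrite -[0]/(0%:C) ler_ReC => h0.
by have := lt_le_trans (exprn_gt0 2 rz) h0; rewrite ltxx.
Qed.

End normal_maps.

Section intertwiners.
Context {R : realType} {H : hilbertType R} (F : fock_space H).
Variables (V : bop H) (phi : bop F -> bop F).
Hypothesis (phin : normal_map phi) (phie : unital_star_endomorphism phi).
Hypothesis phiW : forall u, phi (weyl F u) = weyl F (V u).

(** These operators intertwine the identity with [phi]. They are bounded because [|phi(|eta><Om|)
    xi|^2 = |eta|^2 <xi, phi(|Om><Om|) xi>]. *)
Lemma phi_ketbra_bop xi : exists2 T : bop F,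
  forall eta, T eta = phi (ketbra eta (vac F)) xi & forall S, phi S * T = T * S.
Proof.
have fl : linear (fun eta => phi (ketbra eta (vac F)) xi).
  by move=> a u v; rewrite ketbraDl ketbraZl (phiD phie) (phiZ phie).
pose c := rn (inner xi (phi (ketbra (vac F) (vac F)) xi)).
have fC eta : rn (phi (ketbra eta (vac F)) xi) <= Num.sqrt c * rn eta.
  rewrite -(@ler_pXn2r _ 2) ?nnegrE ?rn_ge0 ?mulr_ge0 ?sqrtr_ge0 ?rn_ge0 //.
  rewrite rn_inner adjP -(phiA phie) -bopME -(phiM phie) adj_ketbra ketbra_comp.
  rewrite (phiZ phie) bopZE innerZr innerE exprMn sqr_sqrtr ?rn_ge0 //.
  apply: le_trans (ler_norm _) _; apply: le_trans (Re_le_rn _) _.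
  by rewrite rnM rnC ger0_norm ?sqr_ge0 // mulrC.
exists (mkbop fl fC) => // S; apply: bop_ext => eta /=.
by rewrite -bopME -(phiM phie) ketbra_mull.
Qed.

(** With [S] from [phi_ketbra_bop], [J^* S] commutes with every Weyl operator, hence is a scalar
    [c]. So [J^* phi(T) S = J^* S T = c T = T J^* S], and the ranges of these [S] are total by
    [phi_nondegenerate]. *)
Lemma intertwine (J : bop F) : (forall u, weyl F (V u) * J = J * weyl F u) ->
  forall T, phi T * J = J * T.
Proof.
move=> JW.
have aJW u : weyl F u * adj J = adj J * weyl F (V u).
  have := congr1 (fun T : bop F => adj T) (JW (- u)); rewrite /= !bop_adjM !adj_weyl bop_N !opprK.
  by move=> <-.
suff h T : adj J * phi T = T * adj J.
  move=> T; have := congr1 (fun T : bop F => adj T) (h (adj T)).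
  by rewrite /= !bop_adjM !adjK -(phiA phie) adjK.
pose X := adj J * phi T - T * adj J.
suff X0 : adj X = 0.
  apply/eqP; rewrite -subr_eq0 -/X; apply/eqP.
  by rewrite -[X]adjK X0 bop_adj0.
apply: bop_ext => y; rewrite bop0E.
have XR xi eta : X (phi (ketbra eta (vac F)) xi) = 0.
  have [S Se Sc] := phi_ketbra_bop xi.
  have [u|c hc] := @weyl_irreducible _ _ F (adj J * S).
    by rewrite -mulrA -Sc phiW mulrA -aJW mulrA.
  rewrite -Se -bopME /X mulrBl -[adj J * _ * S]mulrA Sc mulrA hc -mulrA hc.
  by apply/eqP; rewrite bopBE !bopME !bopZE !bop1E bop_Z subrr.
apply: (phi_nondegenerate phin phie) => x z.
have -> : ketbra x z = ketbra x (vac F) * ketbra (vac F) z.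
  by rewrite ketbra_comp innerE rn_vac expr1n scale1r.
rewrite (phiM phie) bopME.
suff -> : phi (ketbra (vac F) z) (adj X y) = 0 by rewrite bop_0.
apply: inner_ext => xi; rewrite inner0r adjPr -(phiA phie) adj_ketbra.
by rewrite adjPr adjK XR inner0l.
Qed.

(** As [w] is orthogonal to the range of [V], the vectors [e(w + V u)] have the Gram matrix of the
    [e(u)] up to the factor [exp(|w|^2)]. The constant [c] removes it to obtain an isometry, and is
    divided out again at the end. *)
Lemma shift_ex w : isometric V -> adj V w = 0 ->
  exists2 J : bop F, forall u, J (expvec F u) = expvec F (w + V u) &
    forall T, phi T * J = J * T.
Proof.
move=> iV Vw.
have wV u : inner w (V u) = 0 by rewrite adjPr Vw inner0l.
have Vw' u : inner (V u) w = 0 by rewrite innerJ wV rmorph0.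
pose c : R[i] := cexp (- (rn w ^+ 2 / 2)%:C).
have [|J [Je iJ]] := @gram_isometry _ F _ (expvec F) (fun u => c *: expvec F (w + V u)) (@exp_total _ _ F).
  move=> u v; rewrite innerZl innerZr !inner_exp /c -cexpJ -!cexpD; congr cexp.
  rewrite innerDl !innerDr wV Vw' iV innerE addr0 add0r.
  by apply: complex_eqP; rewrite ?(cReD, cReN, cImD, cImN) /=; field.
have c0 : c != 0 by exact: cexp_neq0.
have Je' u : (c^-1 *: J) (expvec F u) = expvec F (w + V u).
  by rewrite bopZE Je scalerA mulVf // scale1r.
exists (c^-1 *: J) => //; apply: intertwine => u.
apply: (@exp_ext _ _ F) => v; rewrite !bopME Je' !weyl_exp bop_Z Je'.
rewrite innerDr Vw' add0r iV (isometric_rn _ iV) bop_D.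
by rewrite addrCA.
Qed.

End intertwiners.

(** * Isometric representations of cones *)

Section vector_norm.
Context {R : realType} {d : nat}.
Implicit Types x y : 'rV[R]_d.

Lemma coord_norm_le y i : `|y 0 i| <= `|y|.
Proof.
rewrite [leRHS]/Num.norm /= mx_normrE.
exact: (le_bigmax _ (fun ij : 'I_1 * 'I_d => `|y ij.1 ij.2|) (0, i)).
Qed.

Lemma norm_coord_le y (e : R) : 0 <= e -> (forall i, `|y 0 i| <= e) -> `|y| <= e.
Proof.
move=> e0 ye; rewrite [leLHS]/Num.norm /= mx_normrE.
by apply/bigmax_leP; split => // -[i j] _ /=; rewrite ord1.
Qed.

End vector_norm.

Section cones.
Context {R : realType} {d : nat} {P : set 'rV[R]_d}.
Hypothesis Pc : convex_cone P.
Implicit Types x y : 'rV[R]_d.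

Lemma coneD x y : P x -> P y -> P (x + y).
Proof.
by move=> Px Py; have := Pc.2 1 1 x y ler01 ler01 Px Py; rewrite !scale1r.
Qed.

Lemma coneZ (t : R) x : 0 <= t -> P x -> P (t *: x).
Proof.
by move=> t0 Px; have := Pc.2 t 0 x x t0 (lexx 0) Px Px; rewrite scale0r addr0.
Qed.

Lemma cone0 : P 0.
Proof. by have [[x Px] _] := Pc; rewrite -(scale0r x); exact: coneZ. Qed.

Lemma coneMn n x : P x -> P (x *+ n).
Proof. by move=> Px; rewrite -scaler_nat; apply: coneZ => //; rewrite ler0n. Qed.

Lemma cone_sum (I : Type) (s : seq I) (f : I -> 'rV[R]_d) :
  (forall i, P (f i)) -> P (\sum_(i <- s) f i).
Proof.
move=> Pf; elim: s => [|i s IH]; rewrite ?big_nil ?big_cons; first exact: cone0.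
exact: coneD.
Qed.

(** With the basis vectors written as [p_i - q_i] in [P], take for [a] the sum of all [p_i + q_i].
    Then [a + y] has coefficients [1 + y_i] and [1 - y_i], nonnegative when the sup norm of [y] is
    at most 1. *)
Lemma cone_interior : spanning P ->
  exists2 a, P a & forall y, `|y| <= 1 -> P (a + y).
Proof.
move=> sP.
have /choice[p hp] : forall i : 'I_d, exists pq : 'rV[R]_d * 'rV[R]_d,
    [/\ P pq.1, P pq.2 & delta_mx 0 i = pq.1 - pq.2].
  move=> i; have : [set x - y | x in P & y in P] (delta_mx 0 i) by rewrite sP.
  by move=> [x Px [y Py xy]]; exists (x, y).
pose a := \sum_i ((p i).1 + (p i).2).
have Pa : P a by apply: cone_sum => i; have [? ? _] := hp i; exact: coneD.
exists a => // y y1; rewrite (row_sum_delta y) /a -big_split /=.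
apply: cone_sum => i; have [p1 p2 ->] := hp i.
have yi : `|y 0 i| <= 1 by apply: le_trans y1; exact: coord_norm_le.
have [h1 h2] : 0 <= 1 + y 0 i /\ 0 <= 1 - y 0 i.
  by move: yi; rewrite ler_norml => /andP[]; split; lra.
have -> : (p i).1 + (p i).2 + y 0 i *: ((p i).1 - (p i).2) =
  (1 + y 0 i) *: (p i).1 + (1 - y 0 i) *: (p i).2.
  by rewrite !scalerDl !scale1r scalerBr scaleNr addrACA.
exact: Pc.2.
Qed.

End cones.

Section cone_representation.
Context {R : realType} {d : nat} {P : set 'rV[R]_d} {H : hilbertType R}.
Variable W : 'rV[R]_d -> bop H.
Hypothesis Pc : convex_cone P.
Hypothesis Wiso : forall x, P x -> isometric (W x).
Hypothesis WD : forall x y, P x -> P y -> W (x + y) = W x * W y.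
Implicit Types (x y z : 'rV[R]_d) (u v w : H).

Local Notation E x := (W x * adj (W x)).
Local Notation E' x := (1 - W x * adj (W x)).

Lemma rep0 : W 0 = 1.
Proof.
have P0 := cone0 Pc; have := WD P0 P0; rewrite addr0 => W0.
apply: bop_ext => u; apply: (isometric_inj (Wiso P0)).
by rewrite -bopME -W0.
Qed.

Lemma rep_adjK x u : P x -> adj (W x) (W x u) = u.
Proof. by move=> Px; apply: isometric_adjK; exact: Wiso. Qed.

Lemma rep_adjM x : P x -> adj (W x) * W x = 1.
Proof. by move=> Px; apply: isometric_adjM; exact: Wiso. Qed.

Lemma adj_repD x y : P x -> P y -> adj (W (x + y)) = adj (W y) * adj (W x).
Proof. by move=> Px Py; rewrite WD // bop_adjM. Qed.

Lemma adj_rep_E' x : P x -> adj (W x) * E' x = 0.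
Proof. by move=> Px; rewrite mulrBr mulr1 mulrA rep_adjM // mul1r subrr. Qed.

Lemma E'_rep x : P x -> E' x * W x = 0.
Proof. by move=> Px; rewrite mulrBl mul1r -mulrA rep_adjM // mulr1 subrr. Qed.

Lemma adj_E x : adj (E x) = E x.
Proof. by rewrite bop_adjM adjK. Qed.

Lemma adj_E' x : adj (E' x) = E' x.
Proof. by rewrite bop_adjD bop_adjN adj_E bop_adj1. Qed.

Lemma E_idem x : P x -> E x * E x = E x.
Proof. by move=> Px; rewrite -mulrA (mulrA (adj _)) rep_adjM // mul1r. Qed.

Lemma E'_idem x : P x -> E' x * E' x = E' x.
Proof.
by move=> Px; rewrite mulrBr mulr1 mulrA E'_rep // mul0r subr0.
Qed.

Lemma E_E' x : P x -> E x * E' x = 0.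
Proof. by move=> Px; rewrite -mulrA adj_rep_E' // mulr0. Qed.

Lemma E'_decomp x u : u = E' x u + W x (adj (W x) u).
Proof. by rewrite bopBE bop1E bopME subrK. Qed.

Lemma E_monotone x y : P x -> P y -> E x * E (x + y) = E (x + y).
Proof.
move=> Px Py; rewrite WD // -!mulrA; congr (_ * _).
by rewrite mulrA rep_adjM // mul1r.
Qed.

Lemma E'_monotone x y : P x -> P y -> E' x * E' (x + y) = E' x.
Proof.
move=> Px Py; rewrite mulrBr mulr1 mulrBl mul1r E_monotone // subrr subr0 //.
Qed.

Lemma adj_rep_E'D x y : P x -> P y -> adj (W x) * E' (x + y) = E' y * adj (W x).
Proof.
move=> Px Py; rewrite mulrBr mulr1 mulrBl mul1r WD // bop_adjM.
by rewrite -!mulrA (mulrA (adj (W x)) (W x)) rep_adjM // mul1r.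
Qed.

Lemma rn_E' x u : P x -> rn (E' x u) ^+ 2 = rn u ^+ 2 - rn (adj (W x) u) ^+ 2.
Proof.
move=> Px.
have h : inner (E' x u) (W x (adj (W x) u)) = 0.
  by rewrite adjPr -bopME adj_rep_E' // bop0E inner0l.
rewrite {2}(E'_decomp x u) rn_pythagoras // (isometric_rn _ (Wiso Px)); ring.
Qed.

Lemma rn_adj_rep x u : P x -> rn (adj (W x) u) <= rn u.
Proof. by move=> Px; apply: adj_isometric_rn; exact: Wiso. Qed.

Lemma rn_E'_le x u : P x -> rn (E' x u) <= rn u.
Proof.
move=> Px; rewrite -(@ler_pXn2r _ 2) ?nnegrE ?rn_ge0 // rn_E' //.
by rewrite gerBl sqr_ge0.
Qed.

Hypothesis Wcont : forall u x (e : R), P x -> 0 < e ->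
  exists2 delta, 0 < delta & forall y, P y -> `|y - x| <= delta -> rn (W y u - W x u) <= e.
Variables (a : 'rV[R]_d) (Pa : P a) (a1 : forall y, `|y| <= 1 -> P (a + y)).

Lemma interior_scaled (e : R) y : 0 < e -> `|y| <= e -> P (e *: a + y).
Proof.
move=> e0 ye; have -> : e *: a + y = e *: (a + e^-1 *: y).
  by rewrite scalerDr scalerA mulfV ?scale1r // gt_eqF.
apply: (coneZ Pc); first exact: ltW.
by apply: a1; rewrite normrZ ger0_norm ?invr_ge0 ?(ltW e0) // mulrC ler_pdivrMr // mul1r.
Qed.

(** [Re <V_r^* u, u> = Re <u, V_r u>] and [|V_r^* u| <= |u|], so strong continuity of [V] at 0
    passes to the adjoints. *)
Lemma rn_adj_rep_sub r u : P r ->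
  rn (adj (W r) u - u) ^+ 2 <= 2 * rn u * rn (W r u - u).
Proof.
move=> Pr; rewrite rn_sqrB -adjPr.
have h1 := rn_adj_rep u Pr; have h2 := rn_ge0 (adj (W r) u); have h3 := rn_ge0 u.
have h4 : complex.Re (inner u u) - complex.Re (inner u (W r u)) <= rn u * rn (W r u - u).
  rewrite -cReB -innerBr rnB; apply: le_trans (ler_norm _) _.
  by apply: le_trans (Re_le_rn _) _; exact: cauchy_schwarz.
rewrite -rn_inner in h4; nra.
Qed.

Lemma adj_rep_cont0 u (e : R) : 0 < e ->
  exists2 delta, 0 < delta & forall r, P r -> `|r| <= delta -> rn (adj (W r) u - u) <= e.
Proof.
move=> e0; have u0 : 0 < 2 * rn u + 1 by have := rn_ge0 u; lra.
have e2 : 0 < e ^+ 2 / (2 * rn u + 1) by rewrite divr_gt0 ?exprn_gt0.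
have [delta d0 hd] := Wcont u (cone0 Pc) e2.
exists delta => // r Pr rd; have := hd r Pr; rewrite subr0 rep0 bop1E => /(_ rd) h.
rewrite -(@ler_pXn2r _ 2) ?nnegrE ?rn_ge0 ?(ltW e0) //.
apply: le_trans (rn_adj_rep_sub u Pr) _.
rewrite ler_pdivlMr // mulrC in h.
have := rn_ge0 (W r u - u); nra.
Qed.

(* For [y] near [x] one has [V_y^* u = V_r^* V_x^* V_{ea} u] with [r = y + e a - x],
   which lies in [P] because [a] is interior; this reduces continuity at [x] to
   continuity at [0]. *)
Lemma adj_rep_cont u x (e : R) : P x -> 0 < e ->
  exists2 delta, 0 < delta & forall y, P y -> `|y - x| <= delta ->
    rn (adj (W y) u - adj (W x) u) <= e.
Proof.
move=> Px e0; have e2 : 0 < e / 2 by lra.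
have [d1 d10 h1] := Wcont u (cone0 Pc) e2.
have [d2 d20 h2] := adj_rep_cont0 (adj (W x) u) e2.
have na : 0 < `|a| + 1 by rewrite ltr_wpDl.
pose t := Num.min (d1 / (`|a| + 1)) (d2 / 2 / (`|a| + 1)).
have t0 : 0 < t by rewrite lt_min !divr_gt0.
have ta : t * (`|a| + 1) <= d1 /\ t * (`|a| + 1) <= d2 / 2.
  by split; rewrite -ler_pdivlMr // ge_min lexx ?orbT.
exists (Num.min t (d2 / 2)) => [|y Py]; first by rewrite lt_min t0 divr_gt0.
rewrite le_min => /andP[yt yd2].
pose r := t *: a + (y - x).
have Pr : P r by exact: interior_scaled.
have Pta : P (t *: a) by apply: (coneZ Pc) => //; exact: ltW.
have nta : `|t *: a| <= t * (`|a| + 1).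
  by rewrite normrZ gtr0_norm // ler_pM2l // lerDl.
have yE : adj (W y) u = adj (W r) (adj (W x) (W (t *: a) u)).
  rewrite -bopME -adj_repD // (_ : x + r = y + t *: a); last first.
    by rewrite /r addrCA (addrC x) subrK addrC.
  by rewrite addrC adj_repD // bopME rep_adjK.
have n1 : rn (W (t *: a) u - u) <= e / 2.
  have := h1 _ Pta; rewrite subr0 rep0 bop1E; apply.
  by apply: le_trans nta _; exact: ta.1.
have n2 : rn (adj (W r) (adj (W x) u) - adj (W x) u) <= e / 2.
  apply: h2 => //; apply: le_trans (ler_normD _ _) _.
  have := le_trans nta ta.2; lra.
rewrite yE; apply: le_trans (rn_dist_triangle _ (adj (W r) (adj (W x) u)) _) _.
have : rn (adj (W r) (adj (W x) (W (t *: a) u)) - adj (W r) (adj (W x) u)) <= e / 2.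
  by rewrite -!bop_B; apply: le_trans (rn_adj_rep _ Pr) _; apply: le_trans (rn_adj_rep _ Px) _.
lra.
Qed.

Lemma E_cont u x (e : R) : P x -> 0 < e ->
  exists2 delta, 0 < delta & forall y, P y -> `|y - x| <= delta ->
    rn (E y u - E x u) <= e.
Proof.
move=> Px e0; have e2 : 0 < e / 2 by lra.
have [d1 d10 h1] := adj_rep_cont u Px e2.
have [d2 d20 h2] := Wcont (adj (W x) u) Px e2.
exists (Num.min d1 d2) => [|y Py]; first by rewrite lt_min d10.
rewrite le_min => /andP[y1 y2]; rewrite !bopME.
apply: le_trans (rn_dist_triangle _ (W y (adj (W x) u)) _) _.
rewrite -bop_B (isometric_rn _ (Wiso Py)).
have := h1 y Py y1; have := h2 y Py y2; lra.
Qed.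

Section discretization.
Variables (x : 'rV[R]_d) (Px : P x).

Definition mesh n : 'rV[R]_d := n.+1%:R^-1 *: x.

Lemma mesh_cone n : P (mesh n).
Proof. by apply: (coneZ Pc) => //; rewrite invr_ge0 ler0n. Qed.

Lemma meshK n : mesh n *+ n.+1 = x.
Proof.
by rewrite /mesh -scaler_nat scalerA mulfV ?scale1r // pnatr_eq0.
Qed.

Lemma mesh_small (e : R) : 0 < e -> exists N, forall n, (N <= n)%N -> `|mesh n| <= e.
Proof.
move=> e0; have nx : 0 < `|x| + 1 by rewrite ltr_wpDl.
have [N hN] := natSinv_small (divr_gt0 e0 nx).
exists N => n /hN h; rewrite /mesh normrZ ger0_norm ?invr_ge0 ?ler0n //.
apply: (@le_trans _ _ (n.+1%:R^-1 * (`|x| + 1))).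
  by rewrite ler_wpM2l ?invr_ge0 ?ler0n // lerDl.
by rewrite -ler_pdivlMr.
Qed.

(** The part of [u] in the layer between the ranges of [V_(jm)] and [V_((j+1)m)], with
    [m = x / (n + 1)], pulled back to [ker V_m^*]. The squared norms of the layers telescope. *)
Definition piece n j u := E' (mesh n) (adj (W (mesh n *+ j)) u).

Lemma piece_sqr n j u : rn (piece n j u) ^+ 2 =
  rn (adj (W (mesh n *+ j)) u) ^+ 2 - rn (adj (W (mesh n *+ j.+1)) u) ^+ 2.
Proof.
have Pm := mesh_cone n; have Pj : P (mesh n *+ j) by apply: (coneMn Pc).
by rewrite /piece rn_E' // mulrSr adj_repD // bopME.
Qed.

Lemma sum_piece_sqr n u : \sum_(0 <= j < n.+1) rn (piece n j u) ^+ 2 <= rn u ^+ 2.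
Proof.
under eq_bigr do rewrite piece_sqr -opprB.
rewrite sumrN telescope_sumr // opprB mulr0n rep0 bop_adj1 bop1E.
by rewrite gerBl sqr_ge0.
Qed.

Lemma rn_piece_le n j u : rn (piece n j u) <= rn u.
Proof.
apply: le_trans (rn_E'_le _ (mesh_cone n)) _; apply: rn_adj_rep.
by apply: (coneMn Pc); exact: mesh_cone.
Qed.

(** [|z|^2 - |z'|^2 <= 2 |u| |z - z'|] with [z - z' = V_(jm)^*(u - V_m^* u)]; contractivity makes
    the bound independent of [j]. *)
Lemma rn_piece_sub n j u :
  rn (piece n j u) ^+ 2 <= 2 * rn u * rn (adj (W (mesh n)) u - u).
Proof.
have Pm := mesh_cone n; have Pj : P (mesh n *+ j) by apply: (coneMn Pc).
rewrite piece_sqr mulrS adj_repD // bopME.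
set z := adj (W (mesh n *+ j)) u; set z' := adj _ (adj _ u).
have h : rn (z - z') <= rn (adj (W (mesh n)) u - u).
  by rewrite rnB /z /z' -bop_B rn_adj_rep.
have zu : rn z <= rn u by rewrite rn_adj_rep.
have zu' : rn z' <= rn u by rewrite !(le_trans (rn_adj_rep _ _)) // rn_adj_rep.
have := rn_sub_le z z'; have := rn_ge0 z; have := rn_ge0 z'; have := rn_ge0 (z - z').
have := rn_ge0 u; nra.
Qed.

Lemma piece_small u (e : R) : 0 < e ->
  exists N, forall n, (N <= n)%N -> forall j, rn (piece n j u) <= e.
Proof.
move=> e0; have u0 : 0 < 2 * rn u + 1 by have := rn_ge0 u; lra.
have e2 : 0 < e ^+ 2 / (2 * rn u + 1) by rewrite divr_gt0 ?exprn_gt0.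
have [delta d0 hd] := adj_rep_cont0 u e2.
have [N hN] := mesh_small d0.
exists N => n /hN /(hd _ (mesh_cone n)) h j.
rewrite -(@ler_pXn2r _ 2) ?nnegrE ?rn_ge0 ?(ltW e0) //.
apply: le_trans (rn_piece_sub n j u) _.
rewrite ler_pdivlMr // mulrC in h.
have := rn_ge0 (adj (W (mesh n)) u - u); nra.
Qed.

End discretization.

End cone_representation.

(** * Gauge cocycles *)

Section bigO.
Context {R : realType}.
Implicit Types f g : R -> R[i].

Definition bigO p f := exists C : R, forall t : R, 0 < t -> t <= 1 -> rn (f t) <= C * t ^+ p.

Lemma bigOD p f g : bigO p f -> bigO p g -> bigO p (fun t => f t + g t).
Proof.
move=> [C hC] [D hD]; exists (C + D) => t t0 t1; rewrite mulrDl.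
apply: le_trans (rn_triangle _ _) _; apply: lerD; [exact: hC|exact: hD].
Qed.

Lemma bigON p f : bigO p f -> bigO p (fun t => - f t).
Proof. by move=> [C hC]; exists C => t t0 t1; rewrite rnN hC. Qed.

Lemma bigOB p f g : bigO p f -> bigO p g -> bigO p (fun t => f t - g t).
Proof. by move=> hf hg; apply: bigOD => //; exact: bigON. Qed.

Lemma bigOM p q f g : bigO p f -> bigO q g -> bigO (p + q) (fun t => f t * g t).
Proof.
move=> [C hC] [D hD]; exists (C * D) => t t0 t1; rewrite rnM exprD mulrACA.
by apply: ler_pM; rewrite ?rn_ge0 ?hC ?hD.
Qed.

Lemma bigO_mono (c : R[i]) p : bigO p (fun t => c * t%:C ^+ p).
Proof.
by exists (rn c) => t t0 t1; rewrite rnM rnX rnC gtr0_norm.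
Qed.

Lemma bigO_cst (c : R[i]) : bigO 0 (fun t => c).
Proof. by exists (rn c) => t t0 t1; rewrite expr0 mulr1. Qed.

Lemma bigO_weak p q f : (p <= q)%N -> bigO q f -> bigO p f.
Proof.
move=> pq [C hC]; exists C => t t0 t1; apply: le_trans (hC t t0 t1) _.
have C0 : 0 <= C.
  by have := hC 1 ltr01 (lexx _); rewrite expr1n mulr1; apply: le_trans (rn_ge0 _).
by rewrite ler_wpM2l // ler_wiXn2l // ltW.
Qed.

Lemma bigO_ext p f g : (forall t, f t = g t) -> bigO p f -> bigO p g.
Proof. by move=> /funext ->. Qed.

Lemma bigO_coef (c : R[i]) p : bigO p.+1 (fun t => c * t%:C ^+ p) -> c = 0.
Proof.
move=> [C hC]; apply: (@rn_le_Ct _ _ C) => t t0 t1.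
have := hC t t0 t1; rewrite rnM rnX rnC gtr0_norm // exprS mulrA ler_pM2r //.
exact: exprn_gt0.
Qed.

Lemma bigO_coef_prod1 f g h (f1 g0 g1 h0 h1 : R[i]) : (forall t, f t = g t * h t) ->
  bigO 2 (fun t => f t - (g0 * h0 + f1 * t%:C)) ->
  bigO 2 (fun t => g t - (g0 + g1 * t%:C)) ->
  bigO 2 (fun t => h t - (h0 + h1 * t%:C)) -> f1 = g0 * h1 + g1 * h0.
Proof.
move=> fgh hf hg hh; apply/eqP; rewrite -subr_eq0; apply/eqP.
apply: (@bigO_coef _ 1).
have mono1 (c : R[i]) : bigO 1 (fun t => c * t%:C) := bigO_mono c 1.
have lin (c c' : R[i]) : bigO 0 (fun t => c + c' * t%:C).
  by apply: bigOD; [exact: bigO_cst|exact: bigO_weak (mono1 c')].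
have h1' := bigOM hg (lin h0 h1).
have h2' := bigOM (lin g0 g1) hh.
have h3' := bigO_weak (isT : (2 <= 2 + 2)%N) (bigOM hg hh).
have h4' := bigOM (mono1 g1) (mono1 h1).
apply: bigO_ext (bigOB (bigOD (bigOD h1' h2') (bigOD h3' h4')) hf) => t.
rewrite fgh expr1; ring.
Qed.

(** In the absence of first order terms, the second order coefficients relative to the constant
    terms add: their cross term has order four. *)
Lemma bigO_coef_prod2 f g h (c0 d0 f2 g2 h2 : R[i]) : c0 != 0 -> d0 != 0 ->
  (forall t, f t = g t * h t) ->
  bigO 3 (fun t => f t - c0 * d0 * (1 + f2 * t%:C ^+ 2)) ->
  bigO 3 (fun t => g t - c0 * (1 + g2 * t%:C ^+ 2)) ->
  bigO 3 (fun t => h t - d0 * (1 + h2 * t%:C ^+ 2)) -> f2 = g2 + h2.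
Proof.
move=> c00 d00 fgh hf hg hh; apply/eqP; rewrite -subr_eq0; apply/eqP.
suff : c0 * d0 * (f2 - (g2 + h2)) = 0.
  by move/eqP; rewrite !mulf_eq0 (negbTE c00) (negbTE d00) => /eqP.
apply: (@bigO_coef _ 2).
have lin (c c' : R[i]) : bigO 0 (fun t => c * (1 + c' * t%:C ^+ 2)).
  apply: (bigOM (bigO_cst c) (bigOD (bigO_cst 1) _)).
  exact: bigO_weak (bigO_mono c' 2).
have h1' := bigOM hg (lin d0 h2).
have h2' := bigOM (lin c0 g2) hh.
have h3' := bigO_weak (isT : (3 <= 3 + 3)%N) (bigOM hg hh).
have h4' := bigO_weak (isT : (3 <= 2 + 2)%N) (bigOM (bigO_mono (c0 * g2) 2) (bigO_mono (d0 * h2) 2)).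
apply: bigO_ext (bigOB (bigOD (bigOD h1' h2') (bigOD h3' h4')) hf) => t.
rewrite fgh; ring.
Qed.

(** Telescoping one factor at a time. The bound on partial products depends on the sum of the [s j]
    only, not on the number of factors, so a mesh can be refined. *)
Lemma prod_compare (n : nat) (z w : nat -> R[i]) (s : nat -> R) :
  (forall j, rn (z j) <= expR (s j)) -> (forall j, rn (w j) <= expR (s j)) ->
  (forall j, 0 <= s j) ->
  rn (\prod_(0 <= j < n) z j - \prod_(0 <= j < n) w j) <=
  expR (\sum_(0 <= j < n) s j) * \sum_(0 <= j < n) rn (z j - w j).
Proof.
move=> zs ws s0.
have pe (y : nat -> R[i]) m : (forall j, rn (y j) <= expR (s j)) ->
    rn (\prod_(0 <= j < m) y j) <= expR (\sum_(0 <= j < m) s j).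
  move=> ys; elim: m => [|m IH]; first by rewrite !big_geq // rn1 expR0.
  rewrite !big_nat_recr //= rnM expRD.
  by apply: ler_pM; rewrite ?rn_ge0.
elim: n => [|n IH]; first by rewrite !big_geq // subrr rn0 mulr0.
rewrite !big_nat_recr //=; set Z := \prod_(0 <= _ < n) _ in IH *.
set X := \prod_(0 <= _ < n) _ in IH *; set S := \sum_(0 <= j < n) s j in IH *.
set D := \sum_(0 <= j < n) rn _ in IH *.
have -> : Z * z n - X * w n = (Z - X) * w n + Z * (z n - w n) by ring.
apply: le_trans (rn_triangle _ _) _; rewrite !rnM expRD.
have hZ : rn Z <= expR S := pe z n zs.
have en : 1 <= expR (s n) by apply: le_trans (expR_ge1Dx _); rewrite lerDl.
have D0 : 0 <= D by apply: sumr_ge0 => j _; exact: rn_ge0.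
have S0 := expR_gt0 S.
have p1 : rn (Z - X) * rn (w n) <= expR S * D * expR (s n).
  by apply: ler_pM; rewrite ?rn_ge0.
have p2 : rn Z * rn (z n - w n) <= expR S * expR (s n) * rn (z n - w n).
  rewrite ler_wpM2r ?rn_ge0 //; apply: le_trans hZ _; rewrite ler_peMr // ltW //.
by apply: le_trans (lerD p1 p2) _; rewrite le_eqVlt; apply/orP; left; apply/eqP; ring.
Qed.

End bigO.

(** * The commuting unitary as a limit of the unitaries of a cocycle *)

Section unitary_limit.
Context {R : realType} {d : nat} {P : set 'rV[R]_d} {H : hilbertType R}.
Variables (W S : 'rV[R]_d -> bop H).
Hypothesis Pc : convex_cone P.
Hypothesis Wiso : forall x, P x -> isometric (W x).
Hypothesis WD : forall x y, P x -> P y -> W (x + y) = W x * W y.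
Hypothesis SU : forall x, P x -> unitary (S x).
Hypothesis SW : forall x, P x -> S x * W x = W x.
Hypothesis SD : forall x y u, P x -> P y -> forall w, adj (W x) w = 0 ->
  S (x + y) (w + W x u) = S x w + W x (S y u).
Variables (a : 'rV[R]_d) (Pa : P a).
Hypothesis Wpure : forall u (e : R), 0 < e ->
  exists N, forall n, (N <= n)%N -> rn (adj (W (a *+ n)) u) <= e.

Local Notation E x := (W x * adj (W x)).
Local Notation E' x := (1 - W x * adj (W x)).

Lemma S_rep x y u : P x -> P y -> S (x + y) (W x u) = W x (S y u).
Proof. by move=> Px Py; have := SD u Px Py (bop_0 _); rewrite add0r bop_0 add0r. Qed.

Lemma S_E' x y u : P x -> P y -> S (x + y) (E' x u) = S x (E' x u).
Proof.
move=> Px Py; have := SD 0 Px Py (_ : adj (W x) (E' x u) = 0).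
by rewrite !bop_0 !addr0; apply; rewrite -bopME (adj_rep_E' Wiso).
Qed.

(** [S_(x+y)] and [S_x] agree on [ker V_x^*], so only the component [V_x V_x^* u] contributes, with
    at most twice its norm. *)
Lemma S_diff x y u : P x -> P y -> rn (S (x + y) u - S x u) <= 2 * rn (adj (W x) u).
Proof.
move=> Px Py.
have -> : S (x + y) u = S x (E' x u) + W x (S y (adj (W x) u)).
  by rewrite {1}(E'_decomp W x u) bop_D S_E' // S_rep.
have -> : S x u = S x (E' x u) + W x (adj (W x) u).
  by rewrite {1}(E'_decomp W x u) bop_D -[S x (W x _)]bopME SW.
rewrite opprD addrACA subrr add0r -bop_B.
rewrite (isometric_rn _ (Wiso Px)); apply: le_trans (rn_triangleB _ _) _.
by rewrite (isometric_rn _ (unitary_isometric (SU Py))) mulr_natl mulr2n.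
Qed.

(** By [S_diff] and purity [S_(na) u] is Cauchy. The limit along [x + n a] is the same, and there
    [S_E'] and [S_rep] give the relations with [V_x]. Surjectivity needs an argument of its own,
    since a strong limit of unitaries is a priori only an isometry. *)
Lemma unitary_limit : exists U : bop H, [/\ unitary U,
  forall x, P x -> U * W x = W x * U & forall x, P x -> S x = U * E' x + E x].
Proof.
have Pn n : P (a *+ n) := coneMn Pc n Pa.
have bound N n u : (N <= n)%N -> rn (S (a *+ n) u - S (a *+ N) u) <= 2 * rn (adj (W (a *+ N)) u).
  by move=> Nn; rewrite -(subnKC Nn) mulrnDr S_diff.
have /choice[f hf] : forall u, exists l, tends (fun n => S (a *+ n) u) l.
  move=> u; apply: cauchy_tends => ep e0.
  have e4 : 0 < ep / 4 by lra.
  have [N hN] := Wpure u e4; exists N => m n Nm Nn.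
  apply: le_trans (rn_dist_triangle _ (S (a *+ N) u) _) _.
  have := bound _ _ u Nm; have := bound _ _ u Nn; rewrite (rnB (S (a *+ N) u)).
  have := hN N (leqnn _); lra.
have finner u v : inner (f u) (f v) = inner u v.
  apply: tends_unique (tends_inner (hf u) (hf v)) _.
  under [X in tends X]eq_fun => n do rewrite (unitary_isometric (SU (Pn n))).
  exact: tends_cst.
have fl : linear f.
  move=> c u v; apply: tends_unique (hf _) _.
  under [X in tends X]eq_fun do rewrite bop_linear.
  apply: tendsD => //; apply: (@tends_squeeze _ _ _ _ _ (fun n => S (a *+ n) u - f u) (rn c)) => [n|].
    by rewrite -scalerBr rnZ.
  by have := tendsD (hf u) (tends_cst (- f u)); rewrite subrr.
have fC u : rn (f u) <= 1 * rn u.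
  by rewrite mul1r -(@ler_pXn2r _ 2) ?nnegrE ?rn_ge0 // !rn_inner finner.
pose U := mkbop fl fC.
have iU : isometric U by exact: finner.
have tx x u : P x -> tends (fun n => S (x + a *+ n) u) (U u).
  move=> Px; apply: (@tends_squeeze _ _ _ _ _
    (fun n => (2 * rn (adj (W (a *+ n)) u))%:C + (rn (S (a *+ n) u - U u))%:C) 1).
    move=> n; rewrite mul1r -rmorphD /= rnC ger0_norm ?addr_ge0 ?mulr_ge0 ?rn_ge0 //.
    apply: le_trans (rn_dist_triangle _ (S (a *+ n) u) _) _; rewrite lerD2r.
    by rewrite [x + _]addrC; exact: S_diff.
  move=> ep e0; have e4 : 0 < ep / 4 by lra.
  have [N1 h1] := Wpure u e4; have [N2 h2] := hf u _ e4.
  exists (maxn N1 N2) => n; rewrite geq_max => /andP[/h1 {}h1 /h2 {}h2].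
  rewrite subr0 -rmorphD /= rnC ger0_norm ?addr_ge0 ?mulr_ge0 ?rn_ge0 //.
  rewrite /= in h2 *; lra.
have UE' x u : P x -> U (E' x u) = S x (E' x u).
  move=> Px; apply: tends_unique (tx x _ Px) _.
  by under [X in tends X]eq_fun do rewrite S_E' //; exact: tends_cst.
have UW x : P x -> U * W x = W x * U.
  move=> Px; apply: bop_ext => u; rewrite !bopME.
  apply: tends_unique (tx x _ Px) _.
  under [X in tends X]eq_fun do rewrite S_rep //.
  apply: (@tends_squeeze _ _ _ _ _ (fun n => S (a *+ n) u - U u) 1) => [n|].
    by rewrite -bop_B (isometric_rn _ (Wiso Px)) mul1r.
  by have := tendsD (hf u) (tends_cst (- f u)); rewrite subrr.
have SE x : P x -> S x = U * E' x + E x.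
  move=> Px; apply: bop_ext => u; rewrite bopDE [(U * _) u]bopME UE' //.
  by rewrite {1}(E'_decomp W x u) bop_D -[S x (W x _)]bopME SW.
exists U; split => //.
(* Each [E'_(Na) v] is in the range of [U], because [S_(Na)] is unitary, commutes with [E'_(Na)] and
   agrees with [U] on its range. So [y] orthogonal to the range of [U] satisfies
   [|y| = |V_(Na)^* y|], which is small. *)
have inj y : adj U y = 0 -> y = 0.
  move=> Uy; apply: rn_le_eps => ep e0.
  have [N /(_ N (leqnn _)) hN] := Wpure y e0.
  suff -> : y = W (a *+ N) (adj (W (a *+ N)) y) by rewrite (isometric_rn _ (Wiso (Pn N))).
  rewrite {1}(E'_decomp W (a *+ N) y) (_ : E' _ y = 0) ?add0r //.
  apply: inner_ext => v; rewrite inner0r adjPr (adj_E' W).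
  have comm : E' (a *+ N) v = U (E' (a *+ N) (adj (S (a *+ N)) v)).
    have SS : E' (a *+ N) * S (a *+ N) = S (a *+ N) * E' (a *+ N).
      have aSW : adj (S (a *+ N)) * W (a *+ N) = W (a *+ N).
        by rewrite -{1}(SW (Pn N)) mulrA (SU (Pn N)).1 mul1r.
      have WS : adj (W (a *+ N)) * S (a *+ N) = adj (W (a *+ N)).
        by have := congr1 (fun T : bop H => adj T) aSW; rewrite /= bop_adjM adjK.
      by rewrite mulrBl mulrBr mul1r mulr1 -mulrA WS mulrA SW.
    by rewrite UE' // -[S _ (E' _ _)]bopME -SS bopME unitary_adjKr //; exact: SU.
  by rewrite comm adjP Uy inner0r.
split; first exact: isometric_adjM.
apply: bop_ext => y; apply/eqP; rewrite -subr_eq0; apply/eqP/inj.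
by rewrite bop_B bopME isometric_adjK // subrr.
Qed.

End unitary_limit.

Section gauge_cocycles.
Context {R : realType} {d : nat} {P : set 'rV[R]_d} {H : hilbertType R}.
Variables (F : fock_space H) (W : 'rV[R]_d -> bop H).
Variable alph : 'rV[R]_d -> bop F -> bop F.
Hypothesis Pc : convex_cone P.
Hypothesis Wiso : forall x, P x -> isometric (W x).
Hypothesis WD : forall x y, P x -> P y -> W (x + y) = W x * W y.
Hypothesis Wcont : forall u x (e : R), P x -> 0 < e ->
  exists2 delta, 0 < delta & forall y, P y -> `|y - x| <= delta -> rn (W y u - W x u) <= e.
Hypothesis alphn : forall x, P x -> normal_map (alph x).
Hypothesis alphe : forall x, P x -> unital_star_endomorphism (alph x).
Hypothesis alphW : forall x, P x -> forall u, alph x (weyl F u) = weyl F (W x u).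
Implicit Types (x y z : 'rV[R]_d) (u v w : H).

Local Notation E x := (W x * adj (W x)).
Local Notation E' x := (1 - W x * adj (W x)).
Local Notation e u := (expvec F u).
Local Notation Om := (vac F).

Lemma perp_intertwiner x w : P x -> adj (W x) w = 0 ->
  exists2 J : bop F, forall u, J (e u) = e (w + W x u) &
    forall T, alph x T * J = J * T.
Proof.
move=> Px Ww.
apply: (shift_ex (alphn Px) (alphe Px) (alphW Px) (Wiso Px) Ww).
Qed.

Lemma adj_rep_E'0 x u : P x -> adj (W x) (E' x u) = 0.
Proof. by move=> Px; rewrite -bopME (adj_rep_E' Wiso). Qed.

Section cocycle.
Variable G : 'rV[R]_d -> bop F.
Hypothesis GU : forall x, P x -> unitary (G x).
Hypothesis GM : forall x y, P x -> P y -> G x * alph x (G y) = G (x + y).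
Hypothesis Gcomm : forall x T, P x -> G x * alph x T = alph x T * G x.
Hypothesis Gcont : forall xi x (e : R), P x -> 0 < e ->
  exists2 delta, 0 < delta & forall y, P y -> `|y - x| <= delta -> rn (G y xi - G x xi) <= e.
Hypothesis no_additive_cocycle : forall xi : 'rV[R]_d -> H,
  (forall x, P x -> adj (W x) (xi x) = 0) ->
  (forall x y, P x -> P y -> xi (x + y) = xi x + W x (xi y)) ->
  forall x, P x -> xi x = 0.

Definition kern x u v : R[i] := inner (e u) (G x (e v)).

(* [J eta = alph x (ketbra eta Om) (J Om)], and [G x] commutes with the range
   of [alph x]. *)
Lemma intertwiner_kernel x (J J' : bop F) : P x ->
  (forall T, alph x T * J = J * T) -> (forall T, alph x T * J' = J' * T) ->
  forall xi eta, inner (J' xi) (G x (J eta)) =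
    inner xi eta * inner (J' Om) (G x (J Om)).
Proof.
move=> Px hJ hJ' xi eta.
have -> : J eta = alph x (ketbra eta Om) (J Om).
  by rewrite -bopME hJ bopME ketbraE innerE rn_vac expr1n scale1r.
rewrite -[G x (alph _ _ _)]bopME Gcomm // bopME adjPr -(phiA (alphe Px)) adj_ketbra.
rewrite -[alph _ _ (J' _)]bopME hJ' bopME ketbraE bop_Z innerZl -innerJ //.
Qed.

(** [G_(x+y) = G_x alpha_x(G_y)] and [alpha_x(G_y) J_w = J_w G_y]; [intertwiner_kernel] then splits
    off the matrix coefficient of [G_y]. *)
Lemma kern_cocycle x y w w' u u' : P x -> P y -> adj (W x) w = 0 -> adj (W x) w' = 0 ->
  kern (x + y) (w' + W x u') (w + W x u) = kern x w' w * kern y u' u.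
Proof.
move=> Px Py xw xw'; rewrite /kern -GM // bopME.
have [J Je hJ] := perp_intertwiner Px xw; have [J' Je' hJ'] := perp_intertwiner Px xw'.
rewrite -Je -Je' -[alph _ _ (J _)]bopME hJ bopME intertwiner_kernel // mulrC.
by rewrite /vac Je Je' !bop_0 !addr0.
Qed.

Lemma kern_shift x w w' u u' : P x -> adj (W x) w = 0 -> adj (W x) w' = 0 ->
  kern x (w' + W x u') (w + W x u) = kern x w' w * cexp (inner u' u).
Proof.
move=> Px xw xw'; rewrite /kern.
have [J Je hJ] := perp_intertwiner Px xw; have [J' Je' hJ'] := perp_intertwiner Px xw'.
rewrite -Je -Je' intertwiner_kernel // mulrC inner_exp.
by rewrite /vac Je Je' !bop_0 !addr0.
Qed.

Definition ckern x u v := kern x (E' x u) (E' x v).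

Lemma kernE x u v : P x ->
  kern x u v = ckern x u v * cexp (inner (adj (W x) u) (adj (W x) v)).
Proof.
move=> Px; rewrite {1}(E'_decomp W x u) {1}(E'_decomp W x v).
by rewrite kern_shift // adj_rep_E'0.
Qed.

(** [E'_(x+y) z = E'_x z + V_x E'_y V_x^* z], a decomposition to which [kern_cocycle] applies. *)
Lemma ckern_cocycle x y u v : P x -> P y ->
  ckern (x + y) u v = ckern x u v * ckern y (adj (W x) u) (adj (W x) v).
Proof.
move=> Px Py; rewrite /ckern.
have h (z : H) : E' (x + y) z = E' x z + W x (E' y (adj (W x) z)).
  rewrite {1}(E'_decomp W x (E' (x + y) z)) -[E' x (E' _ _)]bopME.
  by rewrite (E'_monotone Wiso) // -[adj _ (E' _ _)]bopME (adj_rep_E'D Wiso).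
by rewrite !h kern_cocycle // adj_rep_E'0.
Qed.

Definition chi x := kern x 0 0.

Lemma ckern00 x : ckern x 0 0 = chi x.
Proof. by rewrite /ckern !bop_0. Qed.

Lemma chiD x y : P x -> P y -> chi (x + y) = chi x * chi y.
Proof. by move=> Px Py; rewrite -!ckern00 ckern_cocycle // !bop_0. Qed.

(** At 0 the projection [E'_0] vanishes, so [G_0] is the scalar [chi 0], which is idempotent and
    nonzero. *)
Lemma gauge0 : G 0 = 1.
Proof.
have P0 := cone0 Pc.
have hG : G 0 = chi 0 *: (1 : bop F).
  apply: exp_kernel_ext => u v; rewrite bopZE bop1E innerZr inner_exp.
  rewrite -/(kern 0 u v) kernE // (rep0 Pc Wiso WD) bop_adj1 !bop1E /ckern.
  by rewrite (rep0 Pc Wiso WD) bop_adj1 mulr1 subrr !bop0E.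
have := chiD P0 P0; rewrite addr0 => chi2.
have c0 : chi 0 != 0.
  apply/eqP => c0; have := isometric_rn (vac F) (unitary_isometric (GU P0)).
  rewrite hG c0 scale0r bop0E rn0 rn_vac => /eqP; by rewrite eq_sym oner_eq0.
have c1 : chi 0 = 1 by apply: (mulfI c0); rewrite -chi2 mulr1.
by rewrite hG c1 scale1r.
Qed.

Lemma chi_sub1 y : rn (chi y - 1) <= rn (G y Om - Om).
Proof.
rewrite /chi /kern -(inner_vac F 0) -innerBr; apply: le_trans (cauchy_schwarz _ _) _.
by rewrite rn_vac mul1r.
Qed.

Lemma gauge_cont0 xi (ep : R) : 0 < ep ->
  exists2 delta, 0 < delta & forall y, P y -> `|y| <= delta -> rn (G y xi - xi) <= ep.
Proof.
move=> e0; have [delta d0 hd] := Gcont xi (cone0 Pc) e0.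
by exists delta => // y Py yd; have := hd y Py; rewrite subr0 gauge0 bop1E; exact.
Qed.

Lemma chi_Mn x n : P x -> chi (x *+ n) = chi x ^+ n.
Proof.
move=> Px; elim: n => [|n IH].
  by rewrite mulr0n expr0 /chi /kern gauge0 bop1E inner_vac.
by rewrite mulrS exprS -IH chiD //; exact: (coneMn Pc).
Qed.

(** [chi] is close to 1 near 0, and [chi x] is a power of [chi] at a mesh step. *)
Lemma chi_neq0 x : P x -> chi x != 0.
Proof.
move=> Px; have h2 : 0 < 2^-1 :> R by rewrite invr_gt0.
have [delta d0 hd] := gauge_cont0 Om h2.
have [N hN] := mesh_small x d0.
rewrite -(meshK x N) chi_Mn ?expf_neq0 //; last exact: (mesh_cone Pc Px).
apply/eqP => c0.
have := le_trans (chi_sub1 _) (hd _ (mesh_cone Pc Px N) (hN _ (leqnn N))).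
rewrite c0 sub0r rnN rn1; lra.
Qed.

Lemma ckern_mesh x n u v : P x -> ckern x u v =
  \prod_(0 <= j < n.+1) kern (mesh x n) (piece W x n j u) (piece W x n j v).
Proof.
move=> Px; have Pm := mesh_cone Pc Px n.
rewrite -{1}(meshK x n).
elim: n.+1 => [|m IH]; last first.
  by rewrite big_nat_recr //= -IH mulrSr ckern_cocycle //; exact: (coneMn Pc).
rewrite big_geq // mulr0n /ckern /kern (rep0 Pc Wiso WD) bop_adj1 mulr1 subrr !bop0E.
by rewrite gauge0 bop1E inner_vac.
Qed.

Lemma rn_gauge x xi : P x -> rn (G x xi) = rn xi.
Proof. by move=> Px; apply: isometric_rn; apply: unitary_isometric; exact: GU. Qed.

(** The coefficient of the real parameter [t] in [ckern x (t u) 0]. *)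
Definition acoef x u := inner (ione F (E' x u)) (G x Om).

Lemma ioneZ (a : R[i]) u : ione F (a *: u) = a *: ione F u.
Proof. by rewrite /ione npartZ expr1. Qed.

Lemma ione0 : ione F 0 = 0.
Proof. by rewrite -(scale0r (0 : H)) ioneZ scale0r. Qed.

Lemma bigO_exp1 (g : F) u :
  bigO 2 (fun t => inner (e (t%:C *: u)) g - (inner Om g + inner (ione F u) g * t%:C)).
Proof.
exists (rn u ^+ 2 * expR (rn u ^+ 2) * rn g) => t t0 t1.
have -> : inner (e (t%:C *: u)) g - (inner Om g + inner (ione F u) g * t%:C) =
    inner (e (t%:C *: u) - Om - ione F (t%:C *: u)) g.
  by rewrite !innerBl ioneZ innerZl cjC; ring.
apply: le_trans (cauchy_schwarz _ _) _; rewrite mulrAC ler_wpM2r ?rn_ge0 //.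
apply: le_trans (rn_exp_sub2 _ _) _; rewrite rnZ rnC gtr0_norm // exprMn.
have -> : rn u ^+ 2 * expR (rn u ^+ 2) * t ^+ 2 = t ^+ 2 * rn u ^+ 2 * expR (rn u ^+ 2) by ring.
apply: ler_wpM2l; first by rewrite mulr_ge0 ?sqr_ge0.
by rewrite ler_expR ler_piMl ?sqr_ge0 // exprn_ile1 // ltW.
Qed.

(* First order terms in the cocycle identity for [kern]. *)
Lemma acoefD x y u : P x -> P y ->
  acoef (x + y) u = chi x * acoef y (adj (W x) u) + acoef x u * chi y.
Proof.
move=> Px Py.
pose f z w t := ckern z (t%:C *: w) 0.
have hO z w : bigO 2 (fun t => f z w t - (chi z + acoef z w * t%:C)).
  apply: bigO_ext (bigO_exp1 (G z Om) (E' z w)) => t.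
  by rewrite /f /ckern /kern bop_Z bop_0.
apply: (@bigO_coef_prod1 _ (f (x + y) u) (f x u) (f y (adj (W x) u))) => //.
- by move=> t; rewrite /f ckern_cocycle // bop_Z bop_0.
- by rewrite -chiD.
Qed.

(** [acoefD] is a cocycle identity twisted by [chi]; dividing the Riesz vector of [acoef x] by
    [chi x] makes it additive, and [no_additive_cocycle] applies. *)
Lemma acoef_eq0 x u : P x -> acoef x u = 0.
Proof.
have ex z : exists xi, forall v, inner (ione F v) (G z Om) = inner v xi.
  have [a v w|v|xi hxi] := @riesz _ H (fun v => inner (G z Om) (ione F v)) (rn (G z Om)).
  - by rewrite (@ione_linear _ _ F) innerDr innerZr.
  - by apply: le_trans (cauchy_schwarz _ _) _; rewrite rn_ione.
  by exists xi => v; rewrite innerJ hxi -innerJ.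
have /choice[xi hxi] := ex.
pose eta z := (chi z)^-1 *: E' z (xi z).
have aE z v : P z -> acoef z v = chi z * inner v (eta z).
  move=> Pz; rewrite /acoef hxi /eta innerZr mulrA mulfV ?mul1r; last exact: chi_neq0.
  by rewrite adjPr (adj_E' W).
have eta0 z : P z -> eta z = 0.
  apply: no_additive_cocycle => {}z.
    by move=> Pz; rewrite /eta bop_Z adj_rep_E'0 // scaler0.
  move=> y Pz Py; apply: inner_ext => v.
  apply: (mulfI (chi_neq0 (coneD Pc Pz Py))).
  rewrite -aE; last exact: (coneD Pc).
  rewrite acoefD // !aE // chiD // innerDr adjPr; ring.
by move=> Px; rewrite aE // eta0 // inner0r mulr0.
Qed.

Lemma rn_kern_le x u v : P x -> rn (kern x u v) <= expR (rn u ^+ 2 + rn v ^+ 2).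
Proof.
move=> Px; apply: le_trans (cauchy_schwarz _ _) _; rewrite rn_gauge // expRD.
have h (w : H) : rn (e w) <= expR (rn w ^+ 2).
  rewrite -(@ler_pXn2r _ 2) ?nnegrE ?rn_ge0 ?expR_ge0 // rn_exp expr2 ler_peMr ?expR_ge0 //.
  by apply: le_trans (expR_ge1Dx _); rewrite lerDl sqr_ge0.
by apply: ler_pM; rewrite ?rn_ge0.
Qed.

Lemma rn_chi_le1 x : P x -> rn (chi x) <= 1.
Proof.
move=> Px; apply: le_trans (cauchy_schwarz _ _) _.
by rewrite rn_gauge // rn_vac mulr1.
Qed.

Lemma gauge_vac_sub y : P y -> rn (G y Om - chi y *: Om) <= 2 * rn (G y Om - Om).
Proof.
move=> Py; apply: le_trans (rn_dist_triangle _ Om _) _.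
have -> : Om - chi y *: Om = (1 - chi y) *: Om by rewrite scalerBl scale1r.
rewrite rnZ rn_vac mulr1 (rnB 1).
have := chi_sub1 y; lra.
Qed.

Lemma piece_E' x n j u : P x -> E' (mesh x n) (piece W x n j u) = piece W x n j u.
Proof.
by move=> Px; rewrite /piece -bopME (E'_idem Wiso) //; exact: (mesh_cone Pc).
Qed.

(* The factors of [ckern_mesh] differ from [chi] of a mesh step by a product of
   two quantities that are small for a fine mesh. *)
Lemma ckern_vac x u : P x -> ckern x u 0 = chi x.
Proof.
move=> Px; apply/eqP; rewrite -subr_eq0; apply/eqP; apply: rn_le_eps => ep ep0.
pose C := expR (rn u ^+ 2) * (rn u ^+ 2 * expR (rn u ^+ 2) * 2) + 1.
have C0 : 0 < C.
  by rewrite /C ltr_wpDl // mulr_ge0 ?expR_ge0 // mulr_ge0 // mulr_ge0 ?expR_ge0 ?sqr_ge0.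
have [delta d0 hd] := gauge_cont0 Om (divr_gt0 ep0 C0).
have [N hN] := mesh_small x d0.
have Pm := mesh_cone Pc Px N.
have small := hd _ Pm (hN _ (leqnn N)).
have cx : chi x = \prod_(0 <= j < N.+1) chi (mesh x N).
  by rewrite -{1}(meshK x N) chi_Mn // big_const_nat subn0 iter_mulr_1.
rewrite (ckern_mesh N) // cx.
set g := mesh x N in Pm small *.
pose s j := rn (piece W x N j u) ^+ 2.
have p0 j : piece W x N j 0 = 0 by rewrite /piece !bop_0.
apply: le_trans (@prod_compare _ N.+1 _ _ s _ _ _) _.
- by move=> j; rewrite p0; apply: le_trans (rn_kern_le _ _ Pm) _; rewrite rn0 expr0n addr0.
- move=> j; apply: le_trans (rn_chi_le1 Pm) _.
  by apply: le_trans (expR_ge1Dx _); rewrite lerDl sqr_ge0.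
- by move=> j; exact: sqr_ge0.
have ss : \sum_(0 <= j < N.+1) s j <= rn u ^+ 2 := sum_piece_sqr Pc Wiso WD Px N u.
have each j : rn (kern g (piece W x N j u) (piece W x N j 0) - chi g) <=
    s j * (expR (rn u ^+ 2) * (2 * rn (G g Om - Om))).
  rewrite p0; set w := piece _ _ _ _ _.
  have -> : kern g w 0 - chi g = inner (e w - Om - ione F w) (G g Om - chi g *: Om).
    rewrite /kern /chi /kern !innerBr !innerBl !innerZr.
    have -> : inner (ione F w) (G g Om) = 0.
      by rewrite -(acoef_eq0 w Pm) /acoef /w piece_E'.
    by rewrite inner_vacr inner_ione_vac innerE rn_vac expr1n; ring.
  apply: le_trans (cauchy_schwarz _ _) _; rewrite mulrA; apply: ler_pM; rewrite ?rn_ge0 //.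
    apply: le_trans (rn_exp_sub2 _ _) _; rewrite ler_wpM2l ?sqr_ge0 // ler_expR.
    by rewrite ler_pXn2r ?nnegrE ?rn_ge0 // (rn_piece_le Pc Wiso).
  exact: gauge_vac_sub.
have sumle : \sum_(0 <= j < N.+1) rn (kern g (piece W x N j u) (piece W x N j 0) - chi g) <=
    rn u ^+ 2 * (expR (rn u ^+ 2) * (2 * rn (G g Om - Om))).
  apply: (@le_trans _ _ (\sum_(0 <= j < N.+1) s j * (expR (rn u ^+ 2) * (2 * rn (G g Om - Om))))).
    by apply: ler_sum => j _; exact: each.
  by rewrite -mulr_suml ler_wpM2r // !mulr_ge0 ?expR_ge0 ?rn_ge0.
apply: (@le_trans _ _ (expR (rn u ^+ 2) * (rn u ^+ 2 * (expR (rn u ^+ 2) * (2 * rn (G g Om - Om)))))).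
  apply: ler_pM => //; rewrite ?expR_ge0 ?ler_expR //.
  by apply: sumr_ge0 => j _; exact: rn_ge0.
apply: (@le_trans _ _ (C * rn (G g Om - Om))).
  rewrite [leRHS](_ : _ = expR (rn u ^+ 2) * (rn u ^+ 2 * (expR (rn u ^+ 2) *
    (2 * rn (G g Om - Om)))) + rn (G g Om - Om)); last by rewrite /C; ring.
  by rewrite lerDl rn_ge0.
by rewrite mulrC -ler_pdivlMr.
Qed.

Lemma gauge_vac x : P x -> G x Om = chi x *: Om.
Proof.
move=> Px; apply/eqP; rewrite -subr_eq0; apply/eqP; apply: (@exp_total _ _ F) => u.
rewrite innerBr innerZr inner_vacr mulr1 -/(kern x u 0) kernE // bop_0 inner0r cexp0.
by rewrite mulr1 ckern_vac // subrr.
Qed.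

Lemma rn_chi x : P x -> rn (chi x) = 1.
Proof. by move=> Px; have := rn_gauge Om Px; rewrite gauge_vac // rnZ rn_vac mulr1. Qed.

Lemma adj_gauge_vac x : P x -> adj (G x) Om = (chi x)^-1 *: Om.
Proof.
move=> Px; rewrite -{1}[Om](scale1r) -(mulVf (chi_neq0 Px)) -scalerA bop_Z.
by rewrite -gauge_vac // unitary_adjK //; exact: GU.
Qed.

Lemma conj_chi x : P x -> ((chi x)^-1)^*%C = chi x.
Proof.
move=> Px; apply: (mulIf (invr_neq0 (chi_neq0 Px))).
by rewrite mulJ_rn rnV rn_chi // invr1 expr1n mulfV // chi_neq0.
Qed.

Definition bform x u v : R[i] := (chi x)^-1 * inner (ione F u) (G x (ione F v)).

(** [Om] is an eigenvector of [G_x] and of its adjoint, so the three terms that involve the vacuum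
    all equal [chi x] up to sign. *)
Lemma kern_decomp x u v : P x -> kern x u v - chi x =
  inner (e u - Om) (G x (e v - Om)).
Proof.
move=> Px; rewrite !innerBl !bop_B !innerBr -/(kern x u v) gauge_vac // !innerZr.
rewrite inner_vacr [inner Om (G x (e v))]adjPr adj_gauge_vac // innerZl inner_vac.
by rewrite conj_chi // innerE rn_vac expr1n; ring.
Qed.

Lemma rn_bform x u v : P x -> rn (bform x u v) <= rn u * rn v.
Proof.
move=> Px; rewrite /bform rnM rnV rn_chi // invr1 mul1r.
by apply: le_trans (cauchy_schwarz _ _) _; rewrite rn_gauge // !rn_ione.
Qed.

(** When both exponential vectors in [kern_decomp] are expanded, the pair of one-particle terms
    gives [bform]; all other pairs have total degree at least three, and degree at least one in each
    of [u] and [v]. *)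
Lemma kern_bform x u v (r : R) : P x -> rn u <= r -> rn v <= r ->
  rn (kern x u v - chi x * (1 + bform x u v)) <=
  rn u * rn v * (rn u + rn v) * expR (r ^+ 2) ^+ 2.
Proof.
move=> Px ur vr; have r0 := le_trans (rn_ge0 u) ur.
have hr (w : H) : rn w <= r -> expR (rn w ^+ 2) <= expR (r ^+ 2).
  by move=> wr; rewrite ler_expR ler_pXn2r ?nnegrE ?rn_ge0.
have -> : kern x u v - chi x * (1 + bform x u v) =
    inner (e u - Om - ione F u) (G x (e v - Om)) +
    inner (ione F u) (G x (e v - Om - ione F v)).
  have -> : kern x u v - chi x * (1 + bform x u v) =
      (kern x u v - chi x) - chi x * bform x u v by ring.
  rewrite kern_decomp // /bform mulrA mulfV ?mul1r ?chi_neq0 //.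
  rewrite [inner (_ - ione F u) _]innerBl [G x (_ - ione F v)]bop_B [inner (ione F u) (_ - _)]innerBr; ring.
have e1 : 1 <= expR (r ^+ 2).
  by apply: le_trans (expR_ge1Dx _); rewrite lerDl sqr_ge0.
apply: le_trans (rn_triangle _ _) _.
have b1 : rn (inner (e u - Om - ione F u) (G x (e v - Om))) <=
    (rn u ^+ 2 * expR (r ^+ 2)) * (rn v * expR (r ^+ 2)).
  apply: le_trans (cauchy_schwarz _ _) _; rewrite rn_gauge //.
  apply: ler_pM; rewrite ?rn_ge0 //.
    by apply: le_trans (rn_exp_sub2 _ _) _; rewrite ler_wpM2l ?sqr_ge0 ?hr.
  by apply: le_trans (rn_exp_sub1 _ _) _; rewrite ler_wpM2l ?rn_ge0 ?hr.
have b2 : rn (inner (ione F u) (G x (e v - Om - ione F v))) <=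
    rn u * (rn v ^+ 2 * expR (r ^+ 2)).
  apply: le_trans (cauchy_schwarz _ _) _; rewrite rn_gauge // rn_ione ler_wpM2l ?rn_ge0 //.
  by apply: le_trans (rn_exp_sub2 _ _) _; rewrite ler_wpM2l ?sqr_ge0 ?hr.
have b3 : rn u * (rn v ^+ 2 * expR (r ^+ 2)) <= rn u * (rn v ^+ 2 * expR (r ^+ 2)) * expR (r ^+ 2).
  by rewrite ler_peMr // !mulr_ge0 ?rn_ge0 ?expR_ge0.
apply: le_trans (lerD b1 (le_trans b2 b3)) _.
by rewrite le_eqVlt; apply/orP; left; apply/eqP; ring.
Qed.

Lemma bformZ x (s t : R) u v : bform x (s%:C *: u) (t%:C *: v) = (s * t)%:C * bform x u v.
Proof.
by rewrite /bform !ioneZ bop_Z innerZl innerZr cjC rmorphM /=; ring.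
Qed.

Definition bcoef x u v := bform x (E' x u) (E' x v).

Lemma bigO_ckern x u v : P x ->
  bigO 3 (fun t => ckern x (t%:C *: u) (t%:C *: v) - chi x * (1 + bcoef x u v * t%:C ^+ 2)).
Proof.
move=> Px; pose r := rn u + rn v.
exists (r * r * (r + r) * expR (r ^+ 2) ^+ 2) => t t0 t1.
have hr : 0 <= r by rewrite addr_ge0 ?rn_ge0.
have tu : rn (E' x (t%:C *: u)) <= t * r.
  apply: le_trans (rn_E'_le Wiso _ Px) _; rewrite rnZ rnC gtr0_norm // ler_wpM2l ?(ltW t0) //.
  by rewrite lerDl rn_ge0.
have tv : rn (E' x (t%:C *: v)) <= t * r.
  apply: le_trans (rn_E'_le Wiso _ Px) _; rewrite rnZ rnC gtr0_norm // ler_wpM2l ?(ltW t0) //.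
  by rewrite lerDr rn_ge0.
have tr : t * r <= r by rewrite ler_piMl.
have := kern_bform Px (le_trans tu tr) (le_trans tv tr).
have -> : bform x (E' x (t%:C *: u)) (E' x (t%:C *: v)) = bcoef x u v * t%:C ^+ 2.
  by rewrite !bop_Z bformZ rmorphM /= mulrC expr2.
move/le_trans; apply.
have -> : r * r * (r + r) * expR (r ^+ 2) ^+ 2 * t ^+ 3 =
  (t * r) * (t * r) * (t * r + t * r) * expR (r ^+ 2) ^+ 2 by ring.
rewrite ler_wpM2r ?sqr_ge0 //; apply: ler_pM; rewrite ?mulr_ge0 ?addr_ge0 ?rn_ge0 //.
  by apply: ler_pM; rewrite ?rn_ge0.
exact: lerD.
Qed.

(** Second order terms of [ckern_cocycle] when both arguments are scaled by [t]. *)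
Lemma bcoefD x y u v : P x -> P y ->
  bcoef (x + y) u v = bcoef x u v + bcoef y (adj (W x) u) (adj (W x) v).
Proof.
move=> Px Py.
apply: (@bigO_coef_prod2 _ (fun t => ckern (x + y) (t%:C *: u) (t%:C *: v))
   (fun t => ckern x (t%:C *: u) (t%:C *: v))
   (fun t => ckern y (t%:C *: adj (W x) u) (t%:C *: adj (W x) v)) (chi x) (chi y)).
- exact: chi_neq0.
- exact: chi_neq0.
- by move=> t; rewrite ckern_cocycle // !bop_Z.
- by rewrite -chiD //; apply: bigO_ckern; exact: (coneD Pc).
- exact: bigO_ckern.
- exact: bigO_ckern.
Qed.

Lemma bcoef_mesh x n u v : P x -> bcoef x u v =
  \sum_(0 <= j < n.+1) bform (mesh x n) (piece W x n j u) (piece W x n j v).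
Proof.
move=> Px; have Pm := mesh_cone Pc Px n.
rewrite -{1}(meshK x n).
elim: n.+1 => [|m IH]; last first.
  by rewrite big_nat_recr //= -IH mulrSr bcoefD //; exact: (coneMn Pc).
rewrite big_geq // mulr0n /bcoef /bform (rep0 Pc Wiso WD) bop_adj1 mulr1 subrr !bop0E.
by rewrite ione0 inner0l mulr0.
Qed.

(** Over a mesh both sides are products, with factors [chi g * (1 + b_j)] up to a cubic error and
    [chi g * exp b_j]. These differ by at most a constant times [s_j] times a bound on all pieces;
    the [s_j] sum to at most [|u|^2 + |v|^2], and the pieces tend to 0 uniformly. *)
Lemma ckernE x u v : P x -> ckern x u v = chi x * cexp (bcoef x u v).
Proof.
move=> Px; apply/eqP; rewrite -subr_eq0; apply/eqP; apply: rn_le_eps => ep ep0.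
pose q := rn u ^+ 2 + rn v ^+ 2; pose r := rn u + rn v.
have r0 : 0 <= r by rewrite addr_ge0 ?rn_ge0.
have q0 : 0 <= q by rewrite addr_ge0 ?sqr_ge0.
pose C := expR q * (q * (2 * expR (r ^+ 2) ^+ 2 + r * expR (r ^+ 2))) + 1.
have C0 : 0 < C.
  by rewrite /C ltr_wpDl // mulr_ge0 ?expR_ge0 // mulr_ge0 // addr_ge0 // mulr_ge0 ?expR_ge0 ?sqr_ge0.
have epC := divr_gt0 ep0 C0.
have [N1 hN1] := piece_small Pc Wiso WD Wcont Px u epC.
have [N2 hN2] := piece_small Pc Wiso WD Wcont Px v epC.
pose N := maxn N1 N2.
have Pm := mesh_cone Pc Px N.
have cx : chi x = \prod_(0 <= j < N.+1) chi (mesh x N).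
  by rewrite -{1}(meshK x N) chi_Mn // big_const_nat subn0 iter_mulr_1.
rewrite (ckern_mesh N) // cx (bcoef_mesh N) // cexp_sum -big_split /=.
set g := mesh x N in Pm *.
pose pu j := piece W x N j u; pose pv j := piece W x N j v.
pose s j := rn (pu j) ^+ 2 + rn (pv j) ^+ 2.
have pur j : rn (pu j) <= r.
  by apply: le_trans (rn_piece_le Pc Wiso Px N j u) _; rewrite /r lerDl rn_ge0.
have pvr j : rn (pv j) <= r.
  by apply: le_trans (rn_piece_le Pc Wiso Px N j v) _; rewrite /r lerDr rn_ge0.
have pus j : rn (pu j) <= ep / C by apply: hN1; rewrite leq_maxl.
have pvs j : rn (pv j) <= ep / C by apply: hN2; rewrite leq_maxr.
have uvs j : rn (pu j) * rn (pv j) <= s j.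
  by rewrite /s; have := sqr_ge0 (rn (pu j) - rn (pv j)); have := rn_ge0 (pu j); have := rn_ge0 (pv j); nra.
have bs j : rn (bform g (pu j) (pv j)) <= s j := le_trans (rn_bform _ _ Pm) (uvs j).
apply: le_trans (@prod_compare _ N.+1 _ _ s _ _ _) _.
- by move=> j; exact: rn_kern_le.
- move=> j; rewrite rnM rn_chi // mul1r rn_cexp ler_expR.
  by apply: le_trans (ler_norm _) _; apply: le_trans (Re_le_rn _) _; exact: bs.
- by move=> j; rewrite addr_ge0 ?sqr_ge0.
have ss : \sum_(0 <= j < N.+1) s j <= q.
  by rewrite big_split; apply: lerD; exact: (sum_piece_sqr Pc Wiso WD).
have each j : rn (kern g (pu j) (pv j) - chi g * cexp (bform g (pu j) (pv j))) <=
    s j * ((2 * expR (r ^+ 2) ^+ 2 + r * expR (r ^+ 2)) * (ep / C)).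
  set b := bform g (pu j) (pv j).
  have -> : kern g (pu j) (pv j) - chi g * cexp b =
    (kern g (pu j) (pv j) - chi g * (1 + b)) - chi g * (cexp b - 1 - b) by ring.
  apply: le_trans (rn_triangleB _ _) _.
  have k1 := kern_bform Pm (pur j) (pvr j).
  have k2 : rn (chi g * (cexp b - 1 - b)) <= s j * (r * (ep / C)) * expR (r ^+ 2).
    rewrite rnM rn_chi // mul1r; apply: le_trans (rn_cexp_sub _) _.
    apply: le_trans (expR_sub_le (rn_ge0 _)) _.
    have b1 : rn b <= rn (pu j) * rn (pv j) := rn_bform _ _ Pm.
    apply: ler_pM; rewrite ?sqr_ge0 ?expR_ge0 //.
      rewrite expr2; apply: ler_pM; rewrite ?rn_ge0 ?bs //.
      by apply: le_trans b1 _; apply: ler_pM; rewrite ?rn_ge0.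
    rewrite ler_expR; apply: le_trans b1 _; rewrite expr2.
    by apply: ler_pM; rewrite ?rn_ge0.
  have k3 : rn (pu j) * rn (pv j) * (rn (pu j) + rn (pv j)) * expR (r ^+ 2) ^+ 2 <=
      s j * (2 * (ep / C)) * expR (r ^+ 2) ^+ 2.
    rewrite ler_wpM2r ?sqr_ge0 //; apply: ler_pM; rewrite ?mulr_ge0 ?addr_ge0 ?rn_ge0 //.
    by have := pus j; have := pvs j; lra.
  apply: le_trans (lerD (le_trans k1 k3) k2) _.
  by rewrite le_eqVlt; apply/orP; left; apply/eqP; ring.
have sumle : \sum_(0 <= j < N.+1) rn (kern g (pu j) (pv j) - chi g * cexp (bform g (pu j) (pv j))) <=
    q * ((2 * expR (r ^+ 2) ^+ 2 + r * expR (r ^+ 2)) * (ep / C)).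
  apply: le_trans (ler_sum _ (fun j _ => each j)) _.
  rewrite -mulr_suml ler_wpM2r // mulr_ge0 ?(ltW epC) // addr_ge0 // mulr_ge0 ?expR_ge0 //.
apply: (@le_trans _ _ (expR q * (q * ((2 * expR (r ^+ 2) ^+ 2 + r * expR (r ^+ 2)) * (ep / C))))).
  apply: ler_pM => //; rewrite ?expR_ge0 ?ler_expR //.
  by apply: sumr_ge0 => j _; exact: rn_ge0.
apply: (@le_trans _ _ (C * (ep / C))).
  have Cf (f : R) : C * f = expR q * (q * ((2 * expR (r ^+ 2) ^+ 2 + r * expR (r ^+ 2)) * f)) + f.
    by rewrite /C; ring.
  by rewrite Cf lerDl ltW.
by rewrite mulrCA mulfV ?mulr1 // gt_eqF.
Qed.

(** The total exponent of [kern] is a bounded sesquilinear form, hence [<u, S v>]. Since [G_x] and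
    its adjoint are isometric, so are [S] and its adjoint: the exponentials of [t <S u, S v>] and
    [t <u, v>] agree for all [t] in [(0, 1]]. *)
Lemma gauge_second_quantization x : P x -> exists2 S : bop H, unitary S &
  (forall u, G x (e u) = chi x *: e (S u)) /\ S * W x = W x.
Proof.
move=> Px.
pose B u v := bcoef x u v + inner (adj (W x) u) (adj (W x) v).
have [w c u v|w c u v|u v|T hT] := @sesquilinear_bop _ H B 2.
- rewrite /B /bcoef /bform !bop_linear (@ione_linear _ _ F) bop_linear.
  by rewrite !innerDr !innerZr; ring.
- rewrite /B /bcoef /bform !bop_linear (@ione_linear _ _ F).
  by rewrite !innerDl !innerZl; ring.
- apply: le_trans (rn_triangle _ _) _.
  have h1 : rn (bcoef x u v) <= rn u * rn v.
    apply: le_trans (rn_bform _ _ Px) _; apply: ler_pM; rewrite ?rn_ge0 //.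
      exact: (rn_E'_le Wiso).
    exact: (rn_E'_le Wiso).
  have h2 : rn (inner (adj (W x) u) (adj (W x) v)) <= rn u * rn v.
    apply: le_trans (cauchy_schwarz _ _) _; apply: ler_pM; rewrite ?rn_ge0 //.
      exact: (rn_adj_rep Wiso).
    exact: (rn_adj_rep Wiso).
  lra.
pose S := adj T.
have hS u v : B u v = inner u (S v) by rewrite hT /S adjP.
have Ge u : G x (e u) = chi x *: e (S u).
  apply/eqP; rewrite -subr_eq0; apply/eqP; apply: (@exp_total _ _ F) => w.
  rewrite innerBr innerZr inner_exp -hS /B -/(kern x w u) kernE // ckernE //.
  by rewrite -mulrA -cexpD subrr.
have Ga u : adj (G x) (e u) = (chi x)^-1 *: e (adj S u).
  apply/eqP; rewrite -subr_eq0; apply/eqP; apply: (@exp_total _ _ F) => w.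
  rewrite innerBr innerZr inner_exp -adjP Ge innerZl inner_exp -adjP.
  have -> : (chi x)^*%C = (chi x)^-1 by rewrite -[in LHS](conj_chi Px) conjcK.
  by rewrite subrr.
have iso (T' : bop H) (K : bop F) (c : R[i]) : rn c = 1 -> isometric K ->
    (forall u, K (e u) = c *: e (T' u)) -> isometric T'.
  move=> c1 iK hK u v; apply: cexp_scaled_inj => t t0 t1.
  have := iK (e u) (e (t%:C *: v)); rewrite !hK innerZl innerZr mulrA mulJ_rn c1.
  by rewrite expr1n mul1r !inner_exp bop_Z !innerZr.
have iS : isometric S := iso S (G x) _ (rn_chi Px) (unitary_isometric (GU Px)) Ge.
have iaS : isometric (adj S).
  apply: (iso _ (adj (G x)) (chi x)^-1) => //; first by rewrite rnV rn_chi ?invr1.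
  by apply: unitary_isometric; apply: unitary_adj; exact: GU.
exists S; last split => //.
  by split; [exact: isometric_adjM|have := isometric_adjM iaS; rewrite adjK].
apply: bop_ext => u; apply: inner_ext => w; rewrite bopME -hS /B /bcoef.
have -> : E' x (W x u) = 0 by rewrite -bopME (E'_rep Wiso).
rewrite /bform ione0 bop_0 inner0r mulr0 add0r (rep_adjK Wiso) // adjP adjK //.
Qed.

(** Apply [G_(x+y) = G_x alpha_x(G_y)] to [J_w e(u)]; exponential vectors determine their
    argument. *)
Lemma second_quantization_cocycle x y (S T Z : bop H) u : P x -> P y ->
  (forall u, G x (e u) = chi x *: e (S u)) -> S * W x = W x ->
  (forall u, G y (e u) = chi y *: e (T u)) ->
  (forall u, G (x + y) (e u) = chi (x + y) *: e (Z u)) ->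
  forall w, adj (W x) w = 0 -> Z (w + W x u) = S w + W x (T u).
Proof.
move=> Px Py hS SW hT hZ w xw.
have [J Je hJ] := perp_intertwiner Px xw.
have := hZ (w + W x u); rewrite -GM // bopME -Je -[alph _ _ (J _)]bopME hJ bopME.
rewrite hT !bop_Z Je hS scalerA chiD // mulrC => /(scalerI _) h.
apply: (@expvec_inj _ _ F).
rewrite -h ?mulf_neq0 ?chi_neq0 // bop_D -[S (W x _)]bopME SW //.
Qed.

Lemma gauge_form a : P a ->
  (forall u (ep : R), 0 < ep -> exists N, forall n, (N <= n)%N -> rn (adj (W (a *+ n)) u) <= ep) ->
  exists U : bop H, [/\ unitary U, forall x, P x -> U * W x = W x * U &
    forall x, P x -> unitary (U * E' x + E x) /\
      forall u, G x (e u) = chi x *: e ((U * E' x + E x) u)].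
Proof.
move=> Pa Wpure.
have /choice[S hS] : forall x, exists S : bop H, P x -> unitary S /\
    (forall u, G x (e u) = chi x *: e (S u)) /\ S * W x = W x.
  move=> x; have [Px|nPx] := pselect (P x); last by exists 0.
  by have [S uS hS] := gauge_second_quantization Px; exists S.
have [||x y u Px Py|U [uU UW SE]] := @unitary_limit _ _ P H W S Pc Wiso _ _ _ a Pa Wpure.
- by move=> x Px; have [] := hS x Px.
- by move=> x Px; have [_ []] := hS x Px.
- have [_ [h1 h2]] := hS x Px; have [_ [h3 _]] := hS y Py.
  have [_ [h4 _]] := hS _ (coneD Pc Px Py).
  exact: (second_quantization_cocycle _ Px Py h1 h2 h3 h4).
by exists U; split => // x Px; rewrite -SE //; have [? []] := hS x Px.
Qed.

End cocycle.
End gauge_cocycles.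

(** * Characters of cones *)

Section phases.
Context {R : realType}.
Implicit Types s t : R.

Definition phase t : R[i] := cexp (0 +i* t).

Lemma phaseD s t : phase (s + t) = phase s * phase t.
Proof. by rewrite /phase -cexpD; congr cexp; apply: complex_eqP => /=; rewrite ?addr0. Qed.

Lemma phase0 : phase 0 = 1.
Proof. exact: cexp0. Qed.

Lemma rn_phase t : rn (phase t) = 1.
Proof. by rewrite rn_cexp expR0. Qed.

Lemma phaseX t n : phase t ^+ n = phase (n%:R * t).
Proof.
elim: n => [|n IH]; first by rewrite expr0 mul0r phase0.
by rewrite exprS IH -phaseD mulrS mulrDl mul1r.
Qed.

Lemma phaseE t : phase t = cos t +i* sin t.
Proof. by rewrite /phase /cexp /= expR0 mul1r. Qed.

Lemma rn_cexp_sub1 (z : R[i]) : rn (cexp z - 1) <= rn z * expR (rn z).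
Proof.
have h1 := rn_cexp_sub z; have := rn_sub_le (cexp z - 1) z.
have := ler_wpM2r (ltW (expR_gt0 (rn z))) (expR_ge1Dx (- rn z)).
rewrite -expRD addNr expR0; lra.
Qed.

Lemma rn_imag t : rn (0 +i* t) = `|t|.
Proof.
by apply/eqP; rewrite -(@eqrXn2 _ 2) ?rn_ge0 // rn_sqr /= expr0n add0r real_normK ?num_real.
Qed.

Lemma rn_phase_sub1 t : rn (phase t - 1) <= `|t| * expR `|t|.
Proof. by rewrite -rn_imag; exact: rn_cexp_sub1. Qed.

Lemma phase_small (e : R) : 0 < e ->
  exists2 delta, 0 < delta & forall t, `|t| <= delta -> rn (phase t - 1) <= e.
Proof.
move=> e0; have E0 := expR_gt0 (1 : R).
exists (Num.min 1 (e / expR 1)) => [|t]; first by rewrite lt_min ltr01 divr_gt0.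
rewrite le_min => /andP[t1 te]; apply: le_trans (rn_phase_sub1 t) _.
rewrite ler_pdivlMr // in te; apply: le_trans te.
by rewrite ler_wpM2l // ler_expR.
Qed.

Lemma phase_scaled_inj s s' :
  (forall t : R, 0 < t -> t <= 1 -> phase (t * s) = phase (t * s')) -> s = s'.
Proof.
move=> h; suff : (0 +i* s : R[i]) = 0 +i* s' by case.
apply: cexp_scaled_inj => t t0 t1; have := h t t0 t1; rewrite /phase.
have e1 (r : R) : t%:C * (0 +i* r) = 0 +i* (t * r) by apply: complex_eqP => /=; ring.
by rewrite !e1.
Qed.

Lemma unit_phase (z : R[i]) : rn z = 1 -> 0 < complex.Re z ->
  exists2 t, `|t| < pi / 2 & z = phase t.
Proof.
move=> z1 z0.
have h : complex.Re z ^+ 2 + complex.Im z ^+ 2 = 1 by rewrite -rn_sqr z1 expr1n.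
have im2 : complex.Im z ^+ 2 < 1.
  by have := exprn_gt0 2 z0; lra.
have im1 : `|complex.Im z| < 1.
  by rewrite -(@ltr_pXn2r _ 2) ?nnegrE // expr1n real_normK ?num_real.
move: im1; rewrite ltr_norml => /andP[i1 i2].
have i12 : -1 <= complex.Im z <= 1 by rewrite !ltW.
exists (asin (complex.Im z)).
  by rewrite ltr_norml asin_gtNpi2 ?asin_ltpi2 ?i1 ?(ltW i1) ?(ltW i2) ?i2.
rewrite phaseE asinK ?in_itv //= cos_asin //.
apply: complex_eqP => //=.
have -> : 1 - complex.Im z ^+ 2 = complex.Re z ^+ 2 by lra.
by rewrite sqrtr_sqr gtr0_norm.
Qed.

(** On [[0, delta]] the real part of [f] is positive, so only one of the two square roots is
    admissible and [f (delta / 2^n) = phase (phi / 2^n)] for all [n]. This settles dyadic multiples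
    of [delta]; continuity at 0 does the rest. *)
Lemma one_parameter_phase (f : R -> R[i]) :
  (forall s t, 0 <= s -> 0 <= t -> f (s + t) = f s * f t) ->
  (forall t, 0 <= t -> rn (f t) = 1) ->
  (forall e : R, 0 < e -> exists2 delta, 0 < delta &
     forall t, 0 <= t -> t <= delta -> rn (f t - 1) <= e) ->
  exists theta, forall t, 0 <= t -> f t = phase (theta * t).
Proof.
move=> fD f1 fc.
have fMn t n : 0 <= t -> f (n%:R * t) = f t ^+ n.
  move=> t0; elim: n => [|n IH].
    rewrite mul0r expr0; have := fD 0 0 (lexx _) (lexx _); rewrite addr0 => h.
    have f00 : f 0 != 0.
      by apply/eqP => f00; have := f1 0 (lexx _); rewrite f00 rn0 => /eqP; rewrite eq_sym oner_eq0.
    by apply: (mulfI f00); rewrite -h mulr1.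
  by rewrite mulrS mulrDl mul1r fD ?IH ?exprS // mulr_ge0.
have h2 : 0 < 2^-1 :> R by rewrite invr_gt0.
have [delta d0 hd] := fc _ h2.
have Re0 t : 0 <= t -> t <= delta -> 0 < complex.Re (f t).
  move=> t0 td; have := le_trans (Re_le_rn _) (hd t t0 td).
  rewrite cReB /= ler_norml => /andP[]; lra.
have [phi phi2 fphi] := unit_phase (f1 _ (ltW d0)) (Re0 _ (ltW d0) (lexx _)).
have p2 n : 0 < 2 ^+ n :> R by rewrite exprn_gt0.
have dy n : f (delta / 2 ^+ n) = phase (phi / 2 ^+ n).
  elim: n => [|n IH]; first by rewrite expr0 !divr1.
  set t := delta / 2 ^+ n.+1; set p := phi / 2 ^+ n.+1.
  have tn : 2%:R * t = delta / 2 ^+ n by rewrite /t exprS; field; rewrite gt_eqF.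
  have pn : 2%:R * p = phi / 2 ^+ n by rewrite /p exprS; field; rewrite gt_eqF.
  have t0 : 0 <= t by rewrite divr_ge0 ?ltW.
  have td : t <= delta.
    rewrite ler_pdivrMr // ler_peMr ?(ltW d0) // exprn_ege1 // ler1n //.
  have : f t ^+ 2 = phase p ^+ 2 by rewrite -fMn // tn IH phaseX pn.
  move=> /eqP; rewrite eqf_sqr => /orP[/eqP //|/eqP ft].
  have := Re0 t t0 td; rewrite ft cReN phaseE /= oppr_gt0 => cp.
  have : 0 < cos p.
    have pp : `|p| < pi / 2.
      apply: le_lt_trans phi2; rewrite normrM normfV (ger0_norm (ltW (p2 _))).
      by rewrite ler_pdivrMr // ler_peMr // exprn_ege1 // ler1n.
    by apply: cos_gt0_pihalf; rewrite -ltr_norml.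
  by move=> /lt_trans /(_ cp); rewrite ltxx.
exists (phi / delta) => t t0; apply/eqP; rewrite -subr_eq0; apply/eqP/rn_le_eps => e e0.
have e2 : 0 < e / 2 by lra.
have [d1 d10 h1] := fc _ e2; have [d2' d20' h2'] := phase_small e2.
have pd : 0 < `|phi / delta| + 1 by rewrite ltr_wpDl.
pose d2 := d2' / (`|phi / delta| + 1).
have d20 : 0 < d2 by rewrite divr_gt0.
have dd : 0 < Num.min d1 d2 / delta by rewrite divr_gt0 // lt_min d10.
have [N hN] := natSinv_small dd.
have N2 : (2 ^+ N)^-1 * delta <= Num.min d1 d2.
  rewrite -ler_pdivlMr //; apply: le_trans (hN N (leqnn _)).
  by rewrite lef_pV2 ?posrE ?ltr0n // -natrX ler_nat ltn_expl.
pose h := delta / 2 ^+ N; have h0 : 0 < h by rewrite divr_gt0.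
(* [k * h] is the dyadic point just below [t]. Both sides agree there, and the remainder [r <= h] is
   covered by both continuity estimates at 0. *)
pose k := Num.truncn (t / h).
have th0 : 0 <= t / h by rewrite divr_ge0 // ltW.
have /andP[k1 k2] := truncn_itv th0.
pose r := t - k%:R * h.
have r0 : 0 <= r by rewrite subr_ge0 -ler_pdivlMr.
have rh : r <= h.
  rewrite /r lerBlDl; move: k2; rewrite -/k ltr_pdivrMr // => /ltW.
  by rewrite mulrS mulrDl mul1r addrC.
have rd : r <= d1 /\ r <= d2.
  have := le_trans rh (le_trans (_ : h <= _) N2); rewrite /h mulrC => /(_ (lexx _)).
  by rewrite le_min => /andP[].
have tE : t = k%:R * h + r by rewrite /r addrC subrK.
have -> : f t = phase (phi / delta * (k%:R * h)) * f r.
  have kh0 : 0 <= k%:R * h by rewrite mulr_ge0 // ltW.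
  rewrite {1}tE (fD _ _ kh0 r0) (fMn _ _ (ltW h0)) dy phaseX; congr (phase _ * _).
  by rewrite /h; field; rewrite !gt_eqF.
have -> : phase (phi / delta * t) = phase (phi / delta * (k%:R * h)) * phase (phi / delta * r).
  by rewrite {1}tE mulrDr phaseD.
rewrite -mulrBr rnM rn_phase mul1r.
apply: le_trans (rn_dist_triangle _ 1 _) _.
have a1 := h1 r r0 rd.1.
have a2 : rn (phase (phi / delta * r) - 1) <= e / 2.
  apply: h2'; rewrite normrM (ger0_norm r0).
  apply: (@le_trans _ _ ((`|phi / delta| + 1) * r)); first by rewrite ler_wpM2r // lerDl.
  by rewrite mulrC -ler_pdivlMr // rd.2.
rewrite (rnB 1); lra.
Qed.

End phases.

Section characters.
Context {R : realType} {d : nat} {P : set 'rV[R]_d}.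
Hypotheses (Pc : convex_cone P) (sP : spanning P).

Lemma dotvDr (l x y : 'rV[R]_d) : dotv l (x + y) = dotv l x + dotv l y.
Proof. by rewrite /dotv -big_split; apply: eq_bigr => i _; rewrite mxE mulrDr. Qed.

Lemma dotvZr (l : 'rV[R]_d) (t : R) x : dotv l (t *: x) = t * dotv l x.
Proof. by rewrite /dotv mulr_sumr; apply: eq_bigr => i _; rewrite mxE mulrCA. Qed.

Lemma dotvBl (l m x : 'rV[R]_d) : dotv (l - m) x = dotv l x - dotv m x.
Proof. by rewrite /dotv -sumrB; apply: eq_bigr => i _; rewrite !mxE mulrBl. Qed.

Lemma spanning_basis : exists p q : 'I_d -> 'rV[R]_d, forall i,
  [/\ P (p i), P (q i) & delta_mx 0 i = p i - q i].
Proof.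
have /choice[p hp] : forall i : 'I_d, exists pq : 'rV[R]_d * 'rV[R]_d,
    [/\ P pq.1, P pq.2 & delta_mx 0 i = pq.1 - pq.2].
  move=> i; have : [set x - y | x in P & y in P] (delta_mx 0 i) by rewrite sP.
  by move=> [x Px [y Py xy]]; exists (x, y).
by exists (fun i => (p i).1), (fun i => (p i).2).
Qed.

(** The candidate [l_i] is [theta p_i - theta q_i]. Splitting each [x_i] into positive and negative
    part turns [x = sum x_i (p_i - q_i)] into the equality [key] between sums of elements of [P], to
    which [theta] applies. *)
Lemma cone_additive_linear (theta : 'rV[R]_d -> R) :
  (forall x y, P x -> P y -> theta (x + y) = theta x + theta y) ->
  (forall (t : R) x, 0 <= t -> P x -> theta (t *: x) = t * theta x) ->
  exists l, forall x, P x -> theta x = dotv l x.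
Proof.
move=> tD tZ; have [p [q pq]] := spanning_basis.
exists (\row_i (theta (p i) - theta (q i))) => x Px.
have tsum (f : 'I_d -> 'rV[R]_d) : (forall i, P (f i)) -> theta (\sum_i f i) = \sum_i theta (f i).
  move=> Pf; suff [] : P (\sum_i f i) /\ theta (\sum_i f i) = \sum_i theta (f i) by [].
  elim/big_rec2: _ => [|i y1 y2 _ [Py <-]].
    split; first exact: (cone0 Pc).
    by have := tZ 0 x (lexx _) Px; rewrite scale0r mul0r.
  by split; [exact: (coneD Pc)|rewrite tD].
pose xp i := Num.max (x 0 i) 0; pose xn i := Num.max (- x 0 i) 0.
have xp0 i : 0 <= xp i by rewrite le_max lexx orbT.
have xn0 i : 0 <= xn i by rewrite le_max lexx orbT.
have xpn i : xp i - xn i = x 0 i.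
  by rewrite /xp /xn; case: (leP (x 0 i) 0) => h; case: (leP (- x 0 i) 0) => h'; lra.
have PA i : P (xn i *: p i + xp i *: q i).
  by have [? ? _] := pq i; exact: Pc.2.
have PB i : P (xp i *: p i + xn i *: q i).
  by have [? ? _] := pq i; exact: Pc.2.
have key : x + \sum_i (xn i *: p i + xp i *: q i) = \sum_i (xp i *: p i + xn i *: q i).
  rewrite {1}(row_sum_delta x) -big_split /=; apply: eq_bigr => i _.
  have [_ _ ->] := pq i; rewrite -{1}(xpn i) scalerBr !scalerBl.
  rewrite opprB addrA [in LHS]addrC !addrA.
  by rewrite addrAC; apply/rowP => j; rewrite !mxE; ring.
have := congr1 theta key; rewrite tD //; last exact: (cone_sum Pc).
rewrite !tsum // => /eqP; rewrite -subr_eq0 => /eqP h.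
apply/eqP; rewrite -subr_eq0; apply/eqP; rewrite -[RHS]h.
rewrite -!addrA; congr (_ + _); rewrite -sumrB -[LHS]sumrN; apply: eq_bigr => i _.
have [Pp Pq _] := pq i.
rewrite !tD ?tZ //; try exact: (coneZ Pc).
by rewrite mxE -{1}(xpn i); ring.
Qed.

(** On each ray [one_parameter_phase] gives a real exponent [theta x]. Its additivity and
    homogeneity come from the phases at all [t x], a single phase being ambiguous modulo [2 pi]. *)
Lemma cone_character (c : 'rV[R]_d -> R[i]) :
  (forall x y, P x -> P y -> c (x + y) = c x * c y) ->
  (forall x, P x -> rn (c x) = 1) ->
  (forall e : R, 0 < e -> exists2 delta, 0 < delta &
     forall x, P x -> `|x| <= delta -> rn (c x - 1) <= e) ->
  exists l, forall x, P x -> c x = phase (dotv l x).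
Proof.
move=> cD c1 cc.
have /choice[theta ht] : forall x, exists th, P x -> forall t, 0 <= t -> c (t *: x) = phase (th * t).
  move=> x; have [Px|nPx] := pselect (P x); last by exists 0.
  have [s t s0 t0|t t0|e e0|th hth] := @one_parameter_phase _ (fun t => c (t *: x)).
  - by rewrite scalerDl cD //; exact: (coneZ Pc).
  - by apply: c1; exact: (coneZ Pc).
  - have [delta d0 hd] := cc e e0; have nx : 0 < `|x| + 1 by rewrite ltr_wpDl.
    exists (delta / (`|x| + 1)) => [|t t0 td]; first by rewrite divr_gt0.
    apply: hd; first exact: (coneZ Pc).
    rewrite normrZ ger0_norm //; rewrite ler_pdivlMr // in td; apply: le_trans td.
    by rewrite ler_wpM2l // lerDl.
  by exists th.
have [|t x t0 Px|l hl] := @cone_additive_linear theta.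
- move=> x y Px Py; apply: phase_scaled_inj => t t0 t1.
  have tt := ltW t0.
  rewrite mulrC -ht //; last exact: (coneD Pc).
  rewrite scalerDr cD ?ht //; try exact: (coneZ Pc).
  by rewrite -phaseD -mulrDl mulrC.
- apply: phase_scaled_inj => s s0 s1; have ss := ltW s0.
  rewrite mulrC -ht //; last exact: (coneZ Pc).
  by rewrite scalerA ht ?mulr_ge0 //; congr phase; ring.
by exists l => x Px; rewrite -hl // -[x in LHS]scale1r ht // mulr1.
Qed.

End characters.

(** * Square-integrable functions on a module *)

Section borel_sets.
Context {R : realType}.

Lemma open_borel (T : ptopologicalType) (U : set T) :
  open U -> measurable (U : set (borel T)).
Proof. by move=> oU; exact: sub_sigma_algebra. Qed.

Lemma closed_borel (T : ptopologicalType) (U : set T) :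
  closed U -> measurable (U : set (borel T)).
Proof.
by move=> cU; rewrite -[U]setCK; apply: measurableC; apply: open_borel; exact: closed_openC.
Qed.

Lemma continuous_borel (T S : ptopologicalType) (f : T -> S) : continuous f ->
  measurable_fun setT (f : borel T -> borel S).
Proof.
move=> /continuousP cf; apply: (@measurability _ _ (borel T) (borel S) setT f (@open S)) => //.
by move=> _ [U oU <-]; rewrite setTI; apply: open_borel; exact: cf.
Qed.

Lemma continuous_borel_real (T : ptopologicalType) (f : T -> R) : continuous f ->
  measurable_fun setT (f : borel T -> R).
Proof.
move=> /continuousP cf; apply: (measurability _ (measurable_realfun.RGenOpens.measurableE R)).
move=> _ [_ [a [b ->] <-]]; rewrite setTI; apply: open_borel; apply: cf.
exact: interval_open.
Qed.

End borel_sets.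

Section lebesgue_translation.
Context {R : realType} {d : nat}.
Implicit Types a b x y : 'rV[R]_d.

Definition box a b : set 'rV[R]_d := [set x | forall i, a 0 i < x 0 i <= b 0 i].

Definition boxes : set (set (borel 'rV[R]_d)) :=
  [set B | exists a b, (forall i, a 0 i <= b 0 i) /\ box a b = B].

Lemma box_measurable a b : measurable (box a b : set (borel 'rV[R]_d)).
Proof.
have -> : box a b = \bigcap_(i in [set: 'I_d])
    ([set x : 'rV[R]_d | a 0 i < x 0 i] `&` [set x | x 0 i <= b 0 i]).
  by apply/seteqP; split=> x /= h i => [_|]; [have /andP[] := h i|apply/andP; exact: h].
have fin : finite_set [set: 'I_d] by exact: finite_finset.
apply: fin_bigcap_measurable => // i _; apply: measurableI.
  apply: open_borel; move/continuousP: (@coord_continuous R 1 d 0 i).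
  exact: (fun h => h [set r | a 0 i < r] (@open_gt _ _)).
apply: closed_borel; move/continuous_closedP: (@coord_continuous R 1 d 0 i).
exact: (fun h => h [set r | r <= b 0 i] (@closed_le _ _)).
Qed.

Lemma boxes_setI : setI_closed boxes.
Proof.
move=> _ _ [a [b [ab <-]]] [a' [b' [ab' <-]]].
pose m := \row_i Num.max (a 0 i) (a' 0 i); pose M := \row_i Num.min (b 0 i) (b' 0 i).
have mM : box a b `&` box a' b' = box m M.
  apply/seteqP; split=> x /=.
    by move=> [h h'] i; rewrite !mxE gt_max le_min; have /andP[-> ->] := h i; have /andP[-> ->] := h' i.
  move=> h; split=> i; have := h i;
    by rewrite !mxE gt_max le_min => /andP[/andP[h1 h2] /andP[h3 h4]]; apply/andP.
rewrite mM.
have [h|/existsNP[i /negP]] := pselect (forall i, m 0 i <= M 0 i).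
  by exists m, M.
(* An empty intersection is still a box, the degenerate one from [m] to [m]. *)
rewrite -ltNge => hi; exists m, m; split => //.
apply/seteqP; split=> x /= h; have := h i.
  by move=> /andP[h1 h2]; have := lt_le_trans h1 h2; rewrite ltxx.
by move=> /andP[h1 h2]; have := lt_le_trans h1 (le_trans h2 (ltW hi)); rewrite ltxx.
Qed.

Lemma boxes_generate : @measurable _ (borel 'rV[R]_d) = <<s boxes >>.
Proof.
apply/seteqP; split; last first.
  apply: smallest_sub; first exact: sigma_algebra_measurable.
  by move=> _ [a [b [_ <-]]]; exact: box_measurable.
apply: smallest_sub; first exact: smallest_sigma_algebra.
move=> U oU.
pose I := ('rV[rat]_d * 'rV[rat]_d)%type.
pose r (q : 'rV[rat]_d) : 'rV[R]_d := map_mx ratr q.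
pose good (ab : I) := (forall i, r ab.1 0 i <= r ab.2 0 i) /\ box (r ab.1) (r ab.2) `<=` U.
pose B (ab : I) : set (g_sigma_algebraType boxes) :=
  if pselect (good ab) then box (r ab.1) (r ab.2) else set0.
suff -> : U = \bigcup_ab B ab.
  suff : @measurable _ (g_sigma_algebraType boxes) (\bigcup_ab B ab) by [].
  apply: countable_bigcupT_measurable; first exact: countableP.
  move=> ab; rewrite /B; case: pselect => [h|h]; last exact: measurable0.
  have [h' _] := h.
  by apply: sub_sigma_algebra; exists (r ab.1), (r ab.2).
apply/seteqP; split=> x; last first.
  by move=> [ab _]; rewrite /B; case: pselect => // -[_ h] /h.
move=> Ux; have /nbhs_ballP[e /= e0 hU] : nbhs x U by apply: open_nbhs_nbhs.
have e2 : 0 < e / 2 by rewrite divr_gt0.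
have /choice[p hp] : forall i, exists q : rat, ratr q \in `](x 0 i - e / 2), (x 0 i)[.
  by move=> i; apply: rat_in_itvoo; rewrite ltrBlDr ltrDl.
have /choice[q hq] : forall i, exists q : rat, ratr q \in `](x 0 i), (x 0 i + e / 2)[.
  by move=> i; apply: rat_in_itvoo; rewrite ltrDl.
have ph i : x 0 i - e / 2 < ratr (p i) < x 0 i by have := hp i; rewrite in_itv.
have qh i : x 0 i < ratr (q i) < x 0 i + e / 2 by have := hq i; rewrite in_itv.
exists (\row_i p i, \row_i q i) => //; rewrite /B.
case: pselect => [_|[]] /=.
  move=> i; rewrite !mxE; have /andP[_ ->] := ph i.
  by have /andP[/ltW -> _] := qh i.
split=> [i|y hy] /=.
  rewrite !mxE; have /andP[_ h1] := ph i; have /andP[h2 _] := qh i.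
  exact: ltW (lt_trans h1 h2).
apply: hU; rewrite -ball_normE /ball_ /=.
apply: le_lt_trans (_ : e / 2 < e); last by rewrite ltr_pdivrMr // ltr_pMr // ltr1n.
apply: norm_coord_le; first exact: ltW.
move=> i; have := hy i; rewrite !mxE => /andP[h1 h2].
have /andP[h3 _] := ph i; have /andP[_ h4] := qh i.
rewrite ler_norml; apply/andP; split; lra.
Qed.

Variable mu : {measure set (borel 'rV[R]_d) -> \bar R}.
Hypothesis lmu : is_lebesgue mu.

Definition shiftv x (y : borel 'rV[R]_d) : borel 'rV[R]_d := (y : 'rV[R]_d) - x.

Lemma shiftv_measurable x : measurable_fun setT (shiftv x).
Proof.
apply: continuous_borel => y.
exact: (cvgB cvg_id (cvg_cst x)).
Qed.

(** [is_lebesgue] fixes [mu] on boxes. The image measure agrees with it there, and boxes are stable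
    under intersection, generate the Borel sets and exhaust the space by sets of finite measure. *)
Lemma mu_translate x (B : set (borel 'rV[R]_d)) : measurable B ->
  mu (shiftv x @^-1` B) = mu B.
Proof.
pose m2 : {measure set (borel 'rV[R]_d) -> \bar R} :=
  measure_function_pushforward__canonical__measure_function_Measure mu
    (shiftv_measurable x).
move=> mB; rewrite -[LHS]/(m2 B); apply/esym.
pose g (n : nat) : set (borel 'rV[R]_d) := box (const_mx (- n%:R)) (const_mx n%:R).
apply: (@measure_unique _ _ _ boxes g boxes_generate boxes_setI) => //.
- move=> n; exists (const_mx (- n%:R)), (const_mx n%:R); split => // i.
  rewrite !mxE; have : 0 <= n%:R :> R by []; lra.
- apply/seteqP; split => // y _.
  exists (Num.truncn `|y : 'rV[R]_d|).+1 => // i; rewrite !mxE.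
  have /andP[_ h] := truncn_itv (normr_ge0 (y : 'rV[R]_d)).
  have := le_lt_trans (coord_norm_le (y : 'rV[R]_d) i) h.
  by rewrite ltr_norml => /andP[-> /ltW].
- move=> _ [a [b [ab <-]]].
  rewrite /m2 /= /pushforward.
  have -> : shiftv x @^-1` box a b = box (a + x) (b + x).
    apply/seteqP; split=> y /= h i; have := h i; rewrite /shiftv !mxE;
      by move=> /andP[h1 h2]; apply/andP; split; lra.
  rewrite !lmu //; first by congr (_ %:E); apply: eq_bigr => i _; rewrite !mxE; ring.
  by move=> i; rewrite !mxE lerD2r.
- move=> n; rewrite lmu ?ltry // => i; rewrite !mxE.
  by have : 0 <= n%:R :> R by []; lra.
Qed.

Lemma ge0_integral_translate x (D : set (borel 'rV[R]_d)) (f : borel 'rV[R]_d -> \bar R) :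
  measurable D -> measurable_fun D f -> (forall y, (0 <= f y)%E) ->
  (\int[mu]_(y in shiftv x @^-1` D) f (shiftv x y) = \int[mu]_(y in D) f y)%E.
Proof.
move=> mD mf f0.
rewrite -(@ge0_integral_pushforward _ _ _ _ _ (shiftv x) (shiftv_measurable x)) //.
apply: (@eq_measure_integral _ _ _ _ mu
  (measure_function_pushforward__canonical__measure_function_Measure mu
     (shiftv_measurable x))).
by move=> B mB _; exact: mu_translate.
Qed.

End lebesgue_translation.

Section cut_functions.
Context {R : realType} {d : nat} {K : hilbertType R}.
Variables (mu : {measure set (borel 'rV[R]_d) -> \bar R}) (A : set 'rV[R]_d).
Hypothesis mA : measurable (A : set (borel 'rV[R]_d)).
Implicit Types (f g : 'rV[R]_d -> K) (B C D : set (borel 'rV[R]_d)).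

Local Notation meas D f :=
  (measurable_fun (D : set (borel 'rV[R]_d)) (f : borel 'rV[R]_d -> borel K)).
Local Notation si := (square_integrable mu A).

Definition cutoff (B : set 'rV[R]_d) f y : K := if y \in B then f y else 0.

Definition sqr_norm f (y : borel 'rV[R]_d) : \bar R := (rn (f y) ^+ 2)%:E.

Lemma sqr_norm_ge0 f y : (0 <= sqr_norm f y)%E.
Proof. by rewrite lee_fin sqr_ge0. Qed.

Lemma rn_continuous : continuous (fun v : K => rn v).
Proof.
move=> u; apply/cvgrPdist_le => e e0.
have e0' : 0 < e%:C by rewrite ltr_ReC.
near=> v; have le : rn (u - v) <= e.
  by rewrite -ler_ReC -normE; near: v; apply: cvgr_dist_le e0'; exact: cvg_id.
apply: le_trans le; rewrite ler_norml; have := rn_sub_le u v; have := rn_sub_le v u.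
by rewrite (rnB v u) => h1 h2; apply/andP; split; lra.
Unshelve. all: by end_near. Qed.

Lemma sqr_norm_measurable D f : meas D f -> measurable_fun D (sqr_norm f).
Proof.
move=> mf; apply/measurable_EFinP; apply: measurable_funX.
exact: (measurableT_comp (continuous_borel_real rn_continuous) mf).
Qed.

Lemma glue_measurable B f g : measurable B -> meas A f -> meas A g ->
  meas A (fun y => if y \in B then f y else g y).
Proof.
move=> mB mf mg _ Y mY.
rewrite (_ : _ `&` _ = (B `&` (A `&` f @^-1` Y)) `|` (~` B `&` (A `&` g @^-1` Y))).
  apply: measurableU; apply: measurableI => //; [exact: mf|exact: measurableC|exact: mg].
apply/seteqP; split=> y /=.
  by case: ifPn; [move=> /set_mem|move=> /negP; rewrite in_setE] => h [Ay Yy]; [left|right].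
by move=> [[By [Ay Yy]]|[By [Ay Yy]]]; [rewrite mem_set|rewrite memNset].
Qed.

Lemma scale_measurable (c : R[i]) f : meas A f -> meas A (fun y => c *: f y).
Proof.
have h : continuous (fun v : K => c *: v).
  by move=> v; apply: cvgZl_tmp; exact: cvg_id.
by move=> mf; exact: (measurableT_comp (continuous_borel h) mf).
Qed.

Lemma cutoff_measurable B f : measurable B -> meas A f -> meas A (cutoff B f).
Proof. by move=> mB mf; apply: glue_measurable => //; exact: measurable_cst. Qed.

Lemma L2_integral_le f g : meas A f -> meas A g ->
  (forall y, A y -> rn (f y) <= rn (g y)) -> (L2_integral mu A f <= L2_integral mu A g)%E.
Proof.
move=> mf mg fg; apply: (@ge0_le_integral _ _ _ mu A mA (sqr_norm f) (sqr_norm g)) => //.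
- by move=> y _; exact: sqr_norm_ge0.
- exact: sqr_norm_measurable.
- exact: sqr_norm_measurable.
- move=> y /fg h; rewrite lee_fin.
  by rewrite ler_pXn2r ?nnegrE ?rn_ge0.
Qed.

Lemma L2_integral_eq f g : (forall y, A y -> rn (f y) = rn (g y)) ->
  L2_integral mu A f = L2_integral mu A g.
Proof.
by move=> fg; apply: eq_integral => y /set_mem /fg; rewrite /rn => ->.
Qed.

Lemma cutoff_si B f : measurable B -> si f -> si (cutoff B f).
Proof.
move=> mB [mf If]; split; first exact: cutoff_measurable.
apply: le_lt_trans If; apply: L2_integral_le => //; first exact: cutoff_measurable.
by move=> y _; rewrite /cutoff; case: ifP => // _; rewrite rn0 rn_ge0.
Qed.

Lemma scale_si (c : R[i]) f : si f -> si (fun y => c *: f y).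
Proof.
move=> [mf If]; split; first exact: scale_measurable.
have -> : L2_integral mu A (fun y => c *: f y) =
    (\int[mu]_(y in (A : set (borel 'rV[R]_d))) ((rn c ^+ 2)%:E * sqr_norm f y))%E.
  by apply: eq_integral => y _; rewrite -/(rn _) rnZ exprMn EFinM.
rewrite ge0_integralZl //; last 3 first.
- exact: sqr_norm_measurable.
- by move=> y _; exact: sqr_norm_ge0.
- by rewrite lee_fin sqr_ge0.
by rewrite lte_mul_pinfty // lee_fin sqr_ge0.
Qed.

Lemma si_ext f g : si f -> (forall y, A y -> f y = g y) -> si g.
Proof.
move=> [mf If] fg; split.
  by apply: eq_measurable_fun mf => y /set_mem /fg.
by rewrite -(@L2_integral_eq f g) // => y /fg ->.
Qed.

Lemma zero_si : si (fun=> 0 : K).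
Proof.
split; first exact: measurable_cst.
rewrite /L2_integral (eq_integral (cst 0%E)) ?integral0 ?ltry // => y _ /=.
by rewrite normr0 /= expr0n.
Qed.

(** A sum of functions with complementary supports is a case distinction, so its measurability comes
    from [glue_measurable], not from addition in [K]. *)
Lemma glue_si B f g : measurable B -> si f -> si g ->
  si (fun y => cutoff B f y + cutoff (~` B) g y).
Proof.
move=> mB sf sg; have [mf If] := cutoff_si mB sf; have [mg Ig] := cutoff_si (measurableC mB) sg.
have E y : cutoff B f y + cutoff (~` B) g y = if y \in B then f y else g y.
  rewrite /cutoff; case: ifPn => [/set_mem h|/negP h].
    by rewrite memNset ?addr0 //; apply.
  by rewrite mem_set ?add0r // => /mem_set.
split.
  have -> : (fun y => cutoff B f y + cutoff (~` B) g y) = (fun y => if y \in B then f y else g y).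
    exact/funext.
  by apply: glue_measurable; [|case: sf|case: sg].
rewrite /L2_integral.
rewrite (eq_integral (fun y => sqr_norm (cutoff B f) y + sqr_norm (cutoff (~` B) g) y)%E); last first.
  move=> y _; rewrite -/(rn _) /sqr_norm -EFinD /cutoff in_setC; case: ifP => _ /=.
    by rewrite addr0 rn0 expr0n addr0.
  by rewrite add0r rn0 expr0n add0r.
rewrite ge0_integralD //; first exact: lte_add_pinfty.
- by move=> y _; exact: sqr_norm_ge0.
- exact: sqr_norm_measurable.
- by move=> y _; exact: sqr_norm_ge0.
- exact: sqr_norm_measurable.
Qed.

Lemma L2_integral_glue B f g : measurable B -> si f -> si g ->
  L2_integral mu A (fun y => cutoff B f y + cutoff (~` B) g y) =
  (L2_integral mu A (cutoff B f) + L2_integral mu A (cutoff (~` B) g))%E.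
Proof.
move=> mB sf sg; have [mf _] := cutoff_si mB sf; have [mg _] := cutoff_si (measurableC mB) sg.
rewrite -ge0_integralD //.
- apply: eq_integral => y _; rewrite -!/(rn _) /sqr_norm -EFinD /cutoff in_setC; case: ifP => _ /=.
    by rewrite addr0 rn0 expr0n addr0.
  by rewrite add0r rn0 expr0n add0r.
- by move=> y _; exact: sqr_norm_ge0.
- exact: sqr_norm_measurable.
- by move=> y _; exact: sqr_norm_ge0.
- exact: sqr_norm_measurable.
Qed.

End cut_functions.

(** * Multiplication by indicator functions on [L^2(A, K)] *)

Section spectral_projections.
Context {R : realType} {d : nat} {K : hilbertType R}.
Variables (mu : {measure set (borel 'rV[R]_d) -> \bar R}) (A : set 'rV[R]_d).
Hypothesis mA : measurable (A : set (borel 'rV[R]_d)).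
Variable L : L2_space mu A K.
Implicit Types (f g : 'rV[R]_d -> K) (B C D : set (borel 'rV[R]_d)) (u v : L).

Local Notation si := (square_integrable mu A).
Local Notation cls := (L2_class L).

Lemma rn_cls f : si f -> (rn (cls f) ^+ 2)%:E = L2_integral mu A f.
Proof. exact: L2_class_norm. Qed.

Lemma rn_cls_eq f g : si f -> si g -> L2_integral mu A f = L2_integral mu A g ->
  rn (cls f) = rn (cls g).
Proof.
move=> sf sg fg; have : rn (cls f) ^+ 2 = rn (cls g) ^+ 2.
  by apply/EFin_inj; rewrite !rn_cls.
by move/eqP; rewrite eqrXn2 ?rn_ge0 // => /eqP.
Qed.

Lemma clsD f g : si f -> si g -> cls (fun y => f y + g y) = cls f + cls g.
Proof.
move=> sf sg; rewrite -[cls f]scale1r -L2_class_linear //; congr (cls _).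
by apply/funext => y; rewrite scale1r.
Qed.

Lemma cls0 : cls (fun=> 0) = 0.
Proof.
have /esym/eqP := clsD (zero_si mu A) (zero_si mu A).
rewrite (_ : (fun y => _) = (fun=> 0)); last by apply/funext => y; rewrite addr0.
by rewrite -subr_eq0 addrK => /eqP.
Qed.

Lemma clsZ (c : R[i]) f : si f -> cls (fun y => c *: f y) = c *: cls f.
Proof.
move=> sf; rewrite -[RHS]addr0 -cls0 -L2_class_linear //; last exact: zero_si.
by congr (cls _); apply/funext => y; rewrite addr0.
Qed.

Lemma cls_ext f g : si f -> (forall y, A y -> f y = g y) -> cls g = cls f.
Proof.
move=> sf fg; have sg := si_ext sf fg.
apply/eqP; rewrite -subr_eq0; apply/eqP.
have sN := scale_si mA (-1) sf.
have z y : A y -> (0 : K) = g y + (-1) *: f y by move=> /fg <-; rewrite scaleN1r addrN.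
have -> : cls g - cls f = cls (fun y => g y + (-1) *: f y).
  rewrite -scaleN1r -clsZ // addrC -[cls g]scale1r addrC -L2_class_linear //.
  by congr (cls _); apply/funext => y; rewrite scale1r.
have s0 := si_ext (zero_si mu A) z.
apply: rn0_eq0; have -> : (0 : R) = rn (cls (fun=> 0)) by rewrite cls0 rn0.
apply: rn_cls_eq => //; first exact: zero_si.
by apply: L2_integral_eq => y /z <-.
Qed.

(** Squared norms add on complementary supports, so the real part vanishes; replacing [f] by [i f]
    gives the imaginary part. *)
Lemma cls_cutoff_ortho B f g : measurable B -> si f -> si g ->
  inner (cls (cutoff B f)) (cls (cutoff (~` B) g)) = 0.
Proof.
move=> mB sf sg.
have Re0 h : si h -> complex.Re (inner (cls (cutoff B h)) (cls (cutoff (~` B) g))) = 0.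
  move=> sh; have sB := cutoff_si mA mB sh; have sC := cutoff_si mA (measurableC mB) sg.
  have := rn_sqrD (cls (cutoff B h)) (cls (cutoff (~` B) g)).
  rewrite -clsD //.
  have -> : rn (cls (fun y => cutoff B h y + cutoff (~` B) g y)) ^+ 2 =
      rn (cls (cutoff B h)) ^+ 2 + rn (cls (cutoff (~` B) g)) ^+ 2.
    apply/EFin_inj; rewrite EFinD !rn_cls // ?L2_integral_glue //.
    exact: glue_si.
  by lra.
apply: complex_eqP => /=; first exact: Re0.
have := Re0 _ (scale_si mA (0 +i* 1) sf).
have -> : cutoff B (fun y => (0 +i* 1) *: f y) = (fun y => (0 +i* 1) *: cutoff B f y).
  by apply/funext => y; rewrite /cutoff; case: ifP => // _; rewrite scaler0.
rewrite clsZ; last exact: cutoff_si.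
by rewrite innerZl; case: (inner _ _) => a b /=; rewrite mul0r sub0r mulNr opprK mul1r.
Qed.

Lemma cls_cutoff_decomp B f : measurable B -> si f ->
  cls f = cls (cutoff B f) + cls (cutoff (~` B) f).
Proof.
move=> mB sf; rewrite -clsD; [|exact: cutoff_si|by apply: cutoff_si => //; exact: measurableC].
congr (cls _); apply/funext => y; rewrite /cutoff in_setC.
by case: (y \in B); rewrite /= ?addr0 ?add0r.
Qed.

(* The difference of both sides is orthogonal to itself; sums of measurable
   [K]-valued functions are avoided, as they need not be measurable without
   separability. *)
Lemma cls_cutoff_eq B f g : measurable B -> si f -> si g -> cls f = cls g ->
  cls (cutoff B f) = cls (cutoff B g).
Proof.
move=> mB sf sg; rewrite (cls_cutoff_decomp mB sf) (cls_cutoff_decomp mB sg) => E.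
apply/eqP; rewrite -subr_eq0; apply/eqP; apply: inner_eq0.
have {2}-> : cls (cutoff B f) - cls (cutoff B g) = cls (cutoff (~` B) g) - cls (cutoff (~` B) f).
  by apply/eqP; rewrite subr_eq addrAC eq_sym subr_eq addrC -E addrC.
by rewrite innerBl !innerBr !cls_cutoff_ortho // !subrr.
Qed.

Definition rfun u := projT1 (cid2 (L2_class_onto (l := L) u)).

Lemma rfun_si u : si (rfun u). Proof. by rewrite /rfun; case: cid2. Qed.

Lemma rfunK u : cls (rfun u) = u. Proof. by rewrite /rfun; case: cid2. Qed.

(** Multiplication by the indicator of [B], computed on a chosen representative; [sprojE] shows that
    for measurable [B] the choice is immaterial. *)
Definition sproj B u : L := cls (cutoff B (rfun u)).

Lemma sprojE B f : measurable B -> si f -> sproj B (cls f) = cls (cutoff B f).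
Proof. by move=> mB sf; apply: cls_cutoff_eq => //; [exact: rfun_si|exact: rfunK]. Qed.

Lemma sproj_decomp B u : measurable B -> u = sproj B u + sproj (~` B) u.
Proof. by move=> mB; rewrite -{1}[u]rfunK; apply: cls_cutoff_decomp => //; exact: rfun_si. Qed.

Lemma sproj_orthoC B u v : measurable B -> inner (sproj B u) (sproj (~` B) v) = 0.
Proof. by move=> mB; apply: cls_cutoff_ortho => //; exact: rfun_si. Qed.

Lemma sproj_comp B C u : measurable B -> measurable C -> sproj B (sproj C u) = sproj (B `&` C) u.
Proof.
move=> mB mC; rewrite -[sproj C u]/(cls (cutoff C (rfun u))) sprojE //; last by apply: cutoff_si => //; exact: rfun_si.
congr (cls _); apply/funext => y; rewrite /cutoff in_setI.
by case: (y \in B).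
Qed.

Lemma sproj_ext B C u : measurable B -> (forall y, A y -> B y <-> C y) -> sproj C u = sproj B u.
Proof.
move=> mB BC; apply: cls_ext; first by apply: cutoff_si => //; exact: rfun_si.
move=> y /BC h; rewrite /cutoff; congr (if _ then _ else _).
by apply/idP/idP => /set_mem /h /mem_set.
Qed.

Lemma sproj_full B u : A `<=` B -> sproj B u = u.
Proof.
move=> AB; rewrite -[RHS]rfunK; apply: cls_ext; first exact: rfun_si.
by move=> y /AB h; rewrite /cutoff mem_set.
Qed.

Lemma sproj_set0 u : sproj set0 u = 0.
Proof.
rewrite -cls0; congr (cls _); apply/funext => y; rewrite /cutoff memNset //.
Qed.

Lemma sproj_0 B : measurable B -> sproj B 0 = 0.
Proof.
move=> mB; rewrite -{1}cls0 sprojE //; last exact: zero_si.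
by rewrite -cls0; congr (cls _); apply/funext => y; rewrite /cutoff; case: ifP.
Qed.

(** The difference of both sides is also a combination of vectors cut off to the complement of [B],
    so it is orthogonal to itself. *)
Lemma sprojD B u v : measurable B -> sproj B (u + v) = sproj B u + sproj B v.
Proof.
move=> mB; apply/eqP; rewrite -subr_eq0; apply/eqP; apply: inner_eq0.
have {2}-> : sproj B (u + v) - (sproj B u + sproj B v) =
    (sproj (~` B) u + sproj (~` B) v) - sproj (~` B) (u + v).
  apply/eqP; rewrite subr_eq addrAC eq_sym subr_eq addrC -sproj_decomp // addrCA addrA.
  by rewrite addrA [sproj (~` B) u + sproj B u]addrC -sproj_decomp // -addrA -sproj_decomp.
by rewrite !innerBr !innerDr !innerBl !innerDl !sproj_orthoC // !(addr0, subr0).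
Qed.

Lemma rn_sproj_decomp B u : measurable B ->
  rn u ^+ 2 = rn (sproj B u) ^+ 2 + rn (sproj (~` B) u) ^+ 2.
Proof.
move=> mB; rewrite {1}[u](sproj_decomp u mB) rn_pythagoras //; exact: sproj_orthoC.
Qed.

Lemma inner_sproj B u v : measurable B -> inner (sproj B u) v = inner u (sproj B v).
Proof.
move=> mB; rewrite {1}[v](sproj_decomp v mB) {2}[u](sproj_decomp u mB) innerDr innerDl.
by rewrite sproj_orthoC // addr0 [inner (sproj (~` B) u) _]innerJ sproj_orthoC // conjc0 addr0.
Qed.

(** Dominated convergence, with the squared norm of a representative as majorant. *)
Lemma sproj_vanish (B : nat -> set (borel 'rV[R]_d)) u :
  (forall n, measurable (B n)) ->
  (forall y, exists N, forall n, (N <= n)%N -> ~ B n y) ->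
  forall ep : R, 0 < ep -> exists N, forall n, (N <= n)%N -> rn (sproj (B n) u) <= ep.
Proof.
move=> mB Bv ep ep0.
have sB n : si (cutoff (B n) (rfun u)) by apply: cutoff_si => //; exact: rfun_si.
have [mf If] := rfun_si u.
have H1 : \forall x \ae mu, A x -> sqr_norm (cutoff (B n) (rfun u)) x @[n --> \oo] --> (cst 0%E x : \bar R).
  apply: aeW => y _; have [N hN] := Bv y.
  apply: (@cvg_near_cst); exists N => // n /= /hN hn.
  by rewrite /sqr_norm /cutoff memNset // rn0 expr0n.
have H2 : mu.-integrable A (sqr_norm (rfun u)).
  apply/integrableP; split; first exact: sqr_norm_measurable.
  rewrite (eq_integral (sqr_norm (rfun u))) // => y _.
  by rewrite gee0_abs // sqr_norm_ge0.
have H3 : \forall x \ae mu, forall n : nat, A x ->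
    (`|sqr_norm (cutoff (B n) (rfun u)) x| <= sqr_norm (rfun u) x)%E.
  apply: aeW => y n _; rewrite gee0_abs ?sqr_norm_ge0 // lee_fin.
  rewrite ler_pXn2r ?nnegrE ?rn_ge0 // /cutoff.
  by case: ifP => // _; rewrite rn0 rn_ge0.
have [_ _] := dominated_convergence mA (fun n => sqr_norm_measurable (sB n).1)
  (measurable_cst _) H1 H2 H3.
rewrite integral0 => cv.
have cv' : ((rn (sproj (B n) u) ^+ 2)%:E @[n --> \oo] --> (0 : R)%:E)%E.
  apply: cvg_trans cv; apply: near_eq_cvg; near=> n.
  by rewrite rn_cls.
move/fine_cvgP: cv' => [_ /cvgrPdist_le cv'].
have [N _ hN] := cv' _ (exprn_gt0 2 ep0); exists N => n Nn.
have := hN n Nn; rewrite sub0r normrN ger0_norm ?sqr_ge0 //=.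
by rewrite ler_pXn2r ?nnegrE ?rn_ge0 // ltW.
Unshelve. all: by end_near. Qed.

End spectral_projections.

Section translations.
Context {R : realType} {d : nat} {K : hilbertType R}.
Variable mu : {measure set (borel 'rV[R]_d) -> \bar R}.
Hypothesis lmu : is_lebesgue mu.
Variable A : set 'rV[R]_d.
Hypothesis mA : measurable (A : set (borel 'rV[R]_d)).
Implicit Types (f g : 'rV[R]_d -> K) (B C D : set (borel 'rV[R]_d)) (x y : 'rV[R]_d).

Local Notation si := (square_integrable mu A).
Local Notation meas D f :=
  (measurable_fun (D : set (borel 'rV[R]_d)) (f : borel 'rV[R]_d -> borel K)).

Lemma cutoff_measurableT f : meas A f -> meas setT (cutoff A f).
Proof.
move=> mf _ Y mY.
rewrite (_ : _ `&` _ = (A `&` f @^-1` Y) `|` (~` A `&` [set _ | Y 0])).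
  apply: measurableU; first exact: mf.
  apply: measurableI; first exact: measurableC.
  have [Y0|Y0] := pselect (Y 0).
    by rewrite (_ : [set _ | _] = setT) //; apply/seteqP; split.
  by rewrite (_ : [set _ | _] = set0) //; apply/seteqP; split.
rewrite /cutoff; apply/seteqP; split=> y /=.
  by case: ifPn; [move=> /set_mem|move=> /negP; rewrite in_setE] => h [_ Yy]; [left|right].
by move=> [[Ay Yy]|[Ay Yy]]; [rewrite mem_set|rewrite memNset].
Qed.

Lemma L2_integral_cutoff f :
  L2_integral mu A f = (\int[mu]_y sqr_norm (cutoff A f) y)%E.
Proof.
rewrite /L2_integral integral_mkcond; apply: eq_integral => y _.
by rewrite /patch /sqr_norm /cutoff; case: ifP => // _; rewrite rn0 expr0n.
Qed.

Lemma integral_shift f x : meas setT f ->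
  (\int[mu]_y sqr_norm (f \o shiftv x) y = \int[mu]_y sqr_norm f y)%E.
Proof.
move=> mf; rewrite -[RHS](ge0_integral_translate lmu x) //.
- exact: sqr_norm_measurable.
- by move=> y; exact: sqr_norm_ge0.
Qed.

Lemma shift_measurable f x : meas setT f -> meas A (f \o shiftv x).
Proof.
move=> mf; apply: (@measurable_funS _ _ _ _ setT) => //.
exact: (measurableT_comp mf (shiftv_measurable x)).
Qed.

Lemma L2_integral_shift_le f x : meas setT f ->
  (L2_integral mu A (f \o shiftv x) <= \int[mu]_y sqr_norm f y)%E.
Proof.
move=> mf; rewrite -(integral_shift x mf).
apply: ge0_subset_integral => //.
- exact: (sqr_norm_measurable (measurableT_comp mf (shiftv_measurable x))).
- by move=> y _; exact: sqr_norm_ge0.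
Qed.

Lemma shift_si f x : si f -> si (cutoff A f \o shiftv x).
Proof.
move=> [mf If]; have mcf := cutoff_measurableT mf.
split; first exact: shift_measurable.
by apply: le_lt_trans (L2_integral_shift_le x mcf) _; rewrite -L2_integral_cutoff.
Qed.

Lemma L2_integral_translate f x : si f -> (forall y, A y -> A (x + y)) ->
  L2_integral mu A (translate A x f) = L2_integral mu A f.
Proof.
move=> [mf If] Ax; rewrite !L2_integral_cutoff.
rewrite -[RHS](integral_shift x (cutoff_measurableT mf)).
apply: eq_integral => y _; congr ((rn _ ^+ 2)%:E); rewrite /cutoff /= /translate /shiftv.
case: ifPn => // /negP h; case: ifPn => // /set_mem h'; case: h; apply/mem_set.
by have := Ax _ h'; rewrite addrC subrK.
Qed.

End translations.

Section associated_representation.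
Context {R : realType} {d : nat} {K : hilbertType R}.
Variable mu : {measure set (borel 'rV[R]_d) -> \bar R}.
Hypothesis lmu : is_lebesgue mu.
Variables (P A : set 'rV[R]_d).
Hypotheses (Pc : convex_cone P) (PA : is_module P A).
Variables (L : L2_space mu A K) (W : 'rV[R]_d -> bop L).
Local Notation si := (square_integrable mu A).
Local Notation cls := (L2_class L).
Hypothesis repW : forall x f, P x -> si f -> W x (cls f) = cls (translate A x f).
Implicit Types (B C D : set (borel 'rV[R]_d)) (x y : 'rV[R]_d) (u v : L) (f : 'rV[R]_d -> K).

Let mA : measurable (A : set (borel 'rV[R]_d)).
Proof. by apply: closed_borel; case: PA. Qed.

Lemma module_shift x y : P x -> A y -> A (x + y).
Proof. by move=> Px Ay; rewrite addrC; case: PA => _ _ _; exact. Qed.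

Lemma module_shiftB x y : P x -> A (y - x) -> A y.
Proof. by move=> Px /(module_shift Px); rewrite addrC subrK. Qed.

Lemma translate_si x f : P x -> si f -> si (translate A x f).
Proof. by move=> Px sf; exact: (shift_si lmu mA x sf). Qed.

Lemma rn_rep x u : P x -> rn (W x u) = rn u.
Proof.
move=> Px; rewrite -{1 2}[u]rfunK repW //; last exact: rfun_si.
apply: rn_cls_eq; [exact: translate_si (rfun_si _)|exact: rfun_si|].
by apply: L2_integral_translate => //; [exact: rfun_si|move=> y; exact: module_shift].
Qed.

Lemma rep_isometric x : P x -> isometric (W x).
Proof. by move=> Px; apply: isometric1_rn => u; exact: rn_rep. Qed.

Lemma repD x y : P x -> P y -> W (x + y) = W x * W y.
Proof.
move=> Px Py; apply: bop_ext => u; rewrite bopME -[u]rfunK.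
have su := rfun_si u.
rewrite !repW //; [|exact: translate_si|exact: coneD].
congr (cls _); apply/funext => z; rewrite /translate opprD addrA.
case: (boolP (z - x - y \in A)) => [h|_]; last by case: ifP.
by rewrite ifT //; apply/mem_set; apply: module_shiftB Py _; exact: set_mem.
Qed.

Definition moved x B : set (borel 'rV[R]_d) := shiftv x @^-1` B.

Lemma moved_measurable x B : measurable B -> measurable (moved x B).
Proof. by move=> mB; rewrite -[moved _ _]setTI; exact: shiftv_measurable. Qed.

Lemma sproj_moved x B u : P x -> measurable B -> sproj (moved x B) (W x u) = W x (sproj B u).
Proof.
move=> Px mB; rewrite -{1}[u]rfunK repW //; last exact: rfun_si.
rewrite sprojE //; [|exact: moved_measurable|by apply: translate_si => //; exact: rfun_si].
rewrite /sproj repW //; last by apply: cutoff_si => //; exact: rfun_si.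
congr (cls _); apply/funext => y; rewrite /cutoff /translate /moved.
have -> : (y \in [set z : borel 'rV[R]_d | B (shiftv x z)]) = (y - x \in B).
  by apply/idP/idP => /set_mem h; apply/mem_set.
by case: (y - x \in B); case: (y - x \in A).
Qed.

Lemma sproj_moved_full x u : P x -> sproj (moved x A) (W x u) = W x u.
Proof. by move=> Px; rewrite sproj_moved // sproj_full. Qed.

Lemma sproj_moved_range x u : P x -> exists v, sproj (moved x A) u = W x v.
Proof.
move=> Px; have su := rfun_si u.
exists (cls (cutoff A (rfun u) \o shiftv (- x))).
rewrite repW //; last exact: shift_si.
apply/esym; rewrite /sproj; apply: (cls_ext mA).
  by apply: cutoff_si => //; exact: moved_measurable.
move=> y Ay; rewrite /cutoff /translate /moved /= /shiftv opprK subrK (mem_set Ay).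
have -> : (y \in [set z : borel 'rV[R]_d | A ((z : 'rV[R]_d) - x)]) = (y - x \in A).
  by apply/idP/idP => /set_mem h; apply/mem_set.
by [].
Qed.

(* So [W x * adj (W x)] is multiplication by the indicator of [A + x]. *)
Lemma rn_adj_sproj x u : P x -> rn (adj (W x) u) = rn (sproj (moved x A) u).
Proof.
move=> Px; have mM := moved_measurable x mA; apply/eqP; rewrite eq_le; apply/andP; split.
  have [->|/rn_gt0 h] := eqVneq (adj (W x) u) 0; first by rewrite rn0 rn_ge0.
  rewrite -(ler_pM2r h) -expr2 rn_inner -adjPr -[W x _]sproj_moved_full //.
  rewrite -inner_sproj //; apply: le_trans (ler_norm _) _.
  by apply: le_trans (Re_le_rn _) _; apply: le_trans (cauchy_schwarz _ _) _; rewrite rn_rep.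
have [v hv] := sproj_moved_range u Px.
have [->|/rn_gt0 h] := eqVneq (sproj (moved x A) u) 0; first by rewrite rn0 rn_ge0.
rewrite -(ler_pM2r h) -expr2 rn_inner {2}hv inner_sproj //.
rewrite sproj_moved_full // adjPr; apply: le_trans (ler_norm _) _.
apply: le_trans (Re_le_rn _) _; apply: le_trans (cauchy_schwarz _ _) _.
by rewrite hv rn_rep.
Qed.

Lemma sproj_disjoint_moved x B u : P x -> measurable B -> (forall y, B y -> ~ A (y - x)) ->
  sproj B (W x u) = 0.
Proof.
move=> Px mB BA; rewrite -sproj_moved_full // sproj_comp //; last exact: moved_measurable.
rewrite (_ : _ `&` _ = set0) ?sproj_set0 //.
by apply/seteqP; split=> y // -[/BA h /h].
Qed.

Lemma sproj_moved_vanish x B u : P x -> measurable B -> (forall y, B y -> A (y - x)) ->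
  adj (W x) u = 0 -> sproj B u = 0.
Proof.
move=> Px mB BA u0; have mM := moved_measurable x mA.
have -> : sproj B u = sproj B (sproj (moved x A) u).
  by rewrite sproj_comp //; congr (sproj _ _); rewrite setIidl.
have -> : sproj (moved x A) u = 0 by apply: rn0_eq0; rewrite -rn_adj_sproj // u0 rn0.
exact: sproj_0.
Qed.

Section interior_point.
Variables (a : 'rV[R]_d) (Pa : P a) (a1 : forall y, `|y| <= 1 -> P (a + y)).

Lemma interior_absorb y : exists N, forall n, (N <= n)%N -> P (a *+ n + y).
Proof.
exists (Num.truncn `|y|).+1 => n hn.
have n0 : 0 < n%:R :> R by rewrite ltr0n (leq_trans _ hn).
have -> : a *+ n + y = n%:R *: (a + n%:R^-1 *: y).
  by rewrite scalerDr scalerA mulfV ?gt_eqF // scale1r scaler_nat.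
apply: (coneZ Pc (ler0n _ _)).
apply: a1; rewrite normrZ ger0_norm ?invr_ge0 ?ler0n // mulrC ler_pdivrMr // mul1r.
have /andP[_ h] := truncn_itv (normr_ge0 y).
by apply: le_trans (ltW h) _; rewrite ler_nat.
Qed.

(** For [z] outside [A], eventually [n a + (z - y)] lies in [P], so [y - n a] in [A] would put [z]
    in [A]. *)
Lemma module_leave y : exists N, forall n, (N <= n)%N -> ~ A (y - a *+ n).
Proof.
have [_ /eqP AT _ Aadd] := PA.
have [z Az] : exists z, ~ A z.
  apply/existsNP => h; apply: AT; apply/seteqP; split => // z _; exact: h.
have [N hN] := interior_absorb (z - y); exists N => n /hN hP Ay; apply: Az.
have -> : z = (y - a *+ n) + (a *+ n + (z - y)) by rewrite addrA subrK addrC subrK.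
exact: Aadd.
Qed.

(** [|V_(na)^* u|] is the norm of the restriction of [u] to [A + n a], and these sets eventually
    leave every point by [module_leave]. *)
Lemma rep_pure u (ep : R) : 0 < ep ->
  exists N, forall n, (N <= n)%N -> rn (adj (W (a *+ n)) u) <= ep.
Proof.
move=> ep0.
have [N hN] := sproj_vanish mA u (fun n => moved_measurable (a *+ n) mA) module_leave ep0.
exists N => n /hN; rewrite rn_adj_sproj //; exact: coneMn.
Qed.

(** The balls with rational centres cover the space. Removing the first [n] of them leaves [u]
    unchanged, while the remaining sets [B n] eventually leave every point. *)
Lemma sproj_cover u (r : R) : 0 < r ->
  (forall q, sproj (ball (q : 'rV[R]_d) r : set (borel 'rV[R]_d)) u = 0) -> u = 0.
Proof.
move=> r0 uq.
pose q (n : nat) : 'rV[R]_d :=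
  if unpickle n is Some p then map_mx ratr (p : 'rV[rat]_d) else 0.
have mb n : measurable (ball (q n) r : set (borel 'rV[R]_d)).
  by apply: open_borel; exact: ball_open.
pose B n : set (borel 'rV[R]_d) := [set y | forall m, (m < n)%N -> ~ ball (q m) r y].
have BS n : B n.+1 = B n `&` ~` ball (q n) r.
  apply/seteqP; split=> y /=.
    by move=> h; split=> [m mn|]; apply: h => //; exact: ltnW.
  by move=> [h1 h2] m; rewrite ltnS leq_eqVlt => /orP[/eqP ->|/h1].
have mB n : measurable (B n).
  elim: n => [|n IH]; first by rewrite (_ : B 0%N = setT) //; apply/seteqP; split.
  by rewrite BS; apply: measurableI => //; exact: measurableC.
have hB n : sproj (B n) u = u.
  elim: n => [|n IH].
    by apply: sproj_full => // y _.
  rewrite BS -sproj_comp //; last exact: measurableC.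
  suff -> : sproj (~` ball (q n) r : set (borel 'rV[R]_d)) u = u by [].
  by rewrite [RHS](sproj_decomp mA u (mb n)) uq add0r.
apply: rn_le_eps => ep ep0.
have [] := sproj_vanish mA u mB _ ep0; last by move=> N /(_ N (leqnn N)); rewrite hB.
move=> y.
have /choice[p hp] : forall i, exists p : rat, ratr p \in `](y 0 i - r / 2), (y 0 i + r / 2)[.
  by move=> i; apply: rat_in_itvoo; lra.
exists (pickle (\row_i p i)).+1 => n hn /(_ _ hn); apply.
rewrite /q pickleK -ball_normE /ball_ /=.
apply: le_lt_trans (_ : r / 2 < r); last by lra.
apply: norm_coord_le; first lra.
move=> i; rewrite !mxE ler_norml; have := hp i; rewrite in_itv /= => /andP[h1 h2].
by apply/andP; split; lra.
Qed.

Lemma sproj_bessel (B : nat -> set (borel 'rV[R]_d)) n u :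
  (forall k, measurable (B k)) -> (forall k l, k != l -> [disjoint B k & B l]) ->
  \sum_(k < n) rn (sproj (B k) u) ^+ 2 <= rn u ^+ 2.
Proof.
move=> mB dB; elim: n u => [|n IH] u; first by rewrite big_ord0 sqr_ge0.
rewrite big_ord_recr /= (rn_sproj_decomp mA u (mB n)) addrC lerD2l.
apply: le_trans (IH _); apply: ler_sum => k _.
suff -> : sproj (B k) u = sproj (B k) (sproj (~` B n) u) by [].
rewrite sproj_comp //; last exact: measurableC.
congr (sproj _ _); apply/esym; rewrite setIidl // => y yk yn.
have /dB /disj_setPS h : (k : nat) != n by rewrite ltn_eqF.
exact: (h y (conj yk yn)).
Qed.

Section additive_cocycle.
Variable xi : 'rV[R]_d -> L.
Hypothesis xi_perp : forall x, P x -> adj (W x) (xi x) = 0.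
Hypothesis xiD : forall x y, P x -> P y -> xi (x + y) = xi x + W x (xi y).

(* Both norms are read off [xi (m + w + x + y)] on the common translate
   [moved y B = moved m B']. *)
Lemma cocycle_transfer B B' x y m w : P x -> P y -> P m -> P w ->
  measurable B -> measurable B' -> B `<=` A -> B' `<=` A ->
  (forall z, B' z -> ~ A (z - w)) -> moved y B = moved m B' ->
  rn (sproj B (xi x)) <= rn (sproj B' (xi w)).
Proof.
move=> Px Py Pm Pw mB mB' BA BA' Bw E.
have Pxy := coneD Pc Px Py; have Pmw := coneD Pc Pm Pw.
have Pxw := coneD Pc Px Pmw.
have mC := moved_measurable y mB; have mM := moved_measurable x mA.
have h1 : sproj (moved y B) (xi (y + (x + (m + w)))) = W y (sproj B (xi (x + (m + w)))).
  rewrite xiD // sprojD // sproj_moved //.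
  by rewrite (@sproj_moved_vanish y) ?add0r //; [move=> z /BA|exact: xi_perp].
have h2 : sproj (moved y B) (xi ((m + w) + (x + y))) = W m (sproj B' (xi w)).
  rewrite (xiD Pmw Pxy) sprojD // (@sproj_disjoint_moved (m + w)) ?addr0 //; last first.
    by rewrite E => z /Bw; rewrite /shiftv opprD addrA.
  rewrite E xiD // sprojD // ?sproj_moved //; last exact: moved_measurable.
  by rewrite (@sproj_moved_vanish m) ?add0r //; [exact: moved_measurable|move=> z /BA'|exact: xi_perp].
have xi0 : sproj (moved x A) (xi x) = 0.
  by apply: rn0_eq0; rewrite -rn_adj_sproj // xi_perp // rn0.
have h3 v : inner (sproj B (xi x)) (sproj B (W x v)) = 0.
  rewrite inner_sproj // sproj_comp // setIid -(sproj_moved_full v Px) sproj_comp // setIC -sproj_comp //.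
  by rewrite -inner_sproj // xi0 inner0l.
rewrite -(rn_rep (sproj B' _) Pm) -h2 [m + w + _]addrC -addrA [y + _]addrC -addrA.
rewrite [w + y]addrC [m + _]addrCA [x + (y + _)]addrCA h1 rn_rep // xiD // sprojD //.
rewrite -(@ler_pXn2r _ 2) ?nnegrE ?rn_ge0 // rn_pythagoras //.
by rewrite lerDl sqr_ge0.
Qed.

Hypothesis d2 : (2 <= d)%N.

Lemma interior_neq0 : exists i, a 0 i != 0.
Proof.
apply/not_existsP => h; have a0 : a = 0.
  by apply/matrixP => i j; rewrite ord1 mxE; apply/eqP/contraT => /h.
have [N hN] := module_leave 0; have := hN N (leqnn N).
by rewrite a0 mul0rn subr0; case: PA.
Qed.

(** Move [q] by [k] steps in a direction [c] of [P] independent of [a], then along multiples of [a]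
    to just inside the boundary of [A]: the translated ball lies in [A], while subtracting [3 a]
    takes each of its points out of [A]. The linear form [phi] vanishes on [a] and equals [kappa] at
    [c], so it tells the translates for different [k] apart. *)
Lemma escaping_translates : exists (r : R) (phi : 'rV[R]_d -> R) (kappa : R),
  [/\ 0 < r, 0 < kappa & forall q k, exists y m (B' : set (borel 'rV[R]_d)),
    let B := A `&` ball q r in
    [/\ P y, P m, measurable B' & B' `<=` A] /\
    [/\ forall z, B' z -> ~ A (z - a *+ 3), moved y B = moved m B' &
        forall z, B' z -> `|phi z - phi q - kappa * k%:R| < kappa / 2]].
Proof.
have [i ai0] := interior_neq0.
have [j ji] : exists j, j != i.
  have [->|i0] := eqVneq i (Ordinal (ltnW d2)); first by exists (Ordinal d2).
  by exists (Ordinal (ltnW d2)); rewrite eq_sym.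
pose c : 'rV[R]_d := a + delta_mx 0 j.
have Pc' : P c.
  apply: a1; apply: norm_coord_le => // k; rewrite mxE eqxx /=.
  by case: (k == j); rewrite ?normr1 ?normr0.
pose phi (y : 'rV[R]_d) := a 0 i * (a 0 i * y 0 j - a 0 j * y 0 i).
have phiD y z : phi (y + z) = phi y + phi z by rewrite /phi !mxE; ring.
have phiM (n : nat) y : phi (y *+ n) = phi y * n%:R.
  by elim: n => [|n IH]; [rewrite mulr0n /phi !mxE; ring|rewrite mulrSr phiD IH -[n.+1]addn1 natrD; ring].
have phia : phi a = 0 by rewrite /phi; ring.
have phic : phi c = a 0 i ^+ 2.
  by rewrite /phi !mxE /= !eqxx eq_sym (negbTE ji) /=; ring.
pose s := `|a 0 i| + `|a 0 j|.
have ai : 0 < `|a 0 i| by rewrite normr_gt0.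
have s0 : 0 < s by rewrite ltr_wpDr.
(* The radius is at most 1, so that [a + w] is in [P] for [|w| < r], and so small that
   [|phi w| < kappa / 2] there. *)
exists (Num.min 1 (`|a 0 i| / (2 * s))), phi, (a 0 i ^+ 2); set r := Num.min _ _.
have r0 : 0 < r by rewrite lt_min ltr01 divr_gt0 // mulr_gt0.
have phir y : `|y| < r -> `|phi y| < a 0 i ^+ 2 / 2.
  rewrite lt_min => /andP[_ yr]; rewrite /phi normrM -real_normK ?num_real //.
  rewrite expr2 -mulrA ltr_pM2l //; apply: le_lt_trans (_ : s * `|y| < _).
    rewrite mulrDl; apply: le_trans (ler_normB _ _) _; rewrite !normrM.
    by apply: lerD; rewrite ler_wpM2l // coord_norm_le.
  move: yr; rewrite !ltr_pdivlMr ?mulr_gt0 //.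
  by have -> : s * `|y| * 2 = `|y| * (2 * s) by ring.
have ar y : `|y| < r -> P (a + y).
  by rewrite lt_min => /andP[/ltW h _]; exact: a1.
split=> // [|q k]; first by rewrite exprn_even_gt0.
have [N hN] := module_leave (q + c *+ k).
pose p n : 'rV[R]_d := q + c *+ k - a *+ N + a *+ n.
have ex : exists n, `[< A (p n) >].
  have [M hM] : exists M, P (p M).
    have [M hM] := interior_absorb (p 0%N); exists M.
    by have := hM M (leqnn M); rewrite /p mulr0n addr0 addrC.
  by exists M; apply/asboolP; have [_ _ A0 hA] := PA; rewrite -[p M]add0r; exact: hA.
(* [n] is least with [p n] in [A], and positive since the choice of [N] puts [p 0] outside. The
   translated ball is centred at [p (n + 1)]: one step [a] absorbs the radius. For [z] at offset [w]
   from this centre, [z - 3 a] leads by the step [a - w] of [P] to [p (n - 1)], which is not in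
   [A]. *)
have [n /asboolP An nmin] := ex_minnP ex.
have n0 : (0 < n)%N.
  rewrite lt0n; apply/eqP => n0; apply: (hN N (leqnn N)).
  by move: An; rewrite n0 /p mulr0n addr0.
have An1 : ~ A (p n.-1).
  by move=> h; have := nmin n.-1 (asboolT h); rewrite leqNgt ltn_predL n0.
pose y := c *+ k + a *+ n.+1.
exists y, (a *+ N), (moved (y - a *+ N) (A `&` ball q r)) => B.
have Bq z : B z -> `|z - q| < r by move=> [_]; rewrite -ball_normE /ball_ /= distrC.
have mB : measurable (B : set (borel 'rV[R]_d)).
  by apply: measurableI => //; apply: open_borel; exact: ball_open.
split; split.
- by apply: coneD => //; exact: coneMn.
- exact: coneMn.
- exact: moved_measurable.
- move=> z /Bq h; have [_ _ _ hA] := PA.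
  have -> : z = p n + (a + (z - (y - a *+ N) - q)).
    by rewrite /p /y mulrSr; apply/matrixP => u v; rewrite !mxE; ring.
  by apply: hA => //; exact: ar.
- move=> z /Bq h Az; apply: An1; have [_ _ _ hA] := PA.
  have -> : p n.-1 = z - a *+ 3 + (a - (z - (y - a *+ N) - q)).
    rewrite /p /y -{2}(prednK n0) !mulrSr; apply/matrixP => u v; rewrite !mxE; ring.
  by apply: hA => //; apply: ar; rewrite normrN.
- apply/funext => z; rewrite /moved /shiftv /=.
  by congr (B _); rewrite /B opprB addrA subrK.
- move=> z /Bq h; have := phir _ h.
  have phiB (b b' : 'rV[R]_d) : phi (b - b') = phi b - phi b' by rewrite /phi !mxE; ring.
  rewrite 2!phiB phiB /y phiD !phiM phia phic.
  by congr (`|_| < _); ring.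
Qed.

(* Infinitely many disjoint translates carry at least the mass of [xi x] on a
   small ball, whereas [xi (a *+ 3)] has finite norm. *)
Lemma additive_cocycle_eq0 x : P x -> xi x = 0.
Proof.
move=> Px; have [r [phi [kappa [r0 kappa0 h]]]] := escaping_translates.
apply: (sproj_cover r0) => q.
have /choice[y hy] := h q.
have /choice[m hm] := hy.
have /choice[B' hB] := hm.
pose B : set (borel 'rV[R]_d) := A `&` ball q r.
have mball : measurable (ball q r : set (borel 'rV[R]_d)).
  by apply: open_borel; exact: ball_open.
have mB : measurable B by apply: measurableI.
have -> : sproj (ball q r : set (borel 'rV[R]_d)) (xi x) = sproj B (xi x).
  by apply: sproj_ext => // z Az; split=> [[]|].
(* On [B' k] the values of [phi - phi q] are within [kappa / 2] of [kappa * k]; these bands do not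
   overlap. *)
have dB k l : k != l -> [disjoint B' k & B' l].
  move=> kl; apply/disj_setPS => z [zk zl].
  have [_ [_ _ /(_ _ zk) hk]] := hB k; have [_ [_ _ /(_ _ zl) hl]] := hB l.
  have : `|kappa * k%:R - kappa * l%:R| < kappa.
    have -> : kappa * k%:R - kappa * l%:R =
      (phi z - phi q - kappa * l%:R) - (phi z - phi q - kappa * k%:R) by ring.
    by apply: le_lt_trans (ler_normB _ _) _; lra.
  rewrite -mulrBr normrM gtr0_norm // -ltr_pdivlMl // mulVf ?gt_eqF //.
  have : (1 : R) <= `|k%:R - l%:R|.
    wlog lk : k l kl {zk zl hk hl} / (l < k)%N.
      move=> H; have [lk|lk|E] := ltngtP k l.
      - by rewrite distrC; apply: H => //; rewrite eq_sym.
      - exact: H.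
      - by rewrite E eqxx in kl.
    by rewrite -natrB ?(ltnW lk) // normr_nat ler1n subn_gt0.
  by lra.
have key n : n%:R * rn (sproj B (xi x)) ^+ 2 <= rn (xi (a *+ 3)) ^+ 2.
  apply: le_trans (sproj_bessel n (xi (a *+ 3)) _ dB); last by move=> k; have [[]] := hB k.
  rewrite -{1}[n]card_ord -sum1_card natr_sum mulr_suml; apply: ler_sum => k _.
  have [[Py Pm mB' BA'] [Bw E _]] := hB k.
  rewrite mul1r ler_pXn2r ?nnegrE ?rn_ge0 //.
  by apply: (@cocycle_transfer _ _ _ (y k) (m k)) => //; [exact: coneMn|move=> z []].
apply/eqP/contraT => /rn_gt0 X0; have X2 := exprn_gt0 2 X0.
have /andP[_] := truncn_itv (divr_ge0 (sqr_ge0 (rn (xi (a *+ 3)))) (ltW X2)).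
by rewrite ltr_pdivrMr // ltNge key.
Qed.

End additive_cocycle.

End interior_point.

End associated_representation.

(** * The parametrization of the gauge group *)

Section phase_estimates.
Context {R : realType} {d : nat}.
Implicit Types (l x y : 'rV[R]_d).

Lemma dotv_le l x : `|dotv l x| <= d%:R * (`|l| * `|x|).
Proof.
apply: le_trans (ler_norm_sum _ _ _) _; rewrite mulr_natl -[X in _ <= _ *+ X]card_ord -sumr_const.
apply: ler_sum => i _; rewrite normrM ler_pM ?normr_ge0 //; exact: coord_norm_le.
Qed.

(** Used at [x = a], where both arguments lie in [P], to read the coordinates of [l] off its values
    on [P]. *)
Lemma coord_dotv l x j : l 0 j = dotv l (x + delta_mx 0 j) - dotv l x.
Proof.
rewrite dotvDr addrC addKr /dotv (bigD1 j) //= big1 ?addr0 => [|k kj].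
  by rewrite mxE !eqxx mulr1.
by rewrite mxE (negbTE kj) andbF mulr0.
Qed.

Lemma delta_norm_le (j : 'I_d) : `|delta_mx 0 j : 'rV[R]_d| <= 1.
Proof.
apply: norm_coord_le => // k; rewrite mxE eqxx /=.
by case: (k == j); rewrite ?normr1 ?normr0.
Qed.

Lemma phase_sub_le (s t : R) : rn (phase s - phase t) = rn (phase (s - t) - 1).
Proof.
have -> : phase s - phase t = phase t * (phase (s - t) - 1).
  by rewrite mulrBr mulr1 -phaseD [t + _]addrC subrK.
by rewrite rnM rn_phase mul1r.
Qed.

(* If [|m|] exceeds [r <= 1], then [t = r / |m|] gives [|phase r - 1|], a positive
   constant. *)
Lemma phase_segment (ep : R) : 0 < ep -> exists2 delta, 0 < delta &
  forall m : R, (forall t : R, 0 <= t <= 1 -> rn (phase (t * m) - 1) <= delta) -> `|m| <= ep.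
Proof.
move=> ep0; pose r := Num.min ep 1.
have r0 : 0 < r by rewrite lt_min ep0 ltr01.
have ph0 : 0 < rn (phase r - 1).
  apply: rn_gt0; apply/eqP => h; have : complex.Im (phase r - 1) = 0 by rewrite h.
  rewrite phaseE /= subr0; apply/eqP; rewrite gt_eqF // sin_gt0_pi // r0 /=.
  have /= := @pihalf_ge1 R; have : r <= 1 by rewrite ge_min lexx orbT.
  have := @pi_gt0 R; lra.
exists (rn (phase r - 1) / 2) => [|m hm]; first by rewrite divr_gt0.
rewrite leNgt; apply/negP => mep.
have rm : r < `|m| by apply: le_lt_trans mep; rewrite ge_min lexx.
have m0 : 0 < `|m| := lt_trans r0 rm.
have := hm (r / `|m|); rewrite divr_ge0 ?normr_ge0 ?(ltW r0) // ler_pdivrMr // mul1r (ltW rm) => /(_ erefl).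
have -> : rn (phase (r / `|m| * m) - 1) = rn (phase r - 1).
  have [mp|mn] := ltrP 0 m.
    by rewrite gtr0_norm // mulfVK // gt_eqF.
  rewrite ler0_norm // invrN mulrN mulNr mulfVK; last by rewrite -normr_gt0.
  have -> : phase (- r) - 1 = - (phase (- r) * (phase r - 1)).
    by rewrite mulrBr mulr1 -phaseD addNr phase0 opprB.
  by rewrite rnN rnM rn_phase mul1r.
by lra.
Qed.

End phase_estimates.

Section gauge_parametrization.
Context {R : realType} {d : nat} {P : set 'rV[R]_d} {H : hilbertType R}.
Variables (F : fock_space H) (W : 'rV[R]_d -> bop H).
Variable alph : 'rV[R]_d -> bop F -> bop F.
Hypothesis Pc : convex_cone P.
Hypothesis Wiso : forall x, P x -> isometric (W x).
Hypothesis WD : forall x y, P x -> P y -> W (x + y) = W x * W y.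
Hypothesis Wcont : forall u x (e : R), P x -> 0 < e ->
  exists2 delta, 0 < delta & forall y, P y -> `|y - x| <= delta -> rn (W y u - W x u) <= e.
Hypothesis alphn : forall x, P x -> normal_map (alph x).
Hypothesis alphe : forall x, P x -> unital_star_endomorphism (alph x).
Hypothesis alphW : forall x, P x -> forall u, alph x (weyl F u) = weyl F (W x u).
Variables (a : 'rV[R]_d) (Pa : P a) (a1 : forall y, `|y| <= 1 -> P (a + y)).
Implicit Types (x y z : 'rV[R]_d) (u v w : H) (U : bop H) (l : 'rV[R]_d).

Local Notation E x := (W x * adj (W x)).
Local Notation E' x := (1 - W x * adj (W x)).
Local Notation e u := (expvec F u).
Local Notation Om := (vac F).

Definition commuting_unitary U := unitary U /\ forall x, P x -> U * W x = W x * U.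

Definition dilated U x := U * E' x + E x.

Definition gauge_of l U x := phase (dotv l x) *: second_quantization F (dilated U x).

Section one_unitary.
Variables (U : bop H) (cU : commuting_unitary U).

Lemma commute_adj x : P x -> adj U * W x = W x * adj U.
Proof.
move=> Px; have [[aU Ua] UW] := cU.
by rewrite -[adj U * W x]mulr1 -Ua mulrA -[adj U * W x * U]mulrA -UW // mulrA aU mul1r.
Qed.

Lemma commute_adj_rep x : P x -> U * adj (W x) = adj (W x) * U.
Proof.
by move=> Px; rewrite -[U in LHS]adjK -bop_adjM -commute_adj // bop_adjM adjK.
Qed.

Lemma commute_E x : P x -> U * E x = E x * U.
Proof. by move=> Px; rewrite mulrA (cU.2 x) // -mulrA commute_adj_rep // mulrA. Qed.

Lemma commute_E' x : P x -> U * E' x = E' x * U.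
Proof. by move=> Px; rewrite mulrBr mulrBl mulr1 mul1r commute_E. Qed.

Lemma dilated_unitary x : P x -> unitary (dilated U x).
Proof.
move=> Px; have [aU Ua] := cU.1.
have E'E : E' x * E x = 0 by rewrite mulrA (E'_rep Wiso) // mul0r.
have EE' : E x * E' x = 0 by exact: (E_E' Wiso).
have E'2 : E' x * E' x = E' x by exact: (E'_idem Wiso).
have E2 : E x * E x = E x by exact: (E_idem Wiso).
have E1 : E' x + E x = 1 by rewrite subrK.
have aE : adj U * E x = E x * adj U.
  by rewrite -{1}(adj_E W) -bop_adjM -commute_E // bop_adjM (adj_E W).
have aS : adj (dilated U x) = E' x * adj U + E x.
  by rewrite bop_adjD [adj (U * E' x)]bop_adjM (adj_E W) (adj_E' W).
have UE := commute_E Px; have UE' := commute_E' Px.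
rewrite /unitary aS /dilated.
(* The rest is algebra with two complementary idempotents [p] and [q] commuting with [U]. *)
move: (E x) (E' x) E'E EE' E'2 E2 E1 aE UE UE' => p q qp pq qq pp qp1 aE UE UE'.
split; rewrite mulrDl !mulrDr pp.
  rewrite -[q * adj U * (U * q)]mulrA [adj U * (U * q)]mulrA aU mul1r qq.
  by rewrite -[q * adj U * p]mulrA aE [q * (p * _)]mulrA qp mul0r addr0 UE' mulrA pq mul0r add0r.
rewrite -[U * q * (q * adj U)]mulrA [q * (q * adj U)]mulrA qq mulrA UE' -mulrA Ua mulr1.
rewrite -[q * U * p]mulrA UE mulrA qp mul0r addr0.
by rewrite mulrA pq mul0r add0r.
Qed.

Lemma dilated_rep x u : P x -> dilated U x (W x u) = W x u.
Proof.
move=> Px; rewrite /dilated bopDE !bopME -[E' x (W x u)]bopME (E'_rep Wiso) //.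
by rewrite bop0E bop_0 add0r (rep_adjK Wiso).
Qed.

Lemma dilated_perp x w : P x -> adj (W x) w = 0 -> dilated U x w = U w.
Proof.
by move=> Px w0; rewrite /dilated bopDE !bopME bopBE bop1E bopME w0 !bop_0 subr0 addr0.
Qed.

Lemma rn_dilated x u : P x -> rn (dilated U x u) = rn u.
Proof. by move=> Px; apply: isometric_rn; apply: unitary_isometric; exact: dilated_unitary. Qed.

Lemma gauge_of_exp l x u : P x -> gauge_of l U x (e u) = phase (dotv l x) *: e (dilated U x u).
Proof.
by move=> Px; rewrite /gauge_of bopZE (second_quantizationP F (dilated_unitary Px)).2.
Qed.

Lemma gauge_of_vac l x : P x -> gauge_of l U x Om = phase (dotv l x) *: Om.
Proof. by move=> Px; rewrite /vac gauge_of_exp // bop_0. Qed.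

Lemma gauge_of_unitary l x : P x -> unitary (gauge_of l U x).
Proof.
move=> Px; apply: unitaryZ; first exact: rn_phase.
exact: (second_quantizationP F (dilated_unitary Px)).1.
Qed.

Lemma adj_commute_perp x w : P x -> adj (W x) w = 0 -> adj (W x) (U w) = 0.
Proof. by move=> Px w0; rewrite -bopME -commute_adj_rep // bopME w0 bop_0. Qed.

Lemma gauge_of_commute l x T : P x -> gauge_of l U x * alph x T = alph x T * gauge_of l U x.
Proof.
move=> Px; apply: (@exp_ext _ _ F) => v.
pose w := E' x v; have w0 : adj (W x) w = 0 by exact: (adj_rep_E'0 Wiso).
have [J Je JT] := perp_intertwiner Wiso alphn alphe alphW Px w0.
have [J' Je' JT'] := perp_intertwiner Wiso alphn alphe alphW Px (adj_commute_perp Px w0).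
have GJ : gauge_of l U x * J = phase (dotv l x) *: J'.
  apply: (@exp_ext _ _ F) => u; rewrite bopME Je gauge_of_exp // bopZE Je'.
  by rewrite bop_D dilated_rep // dilated_perp.
have -> : e v = J (e (adj (W x) v)) by rewrite Je -(E'_decomp W x v).
have {}GJ xi : gauge_of l U x (J xi) = phase (dotv l x) *: J' xi by rewrite -bopME GJ.
have {}JT xi : alph x T (J xi) = J (T xi) by rewrite -bopME JT.
by rewrite !bopME JT !GJ bop_Z -bopME -JT'.
Qed.

Lemma gauge_of_cocycle l x y : P x -> P y ->
  gauge_of l U x * alph x (gauge_of l U y) = gauge_of l U (x + y).
Proof.
move=> Px Py; apply: (@exp_ext _ _ F) => v; have Pxy := coneD Pc Px Py.
pose w := E' x v; have w0 : adj (W x) w = 0 by exact: (adj_rep_E'0 Wiso).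
have [J Je JT] := perp_intertwiner Wiso alphn alphe alphW Px w0.
rewrite [RHS]gauge_of_exp // bopME.
have -> : e v = J (e (adj (W x) v)) by rewrite Je -(E'_decomp W x v).
rewrite -[alph x _ (J _)]bopME JT bopME gauge_of_exp // bop_Z Je bop_Z gauge_of_exp //.
rewrite scalerA -phaseD dotvDr addrC; congr (_ *: e _).
rewrite bop_D dilated_rep // dilated_perp // /dilated /w WD // bop_adjM.
rewrite !bopDE !bopME !bopBE !bop1E !bopME !bop_D !bop_N.
have UW (z : H) : U (W x z) = W x (U z) by rewrite -!bopME cU.2.
by rewrite !UW addrA subrKA.
Qed.

End one_unitary.

Section joint_continuity.
Variables (U0 : bop H) (l0 : 'rV[R]_d) (x : 'rV[R]_d).
Hypotheses (cU0 : commuting_unitary U0) (Px : P x).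

(** A neighbourhood of [U0] in the strong operator topology enters through a finite list [s] of test
    vectors. *)
Definition jointly_continuous (xi : F) := forall ep : R, 0 < ep ->
  exists2 delta, 0 < delta & exists s : seq H, forall l U y,
    commuting_unitary U -> P y -> `|y - x| <= delta -> `|l - l0| <= delta ->
    (forall u, u \in s -> rn (U u - U0 u) <= delta) ->
    rn (gauge_of l U y xi - gauge_of l0 U0 x xi) <= ep.

Lemma jointly_continuousD xi eta :
  jointly_continuous xi -> jointly_continuous eta -> jointly_continuous (xi + eta).
Proof.
move=> jx je ep ep0; have ep2 : 0 < ep / 2 by lra.
have [d1 d10 [s1 h1]] := jx _ ep2; have [d2 d20 [s2 h2]] := je _ ep2.
exists (Num.min d1 d2); first by rewrite lt_min d10 d20.
exists (s1 ++ s2) => l U y cU Py; rewrite !le_min => /andP[y1 y2] /andP[l1 l2] hs.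
have h3 u : u \in s1 -> rn (U u - U0 u) <= d1.
  by move=> us; have := hs u; rewrite mem_cat us le_min => /(_ erefl) /andP[].
have h4 u : u \in s2 -> rn (U u - U0 u) <= d2.
  by move=> us; have := hs u; rewrite mem_cat us orbT le_min => /(_ erefl) /andP[].
have := h1 l U y cU Py y1 l1 h3; have := h2 l U y cU Py y2 l2 h4.
rewrite !bop_D opprD addrACA => k1 k2; apply: le_trans (rn_triangle _ _) _; lra.
Qed.

Lemma jointly_continuousZ c xi : jointly_continuous xi -> jointly_continuous (c *: xi).
Proof.
move=> jx ep ep0; have c0 : 0 < rn c + 1 by have := rn_ge0 c; lra.
have [d1 d10 [s1 h1]] := jx _ (divr_gt0 ep0 c0); exists d1 => //; exists s1 => l U y cU Py yd ld hs.
have := h1 l U y cU Py yd ld hs; rewrite !bop_Z -scalerBr rnZ ler_pdivlMr //.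
by have := rn_ge0 (gauge_of l U y xi - gauge_of l0 U0 x xi); lra.
Qed.

(** The dilated unitaries differ at [v] by [(E_y - E_x) v - U (E_y - E_x) v + (U - U0) E'_x v]. As
    [U] is isometric, continuity of [E] handles the first two terms, and [E'_x v] is the only test
    vector. *)
Lemma jointly_continuous_exp v : jointly_continuous (e v).
Proof.
move=> ep ep0; pose r := 1 + rn v; have v0 := rn_ge0 v.
have r1 : 1 <= r by rewrite lerDl.
pose C := 2 * r * expR (4 * r ^+ 2).
have C0 : 0 < C by rewrite mulr_gt0 ?expR_gt0 //; lra.
have ev0 := rn_ge0 (e v).
have [d1 d10 ph] := phase_small (divr_gt0 ep0 (mulr_gt0 (ltr0Sn R 1) (ltr_wpDl ev0 ltr01))).
(* [rn_expB] bounds the squared distance of exponential vectors by [C] times that of their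
   arguments; [t] is the distance that keeps it below [(ep / 2)^2]. *)
pose t := (ep / 2) ^+ 2 / C.
have t0 : 0 < t by rewrite divr_gt0 // exprn_gt0 //; lra.
have t4 : 0 < t / 4 by lra.
have [d2 d20 Ec] := E_cont Pc Wiso WD Wcont Pa a1 v Px t4.
pose D := d%:R * (`|x| + 1 + `|l0|) + 1 : R.
have D0 : 0 < D.
  have : 0 <= d%:R * (`|x| + 1 + `|l0|) by rewrite mulr_ge0 ?addr_ge0.
  by rewrite /D; lra.
pose delta := Num.min (Num.min 1 d2) (Num.min (t / 2) (d1 / D)).
exists delta; first by rewrite !lt_min ltr01 d20 divr_gt0 // divr_gt0.
exists [:: E' x v] => l U y cU Py; rewrite /delta !le_min.
move=> /andP[/andP[y1 y2] /andP[y3 y4]] /andP[/andP[l1 l2] /andP[l3 l4]] hs.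
have {}hs : rn (U (E' x v) - U0 (E' x v)) <= t / 2.
  by have := hs _ (mem_head _ _); rewrite !le_min => /andP[_ /andP[]].
rewrite !gauge_of_exp //; set p := phase _; set p0 := phase _.
have pp : rn (p - p0) * rn (e v) <= ep / 2.
  have h : rn (p - p0) <= ep / (2 * (rn (e v) + 1)).
    rewrite phase_sub_le; apply: ph.
    have -> : dotv l y - dotv l0 x = dotv (l - l0) y + dotv l0 (y - x).
      rewrite dotvBl [dotv l0 (y - x)]/dotv.
      under [X in _ = _ + X]eq_bigr => i _ do rewrite !mxE mulrBr.
      by rewrite sumrB -/(dotv l0 y) -/(dotv l0 x) addrA subrK.
    apply: le_trans (ler_normD _ _) _; apply: le_trans (lerD (dotv_le _ _) (dotv_le _ _)) _.
    have yn : `|y| <= `|x| + 1.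
      by rewrite -[y](subrK x) addrC; apply: le_trans (ler_normD _ _) _; rewrite lerD2l.
    have tau0 : 0 <= d1 / D by rewrite divr_ge0 // ltW.
    apply: (@le_trans _ _ (d%:R * (d1 / D * (`|x| + 1)) + d%:R * (`|l0| * (d1 / D)))).
      by apply: lerD; rewrite ler_wpM2l // ?ler_pM // ler_wpM2l.
    have -> : d%:R * (d1 / D * (`|x| + 1)) + d%:R * (`|l0| * (d1 / D)) = d1 / D * (D - 1).
      have -> : D - 1 = d%:R * (`|x| + 1 + `|l0|) by rewrite /D addrK.
      by ring.
    by rewrite mulrBr mulfVK ?gt_eqF // mulr1; lra.
  apply: le_trans (ler_wpM2r ev0 h) _.
  rewrite mulrAC ler_pdivrMr ?mulr_gt0 //; last lra.
  by have := mulr_ge0 (ltW ep0) ev0; nra.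
have dd : rn (e (dilated U y v) - e (dilated U0 x v)) <= ep / 2.
  rewrite -(@ler_pXn2r _ 2) ?nnegrE ?rn_ge0 //; last lra.
  apply: le_trans (@rn_expB _ _ _ _ _ r r1 _ _) _; rewrite ?rn_dilated ?lerDr //.
  rewrite -/C mulrC -ler_pdivlMr //.
  have -> : dilated U y v - dilated U0 x v =
      (E y v - E x v) - U (E y v - E x v) + (U (E' x v) - U0 (E' x v)).
    rewrite /dilated !bopDE !bopME !bopBE !bop1E !bopME !bop_B.
    rewrite !opprB !opprD [RHS](AC ((2*2)*(2*(1*1))) (((5*4)*1)*((8*7)*2)*(6*3))).
    by rewrite opprK /= -[U (E x v)]/(U (W x (adj (W x) v))) addNr addr0.
  have Un w : rn (U w) = rn w by apply: isometric_rn; apply: unitary_isometric; exact: cU.1.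
  apply: le_trans (rn_triangle _ _) _; rewrite -/t.
  have := rn_triangleB (E y v - E x v) (U (E y v - E x v)); rewrite Un.
  have := Ec y Py y2; lra.
have -> : p *: e (dilated U y v) - p0 *: e (dilated U0 x v) =
    (p - p0) *: e (dilated U y v) + p0 *: (e (dilated U y v) - e (dilated U0 x v)).
  by rewrite scalerBl scalerBr addrA subrK.
apply: le_trans (rn_triangle _ _) _; rewrite !rnZ rn_phase mul1r.
have -> : rn (e (dilated U y v)) = rn (e v).
  by apply/eqP; rewrite -(@eqrXn2 _ 2) ?rn_ge0 // !rn_exp rn_dilated.
lra.
Qed.

(** All [gauge_of l U y] involved are isometric, so the property passes from combinations of
    exponential vectors to their limits. *)
Lemma jointly_continuous_all xi : jointly_continuous xi.
Proof.
move=> ep ep0; have ep3 : 0 < ep / 3 by lra.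
have [s hs] := ortho_total_dense (@exp_total _ _ F) xi ep3.
have : jointly_continuous (comb (expvec F) s).
  rewrite /comb; elim: (s) => [|q s' IH].
    rewrite big_nil => e' e0'; exists 1 => //; exists [::] => *.
    by rewrite !bop_0 subr0 rn0 ltW.
  rewrite big_cons; apply: jointly_continuousD => //; apply: jointly_continuousZ.
  exact: jointly_continuous_exp.
move=> /(_ _ ep3) [delta d0 [s' h]]; exists delta => //; exists s' => l U y cU Py yd ld hs'.
have := h l U y cU Py yd ld hs'; set eta := comb _ s in hs *.
have -> : gauge_of l U y xi - gauge_of l0 U0 x xi = gauge_of l U y (xi - eta) +
    (gauge_of l U y eta - gauge_of l0 U0 x eta) - gauge_of l0 U0 x (xi - eta).
  by rewrite !bop_B opprB !subrKA.
have n1 (z : F) : rn (gauge_of l U y z) = rn z.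
  by apply: isometric_rn; apply: unitary_isometric; exact: gauge_of_unitary.
have n2 (z : F) : rn (gauge_of l0 U0 x z) = rn z.
  by apply: isometric_rn; apply: unitary_isometric; exact: gauge_of_unitary.
move=> k; apply: le_trans (rn_triangleB _ _) _; rewrite n2.
have := rn_triangle (gauge_of l U y (xi - eta)) (gauge_of l U y eta - gauge_of l0 U0 x eta).
by rewrite n1; lra.
Qed.

End joint_continuity.

Lemma phase_of_gauge l l0 U U0 x : commuting_unitary U -> commuting_unitary U0 -> P x ->
  rn (gauge_of l U x Om - gauge_of l0 U0 x Om) = rn (phase (dotv l x) - phase (dotv l0 x)).
Proof. by move=> cU cU0 Px; rewrite !gauge_of_vac // -scalerBl rnZ rn_vac mulr1. Qed.

(** The vacuum yields the phase, and [e(E'_x u)] goes to that phase times [e(U E'_x u)], from which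
    [rn_sub_le_exp] recovers [U E'_x u]. The rest [V_x V_x^* u] costs [ep / 4] for each of [U] and
    [U0]. *)
Lemma unitary_of_gauge l0 U0 u x (ep : R) : commuting_unitary U0 -> P x -> 0 < ep ->
  rn (adj (W x) u) <= ep / 4 ->
  exists2 delta, 0 < delta & forall l U, commuting_unitary U ->
    rn (gauge_of l U x Om - gauge_of l0 U0 x Om) <= delta ->
    rn (gauge_of l U x (e (E' x u)) - gauge_of l0 U0 x (e (E' x u))) <= delta ->
    rn (U u - U0 u) <= ep.
Proof.
move=> cU0 Px ep0 hu; set v := E' x u.
have ev0 := rn_ge0 (e v).
have D0 : 0 < 2 * (rn (e v) + 1) by lra.
(* With this [delta] the two hypotheses contribute at most [delta * (|e v| + 1) = ep / 2]. *)
exists (ep / (2 * (rn (e v) + 1))) => [|l U cU]; first by rewrite divr_gt0.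
rewrite phase_of_gauge // !gauge_of_exp // !ler_pdivlMr //.
have v0 : adj (W x) v = 0 by exact: (adj_rep_E'0 Wiso).
rewrite !dilated_perp //; set p := phase _; set p0 := phase _ => h1 h2.
have Un w : rn (U w) = rn w by apply: isometric_rn; apply: unitary_isometric; exact: cU.1.
have U0n w : rn (U0 w) = rn w by apply: isometric_rn; apply: unitary_isometric; exact: cU0.1.
have h3 : rn (U v - U0 v) <= rn (p - p0) * rn (e v) + rn (p *: e (U v) - p0 *: e (U0 v)).
  apply: le_trans (rn_sub_le_exp F _ _) _.
  have <- : rn (p0 *: (e (U v) - e (U0 v))) = rn (e (U v) - e (U0 v)).
    by rewrite rnZ rn_phase mul1r.
  have -> : p0 *: (e (U v) - e (U0 v)) =
      (p0 - p) *: e (U v) + (p *: e (U v) - p0 *: e (U0 v)).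
    by rewrite scalerBl scalerBr addrA subrK.
  apply: le_trans (rn_triangle _ _) _; rewrite rnZ (rnB p0 p).
  suff -> : rn (e (U v)) = rn (e v) by [].
  by apply/eqP; rewrite -(@eqrXn2 _ 2) ?rn_ge0 // !rn_exp Un.
have uv : rn (u - v) <= ep / 4.
  have -> : u - v = W x (adj (W x) u) by rewrite /v bopBE bop1E opprB addrC subrK.
  by rewrite (isometric_rn _ (Wiso Px)).
have -> : U u - U0 u = U (u - v) + (U v - U0 v) - U0 (u - v).
    rewrite (bop_B U) (bop_B U0) opprB.
  by rewrite !subrKA.
apply: le_trans (rn_triangleB _ _) _; rewrite U0n.
have := rn_triangle (U (u - v)) (U v - U0 v); rewrite Un => h4.
have := rn_ge0 (p - p0); have := rn_ge0 (p *: e (U v) - p0 *: e (U0 v)); nra.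
Qed.

Lemma gauge_of_inj l l0 U U0 : commuting_unitary U -> commuting_unitary U0 ->
  (forall u (ep : R), 0 < ep -> exists n, rn (adj (W (a *+ n)) u) <= ep) ->
  (forall x, P x -> gauge_of l U x = gauge_of l0 U0 x) -> l = l0 /\ U = U0.
Proof.
move=> cU cU0 pure GG; split; last first.
  apply: bop_ext => u; apply/eqP; rewrite -subr_eq0; apply/eqP; apply: rn_le_eps => ep ep0.
  have ep4 : 0 < ep / 4 by lra.
  have [n hn] := pure u _ ep4; have Pn := coneMn Pc n Pa.
  have [delta d0 h] := unitary_of_gauge l0 cU0 Pn ep0 hn.
  by apply: (h l U cU); rewrite GG // subrr rn0 ltW.
have lP x : P x -> dotv l x = dotv l0 x.
  move=> Px; apply: phase_scaled_inj => t t0 t1; rewrite -!dotvZr.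
  have Ptx := coneZ Pc (ltW t0) Px.
  apply/eqP; rewrite -subr_eq0; apply/eqP/rn0_eq0.
  by rewrite -(phase_of_gauge l l0 cU cU0 Ptx) GG // subrr rn0.
apply/matrixP => i j; rewrite ord1.
rewrite (coord_dotv l a) (coord_dotv l0 a) !lP //; apply: a1; exact: delta_norm_le.
Qed.

End gauge_parametrization.

(** * Topologies *)

Section strong_operator_topology.
Context {R : realType} {H : hilbertType R}.
Implicit Types (S T U : bop H).

Lemma entourage_rn (e : R) : 0 < e ->
  entourage [set xy : H * H | rn (xy.1 - xy.2) < e].
Proof.
move=> e0; rewrite -entourage_ballE; exists e%:C => /=; first by rewrite ltr_ReC.
by move=> [x y] /=; rewrite -ball_normE /ball_ /= normE ltr_ReC.
Qed.

Lemma entourage_rnP (E : set (H * H)) : entourage E ->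
  exists2 e : R, 0 < e & forall x y, rn (x - y) <= e -> E (x, y).
Proof.
rewrite -entourage_ballE => -[e /= e0 eE]; have ee := ge0_ReC (ltW e0).
have e0' : 0 < complex.Re e by rewrite -ltr_ReC -ee.
exists (complex.Re e / 2) => [|x y xy]; first by lra.
apply: eE; rewrite /= -ball_normE /ball_ /= normE ee ltr_ReC; lra.
Qed.

Lemma entourage_sot u (e : R) : 0 < e ->
  entourage [set ST : bop H * bop H | rn (ST.1 u - ST.2 u) < e].
Proof.
move=> e0.
exists [set fg : {ptws H -> H} * {ptws H -> H} | rn (fg.1 u - fg.2 u) < e] => //.
pose D : set ({ptws H -> H} * {ptws H -> H}) := [set fg | rn (fg.1 u - fg.2 u) < e].
have entD : @entourage (initial_topology (@proj H (fun=> H) u)) D.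
  by exists [set xy : H * H | rn (xy.1 - xy.2) < e] => //; exact: entourage_rn.
exists D => //.
unshelve refine (ex_intro2 _ _ (finmap.fset1 (exist _ (u : {classic H}, D) ?[pf])) _ _).
- exact: asboolT entD.
- by move=> p _; exact: in_setT.
rewrite eqEsubset; split=> fg /=.
  by move=> /(_ _ (finmap.fset11 _)).
by move=> h p /= /finmap.fset1P ->.
Qed.

(** A basic entourage of pointwise convergence constrains finitely many vectors, and finitely many
    radii have a positive minimum. *)
Lemma entourage_sotP (E : set (bop H * bop H)) : entourage E ->
  exists (s : seq H) (e : R), 0 < e /\
    forall S T, (forall u, u \in s -> rn (S u - T u) <= e) -> E (S, T).
Proof.
move=> [B [_ [/= D _ <-] DB] BE].
suff [s [e [e0 h]]] : exists (s : seq H) (e : R), 0 < e /\ forall S T : bop H,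
    (forall u, u \in s -> rn (S u - T u) <= e) ->
    forall p, p \in finmap.enum_fset D -> (projT1 p).2 (S : {ptws H -> H}, T : {ptws H -> H}).
  exists s, e; split => // S T ST; apply: BE; apply: DB => p pD; exact: (h _ _ ST).
elim: (finmap.enum_fset D) => [|[[u C] /= entC] l [s [e [e0 IH]]]].
  by exists [::], 1; split => // S T _ p; rewrite in_nil.
have /asboolP [/= Z /entourage_rnP [e' e'0 he'] ZC] := entC.
exists (u :: s), (Num.min e e'); split; first by rewrite lt_min e0.
move=> S T ST p; rewrite inE => /orP[/eqP ->|pl] /=.
  apply: ZC; apply: he'; have := ST _ (mem_head _ _).
  by rewrite le_min => /andP[].
apply: IH pl => v vs; have := ST v; rewrite inE vs orbT le_min => /(_ erefl) /andP[].
by [].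
Qed.

Lemma sot_cvg (F : set_system (bop H)) (FF : Filter F) (S : bop H) :
  (forall u (e : R), 0 < e -> F [set T | rn (T u - S u) <= e]) -> F --> S.
Proof.
move=> h A; rewrite -nbhs_entourageE => -[E entE EA].
have [s [e [e0 hE]]] := entourage_sotP entE.
have : F [set T | forall u, u \in s -> rn (T u - S u) <= e].
  elim: s {hE} => [|u s IH]; first by apply: filterS filterT => T _ u; rewrite in_nil.
  apply: filterS2 IH (h u e e0) => T h1 h2 v; rewrite inE => /orP[/eqP ->|] //.
  exact: h1.
apply: filterS => T hT; apply: EA; apply/xsectionP; apply: hE => u us.
by rewrite rnB; exact: hT.
Qed.

Lemma sot_nbhs (S : bop H) u (e : R) : 0 < e -> nbhs S [set T : bop H | rn (T u - S u) <= e].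
Proof.
move=> e0; have := nbhs_entourage S (entourage_sot u e0).
by apply: filterS => T /xsectionP /= h; rewrite rnB ltW.
Qed.

End strong_operator_topology.

Section subtype_families.
Context {R : realType} {d : nat} {P : set 'rV[R]_d}.

(* Families over the type of elements of [P] become functions of vectors, with
   the junk value [t0] off [P]. *)
Definition extend (T : Type) (t0 : T) (f : P -> T) (x : 'rV[R]_d) : T :=
  oapp f t0 (insub x).

Lemma extendE (T : Type) (t0 : T) (f : P -> T) (x : P) : extend t0 f (val x) = f x.
Proof. by rewrite /extend valK. Qed.

Lemma element_ex x : P x -> exists p : P, val p = x.
Proof. by move=> Px; exists (exist _ x (mem_set Px)). Qed.

Lemma elementP (p : P) : P (val p).
Proof. exact: set_mem (valP p). Qed.

Lemma nbhs_element (p : P) (e : R) : 0 < e -> nbhs p [set q : P | `|val q - val p| <= e].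
Proof.
move=> e0; have := @initial_continuous P _ set_val p.
move=> /(_ [set x | `|x - val p| <= e]); apply.
apply/nbhs_ballP; exists e => //= y; rewrite -ball_normE /ball_ /= distrC.
exact: ltW.
Qed.

Lemma nbhs_elementP (p : P) (B : set P) : nbhs p B ->
  exists2 e : R, 0 < e & forall q : P, `|val q - val p| <= e -> B q.
Proof.
move=> [_ /= [[C oC <-] Cp CB]].
have /nbhs_ballP [e /= e0 eC] : nbhs (val p) C by apply: open_nbhs_nbhs.
exists (e / 2) => [|q qp]; first lra.
by apply/CB/eC; rewrite -ball_normE /ball_ /= distrC; lra.
Qed.

Context {H : hilbertType R} (S : set {family compact, P -> bop H}).

(** Uniform convergence on compact sets for the strong operator uniformity: each entourage involves
    finitely many vectors, each handled by the hypothesis. *)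
Lemma gauge_continuous (Y : topologicalType) (f : Y -> S) :
  (forall y0 (K : set P) (u : H) (e : R), compact K -> 0 < e ->
    \forall y \near y0, forall x, K x -> rn (val (f y) x u - val (f y0) x u) <= e) ->
  continuous f.
Proof.
move=> h; apply: continuous_comp_initial => y0.
apply/fam_cvgP => K cK B /uniform_nbhs [E [entE EB]].
have [s [e [e0 hE]]] := entourage_sotP entE.
have : nbhs y0 [set y | forall u, u \in s -> forall x, K x ->
    rn (val (f y) x u - val (f y0) x u) <= e].
  elim: s {hE} => [|u s IH]; first by apply: filterS filterT => T _ u; rewrite in_nil.
  apply: filterS2 IH (h y0 K u e cK e0) => y h1 h2 v; rewrite inE => /orP[/eqP ->|] //.
  exact: h1.
apply: filterS => y hy; apply: EB => x Kx; apply: hE => u us.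
by rewrite rnB; exact: hy.
Qed.

Lemma gauge_nbhs (G0 : S) (K : set P) (u : H) (e : R) : compact K -> 0 < e ->
  nbhs G0 [set G : S | forall x, K x -> rn (val G x u - val G0 x u) <= e].
Proof.
move=> cK e0.
have h : nbhs (val G0 : {family compact, P -> bop H})
    [set h | forall x, K x -> rn ((h : P -> bop H) x u - (val G0 : P -> bop H) x u) <= e].
  have /fam_cvgP := @cvg_id _ (nbhs (val G0 : {family compact, P -> bop H})).
  move=> /(_ K cK) hK.
  suff /hK : nbhs (val G0 : {uniform` K -> bop H})
    [set h | forall x, K x -> rn ((h : P -> bop H) x u - (val G0 : P -> bop H) x u) <= e] by [].
  apply/uniform_nbhs.
  exists [set ST : bop H * bop H | rn (ST.1 u - ST.2 u) < e]; split.
    exact: entourage_sot.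
  by move=> g hg x /hg /= /ltW; rewrite rnB.
exact: (@initial_continuous S _ set_val G0 _ h).
Qed.

End subtype_families.

Section commutants.
Context {R : realType} {H : hilbertType R}.
Implicit Types (N : set (bop H)) (T U : bop H).

Lemma commutant3 N : commutant (commutant (commutant N)) = commutant N.
Proof.
apply/seteqP; split=> T h S hS; last exact/esym/hS.
by apply: h => S' hS'; rewrite hS'.
Qed.

Lemma unitary_commute_adj U T : unitary U -> U * T = T * U -> adj U * T = T * adj U.
Proof.
move=> [aU Ua] UT.
by rewrite -[adj U * T]mulr1 -Ua mulrA -[adj U * T * U]mulrA -UT mulrA aU mul1r.
Qed.

(* The commutant of [U] and [adj U] is a von Neumann algebra. *)
Lemma unitary_commutant N U : unitary U ->
  commutant (generated_vN N) U <-> forall T, N T -> T * U = U * T.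
Proof.
move=> uU; split=> [h T NT|h T]; first by apply: h => N' _ NN'; exact: NN'.
pose N' := commutant [set U; adj U].
have vN' : von_neumann_algebra N'.
  split=> [S hS V|]; last exact: commutant3.
  move=> [->|->].
    by rewrite -[U in LHS]adjK -bop_adjM -hS ?bop_adjM ?adjK //; right.
  by rewrite -!bop_adjM hS //; left.
move=> /(_ _ vN') hT; apply/esym; apply: hT; last by left.
move=> S NS V [->|->]; first exact/esym/h.
by apply: unitary_commute_adj => //; exact/esym/h.
Qed.

End commutants.

Section weak_continuity.
Context {R : realType} {d : nat} {P : set 'rV[R]_d} {H : hilbertType R}.
Variables (F : fock_space H) (V : P -> bop H) (alpha : P -> bop F -> bop F).
Hypothesis Viso : forall x, isometric (V x).
Hypothesis alphaV : forall x u, alpha x (weyl F u) = weyl F (V x u).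
Hypothesis alphac : forall T xi eta,
  continuous (fun x : P => inner (alpha x T xi) eta : R[i]^o).

(* The matrix coefficient of [alpha x (weyl F u)] between [Om] and [e (V x0 u)] is
   a multiple of [cexp <V x u, V x0 u>], whose modulus is maximal only if
   [V x u = V x0 u]. *)
Lemma CCR_strongly_continuous u (x0 : P) (e : R) : 0 < e ->
  exists2 delta : R, 0 < delta &
    forall x : P, `|val x - val x0| <= delta -> rn (V x u - V x0 u) <= e.
Proof.
move=> e0; pose N := rn u ^+ 2; pose c := expR (- (N / 2)).
pose f x : R[i]^o := inner (alpha x (weyl F u) (vac F)) (expvec F (V x0 u)).
have fE x : f x = c%:C * cexp (inner (V x u) (V x0 u)).
  rewrite /f alphaV weyl_vac innerZl inner_exp (isometric_rn _ (Viso x)) -/N.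
  by rewrite -rmorphN cexpC cjC.
(* [c = exp(- N / 2)] is the normalization of [W(u) Om]. If the coefficients differ by at most [ep],
   then [exp N - exp b >= exp(- N) (N - b)] gives [N - b <= e^2 / 2], and
   [|V_x u - V_x0 u|^2 = 2 (N - b)]. *)
pose ep := e ^+ 2 * expR (- N) * c / 2.
have ep0 : 0 < ep by rewrite divr_gt0 // !mulr_gt0 ?expR_gt0 ?exprn_gt0.
have epC : 0 < ep%:C by rewrite ltr_ReC.
have cf : f x @[x --> x0] --> f x0 by exact: alphac.
move/cvgrPdist_le: cf => /(_ _ epC) /nbhs_elementP [delta d0 h].
exists delta => // x /h; rewrite -/(f x) -/(f x0) normE ler_ReC !fE -mulrBr rnM rnC.
rewrite gtr0_norm ?expR_gt0 // (Viso x0) => {}h.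
set b := complex.Re (inner (V x u) (V x0 u)).
have hN : complex.Re (inner u u) = N by rewrite -rn_inner.
have bN : `|b| <= N.
  apply: le_trans (Re_le_rn _) _; apply: le_trans (cauchy_schwarz _ _) _.
  by rewrite !(isometric_rn _ (Viso _)).
have := Re_le_rn (cexp (inner u u) - cexp (inner (V x u) (V x0 u))).
have := rn_sub_le (cexp (inner u u)) (cexp (inner (V x u) (V x0 u))).
rewrite !rn_cexp hN -/b => h1 _.
have h2 : expR b * (1 + (N - b)) <= expR N.
  have -> : expR N = expR b * expR (N - b) by rewrite -expRD addrC subrK.
  by rewrite ler_wpM2l ?expR_ge0 // expR_ge1Dx.
have h3 : expR (- N) <= expR b.
  by rewrite ler_expR; move: bN; rewrite ler_norml => /andP[].
have h4 : 0 <= N - b by move: bN; rewrite ler_norml => /andP[_]; lra.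
have h5 : c * (expR (- N) * (N - b)) <= ep.
  apply: le_trans h; rewrite ler_wpM2l ?expR_ge0 //.
  by apply: le_trans (ler_wpM2r h4 h3) _; lra.
have h6 : 2 * (N - b) <= e ^+ 2.
  have cE : 0 < c * expR (- N) by rewrite mulr_gt0 ?expR_gt0.
  rewrite -(ler_pM2l cE); have -> : c * expR (- N) * e ^+ 2 = 2 * ep by rewrite /ep; field.
  have -> : c * expR (- N) * (2 * (N - b)) = 2 * (c * (expR (- N) * (N - b))) by ring.
  lra.
rewrite -(@ler_pXn2r _ 2) ?nnegrE ?rn_ge0 ?(ltW e0) // rn_sqrB !(isometric_rn _ (Viso _)) -/N -/b.
lra.
Qed.

End weak_continuity.

Section rays.
Context {R : realType} {d : nat} {P : set 'rV[R]_d}.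
Hypothesis Pc : convex_cone P.

Lemma segment_in_cone b : P b -> exists2 K : set P, compact K &
  forall t : R, 0 <= t <= 1 -> exists2 p, K p & val p = t *: b.
Proof.
move=> Pb.
(* The absolute value makes [t |-> |t| b] a continuous map of the whole line into [P], so that the
   image of [[0, 1]] is compact. *)
have Pt (t : R) : P (`|t| *: b) by apply: coneZ.
pose g (t : R) : P := exist _ (`|t| *: b) (mem_set (Pt t)).
have cg : continuous g.
  apply: continuous_comp_initial => t; apply: cvgZr_tmp.
  exact: norm_continuous.
exists (g @` `[0, 1]).
  apply: continuous_compact; last exact: segment_compact.
  exact: continuous_subspaceT.
move=> t /andP[t0 t1]; exists (g t); first by exists t => //=; rewrite in_itv /= t0.
by rewrite /= ger0_norm.
Qed.

End rays.

Theorem theorem2p7 (R : realType) (d : nat) (P A : set 'rV[R]_d)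
    (mu : {measure set (borel 'rV[R]_d) -> \bar R})
    (k : option nat) (K : hilbertType R) (L : L2_space mu A K)
    (V : P -> bop L) (F : fock_space L) (alpha : P -> bop F -> bop F) :
  (2 <= d)%N ->
  closed P -> convex_cone P -> pointed P -> spanning P ->
  is_module P A ->
  is_lebesgue mu ->
  k <> Some 0%N -> separable_space K -> has_dim K k ->
  associated_representation V ->
  CCR_flow V alpha ->
  let E (x : P) : bop L := V x * adj (V x) in
  let M : set (bop L) := commutant (generated_vN (range V)) in
  exists Phi : ('rV[R]_d * unitary_group M)%type -> gauge_group alpha,
    (forall (lambda : 'rV[R]_d) (U : unitary_group M) (x : P),
       val (Phi (lambda, U)) x =
       cexp (0 +i* dotv lambda (val x)) *:
         second_quantization F (val U * (1 - E x) + E x)) /\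
    homeomorphism Phi.

Proof.
move=> d2 _ Pc _ sP PA lmu _ _ _ hV [[alphaE alphaD alphaC] alphaW] E M.
have [a Pa a1] := cone_interior Pc sP.
pose W := extend (0 : bop L) V; pose alph := extend (fun _ : bop F => 0 : bop F) alpha.
have WE (p : P) : W (val p) = V p by exact: extendE.
have alphE (p : P) : alph (val p) = alpha p by exact: extendE.
have repW x f : P x -> square_integrable mu A f ->
    W x (L2_class L f) = L2_class L (translate A x f).
  by move=> /element_ex [p <-] sf; rewrite WE hV.
have Wiso : forall x, P x -> isometric (W x) := rep_isometric lmu PA repW.
have WD : forall x y, P x -> P y -> W (x + y) = W x * W y := repD lmu Pc PA repW.
have Viso p : isometric (V p) by rewrite -WE; apply: Wiso; exact: elementP.
(* The representation inherits strong continuity from the weak continuity of the flow. *)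
have Wcont u x (e : R) : P x -> 0 < e ->
    exists2 delta, 0 < delta & forall y, P y -> `|y - x| <= delta -> rn (W y u - W x u) <= e.
  move=> /element_ex [p <-] e0.
  have [delta d0 h] := CCR_strongly_continuous Viso alphaW alphaC u p e0.
  by exists delta => // _ /element_ex [q <-]; rewrite !WE; exact: h.
have alphn x : P x -> normal_map (alph x).
  by move=> /element_ex [p <-]; rewrite alphE; case: (alphaE p).
have alphe x : P x -> unital_star_endomorphism (alph x).
  by move=> /element_ex [p <-]; rewrite alphE; case: (alphaE p).
have alphW x : P x -> forall u, alph x (weyl F u) = weyl F (W x u).
  by move=> /element_ex [p <-] u; rewrite alphE WE.
have pure := rep_pure lmu Pc PA repW Pa a1.
have MU (U : unitary_group M) : commuting_unitary (P := P) W (val U).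
  have [MU uU] := set_valP U; split => // _ /element_ex [p <-]; rewrite WE.
  by apply/esym; apply: (unitary_commutant _ uU).1 MU _ _; exists p.
have UM (U : bop L) : commuting_unitary (P := P) W U -> unitary_group M U.
  move=> [uU UW]; split => //; apply/(unitary_commutant _ uU) => _ [p _ <-].
  by rewrite -WE UW //; exact: elementP.
have joint l (U : unitary_group M) (p : P) xi : jointly_continuous (F := F) (P := P) W (val U) l (val p) xi.
  exact: (jointly_continuous_all Pc Wiso WD Wcont Pa a1 l (MU U) (elementP p)).
have PhiP l (U : unitary_group M) :
    gauge_group alpha (fun x : P => gauge_of F W l (val U) (val x)).
  split.
  - move=> x; exact: (gauge_of_unitary F Wiso (MU U) l (elementP x)).
  - move=> x0; apply: (@sot_cvg _ _ _ (fmap_filter _ (nbhs_filter x0))) => xi e e0.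
    have [delta d0 [s h]] := joint l U x0 xi e e0.
    apply: filterS (nbhs_element x0 d0) => x xd /=.
    apply: h => //; [exact: MU|exact: elementP|by rewrite subrr normr0 ltW|].
    by move=> u _; rewrite subrr rn0 ltW.
  - move=> x y z xyz; rewrite xyz -alphE.
    exact: (gauge_of_cocycle Pc Wiso WD alphn alphe alphW (MU U) l (elementP x) (elementP y)).
  - move=> x T; rewrite -alphE.
    rewrite (gauge_of_commute Wiso alphn alphe alphW (MU U) l T (elementP x)) -mulrA.
    by have [_ ->] := gauge_of_unitary F Wiso (MU U) l (elementP x); rewrite mulr1.
pose Phi (p : 'rV[R]_d * unitary_group M) : gauge_group alpha :=
  exist (fun G => G \in gauge_group alpha) _ (mem_set (PhiP p.1 p.2)).
have PhiE p (x : P) : (val (Phi p) : P -> bop F) x = gauge_of F W p.1 (val p.2) (val x) by [].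
exists Phi; split; first by move=> l U x; rewrite PhiE /gauge_of /dilated WE.
have Phi_cont : continuous Phi.
  apply: gauge_continuous => -[l0 U0] C xi e cC e0; have e2 : 0 < e / 2 by lra.
  (* [joint] bounds the difference near each point of [C]; compactness turns this into a
     neighbourhood of [(l0, U0)] that works for all of [C]. *)
  apply: ((compact_near_coveringP C).1 cC _ (nbhs (l0, U0))
    (fun y x => rn (val (Phi y) x xi - val (Phi (l0, U0)) x xi) <= e)) => x _.
  (* [e / 2] is used twice: at a nearby [x'], both [(l, U)] and [(l0, U0)] are compared with
     [(l0, U0)] at [x]. *)
  have [delta d0 [s h]] := joint l0 U0 x xi _ e2.
  exists ([set x' : P | `|val x' - val x| <= delta],
    [set y : 'rV[R]_d * unitary_group M | `|y.1 - l0| <= delta /\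
       forall u, u \in s -> rn (val y.2 u - val U0 u) <= delta]); last first.
    move=> [x' [l U]] /= [xx' [ll hs]].
    have := h l (val U) (val x') (MU U) (elementP x') xx' ll hs.
    have := h l0 (val U0) (val x') (MU U0) (elementP x') xx'.
    rewrite subrr normr0 => /(_ (ltW d0)) h1.
    have {}h1 : rn (gauge_of F W l0 (val U0) (val x') xi - gauge_of F W l0 (val U0) (val x) xi) <= e / 2.
      by apply: h1 => u _; rewrite subrr rn0 ltW.
    move=> h2; apply: le_trans (rn_dist_triangle _ (gauge_of F W l0 (val U0) (val x) xi) _) _.
    rewrite [leRHS]splitr; apply: lerD; first exact: h2.
    rewrite rnB.
    exact: h1.
  split; first exact: nbhs_element.
  exists ([set l | `|l - l0| <= delta],
    [set U : unitary_group M | forall u, u \in s -> rn (val U u - val U0 u) <= delta]).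
    split => /=.
      apply/nbhs_ballP; exists delta => //= l; rewrite -ball_normE /ball_ /= distrC; exact: ltW.
    apply: (@initial_continuous (unitary_group M) _ set_val U0
      [set U : bop L | forall u, u \in s -> rn (U u - val U0 u) <= delta]).
    elim: s {h} => [|u s IH]; first by apply: filterS filterT => T _ u; rewrite in_nil.
    apply: filterS2 IH (sot_nbhs (val U0) u d0) => T h1 h2 v; rewrite inE => /orP[/eqP ->|] //.
    exact: h1.
  by move=> [l U] [].
have Phi_inj : injective Phi.
  move=> [l U] [l' U'] E'.
  have [||-> UU] := @gauge_of_inj _ _ P _ F W Pc Wiso a Pa a1 l l' _ _ (MU U) (MU U').
  - by move=> u ep ep0; have [N hN] := pure u ep ep0; exists N; apply: hN.
  - move=> _ /element_ex [p <-].
    by have := congr1 (fun G : gauge_group alpha => (val G : P -> bop F) p) E'; rewrite !PhiE.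
  by congr (_, _); exact: val_inj.
have Phi_surj (G : gauge_group alpha) : exists p, Phi p = G.
  have [GU Gc GM Gg] := set_valP G.
  pose Gx := extend (0 : bop F) (val G : P -> bop F).
  have GE (p : P) : Gx (val p) = (val G : P -> bop F) p by exact: extendE.
  have GU' x : P x -> unitary (Gx x) by move=> /element_ex [p <-]; rewrite GE.
  have GM' x y : P x -> P y -> Gx x * alph x (Gx y) = Gx (x + y).
    move=> Px Py; have /element_ex [r rE] := coneD Pc Px Py.
    move: Px Py rE => /element_ex [p <-] /element_ex [q <-] rE.
    by rewrite -rE !GE alphE; apply: GM.
  have Gcomm x T : P x -> Gx x * alph x T = alph x T * Gx x.
    move=> /element_ex [p <-]; rewrite GE alphE -[in RHS](Gg p T) -!mulrA.
    by have [-> _] := GU p; rewrite mulr1.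
  have Gcont xi x (e : R) : P x -> 0 < e -> exists2 delta, 0 < delta &
      forall y, P y -> `|y - x| <= delta -> rn (Gx y xi - Gx x xi) <= e.
    move=> /element_ex [p <-] e0.
    have /nbhs_elementP [delta d0 h] := Gc p _ (sot_nbhs ((val G : P -> bop F) p) xi e0).
    by exists delta => // _ /element_ex [q <-]; rewrite !GE; exact: h.
  have noadd (xi : 'rV[R]_d -> L) : (forall x, P x -> adj (W x) (xi x) = 0) ->
      (forall x y, P x -> P y -> xi (x + y) = xi x + W x (xi y)) ->
      forall x, P x -> xi x = 0.
    by move=> h1 h2 x Px; exact: (additive_cocycle_eq0 lmu Pc PA repW Pa a1 h1 h2 d2 Px).
  have [U [uU UW GF]] := gauge_form Pc Wiso WD Wcont alphn alphe alphW GU' GM' Gcomm Gcont noadd Pa pure.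
  have [||e e0|l hl] := cone_character Pc sP (c := chi Gx).
  - by move=> x y; exact: (chiD Wiso WD alphn alphe alphW GM' Gcomm).
  - by move=> x Px; exact: (rn_chi Pc Wiso WD alphn alphe alphW GU' GM' Gcomm Gcont noadd Px).
  - have [delta d0 h] := gauge_cont0 Pc Wiso WD alphn alphe alphW GU' GM' Gcomm Gcont (vac F) e0.
    by exists delta => // x Px xd; apply: le_trans (chi_sub1 _ _) _; exact: h.
  have cU : commuting_unitary (P := P) W U by [].
  pose UU : unitary_group M := exist _ U (mem_set (UM U cU)).
  exists (l, UU); apply: val_inj; apply/funext => p; rewrite -[RHS]GE.
  apply: (@exp_ext _ _ F) => u; rewrite PhiE (gauge_of_exp F Wiso cU) /=; last exact: elementP.
  have [_ ->] := GF _ (elementP p); rewrite hl //; exact: elementP.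
split=> //; have /choice[g gK] := Phi_surj.
exists g; split => //; first by move=> p; apply: Phi_inj; rewrite gK.
move=> G0 Q [[B1 B2] /= [n1 n2] BQ].
have GE (G : gauge_group alpha) (x : P) :
    (val G : P -> bop F) x = gauge_of F W (g G).1 (val (g G).2) (val x).
  by rewrite -PhiE gK.
(* The vacuum vector shows only phases; closeness at all [t b] with [t] in [[0, 1]], uniform on a
   compact segment, excludes jumps by multiples of [2 pi]. *)
have phase_near b (e : R) : P b -> 0 < e ->
    nbhs G0 [set G | `|dotv ((g G).1 - (g G0).1) b| <= e].
  move=> Pb e0; have [delta d0 h] := phase_segment e0.
  have [C cC Cb] := segment_in_cone Pc Pb.
  apply: filterS (gauge_nbhs G0 (vac F) cC d0) => G hG; apply: h => t t01.
  have [p Cp pE] := Cb t t01.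
  have := hG p Cp; rewrite !GE (phase_of_gauge F Wiso _ _ (MU _) (MU _) (elementP p)).
  by rewrite pE phase_sub_le -dotvBl dotvZr.
have near1 : nbhs G0 [set G | B1 (g G).1].
  have /nbhs_ballP [e /= e0 eB] := n1; have e4 : 0 < e / 4 by lra.
  have h (j : 'I_d) : nbhs G0 [set G | `|(g G).1 0 j - (g G0).1 0 j| <= e / 2].
    have Pj : P (a + delta_mx 0 j) by apply: a1; exact: delta_norm_le.
    apply: filterS2 (phase_near _ _ Pa e4) (phase_near _ _ Pj e4) => G h1 h2 /=.
    have -> : (g G).1 0 j - (g G0).1 0 j = ((g G).1 - (g G0).1) 0 j by rewrite !mxE.
    rewrite (coord_dotv _ a); apply: le_trans (ler_normB _ _) _.
    have -> : e / 2 = e / 4 + e / 4 by field.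
    exact: lerD.
  have : nbhs G0 [set G | forall j, `|(g G).1 0 j - (g G0).1 0 j| <= e / 2].
    exact: (filter_forall (nbhs_filter G0)).
  apply: filterS => G hG; apply: eB.
  rewrite -ball_normE /ball_ /= distrC; apply: le_lt_trans (_ : e / 2 < e); last lra.
  by apply: norm_coord_le => [|j]; [lra|have := hG j; rewrite !mxE].
have near2 : nbhs G0 [set G | B2 (g G).2].
  case: n2 => _ [[C oC <-] C0 CB].
  have hC : nbhs (val (g G0).2) C by apply: open_nbhs_nbhs.
  suff : (fun G => val (g G).2) @ nbhs G0 --> val (g G0).2.
    move=> /(_ _ hC) hG; apply: (filterS _ (hG : nbhs G0 _)) => G; exact: CB.
  apply: (@sot_cvg _ _ _ (fmap_filter _ (nbhs_filter G0))) => u e e0; have e4 : 0 < e / 4 by lra.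
  (* At the single point [N a] the vector [V_(Na)^* u] is small enough for [unitary_of_gauge], so a
     one-point compact set controls [U u]. *)
  have [N hN] := pure u _ e4; have PN := coneMn Pc N Pa.
  have [delta d0 h] := unitary_of_gauge F Wiso (g G0).1 (MU (g G0).2) PN e0 (hN _ (leqnn N)).
  have [p pE] := element_ex PN; rewrite -pE in h.
  have c1 : compact [set p] by exact: compact_set1.
  apply: filterS2 (gauge_nbhs G0 (vac F) c1 d0)
    (gauge_nbhs G0 (expvec F ((1 - W (val p) * adj (W (val p))) u)) c1 d0) => G h1 h2 /=.
  by apply: (h (g G).1 _ (MU _)); rewrite -!GE; [exact: h1|exact: h2].
by apply: filterS2 near1 near2 => G h1 h2; apply: BQ.
Qed.
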